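(* Let $X$ be a proper $\mathrm{CAT}(0)$-space and let $G<\mathrm{Iso}(X)$ be a non-elementary subgroup with limit set $\Lambda\subset\partial X$ which contains a rank-one element. Let $\Delta$ denote the diagonal of $\Lambda\times\Lambda$. Then: (1) $\Lambda$ is perfect (it has no isolated points), and the $G$-action on $\Lambda$ is minimal (every $G$-orbit in $\Lambda$ is dense in $\Lambda$). (2) Pairs of fixed points (in $\partial X$) of rank-one elements of $G$ are dense in $\Lambda\times\Lambda-\Delta$. (3) There is a dense orbit for the (diagonal) action of $G$ on $\Lambda\times\Lambda-\Delta$. (4) $G$ contains a free subgroup with two generators all of whose non-identity elements are rank-one.
   Context: A geodesic metric space is proper if closed balls of finite radius are compact. $\partial X$ is the visual boundary of $X$: the space of geodesic rays issuing from a fixed basepoint, with the topology of uniform convergence on bounded sets (independent of the basepoint); $X\cup\partial X$ is a compactification of $X$. $\mathrm{Iso}(X)$ is the isometry group of $X$; it acts on $\partial X$ by homeomorphisms. The limit set $\Lambda$ of a subgroup $G<\mathrm{Iso}(X)$ is the set of accumulation points in $\partial X$ of one (equivalently every) orbit of $G$ on $X$. $G$ is elementary if either its limit set consists of at most two points or $G$ fixes a point in $\partial X$; otherwise $G$ is non-elementary. An isometry $g$ is axial if the function $x\mapsto d(x,gx)$ attains a positive minimum on $X$; then there is a geodesic line $\gamma:\mathbb{R}\to X$ (an axis of $g$) with $g\gamma(t)=\gamma(t+\tau)$ for all $t$, where $\tau=\min_x d(x,gx)>0$. An axial isometry $g$ is rank-one if it has an axis which does not bound a flat half-plane, i.e.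 a totally geodesic embedded isometric copy in $X$ of a euclidean half-plane. A rank-one isometry has exactly two fixed points in $\partial X$, the endpoints $\gamma(\infty),\gamma(-\infty)$ of an axis, and for a rank-one element of $G$ these lie in $\Lambda$. *)

(* Defs.v *)
From HB Require Import structures.
From mathcomp Require Import all_boot all_order all_algebra.
From mathcomp Require Import all_classical all_reals all_analysis.

Set Implicit Arguments.
Unset Strict Implicit.
Unset Printing Implicit Defensive.

Import Order.TTheory GRing.Theory Num.Theory.

Local Open Scope classical_set_scope.
Local Open Scope ring_scope.

Section Subgroups.
Variable gT : groupType.
Implicit Types (G H : set gT) (a b : gT).

Definition subgroup G : Prop := group_closed [in G].

(* A letter (i, e) stands for a (i = true) or b (i = false), inverted when
   e = false. *)
Definition letter a b (l : bool * bool) : gT :=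
  let g := if l.1 then a else b in if l.2 then g else (g^-1)%g.

Definition reduced_word (w : seq (bool * bool)) : bool :=
  sorted (fun l l' => l' != (l.1, ~~ l.2)) w.

Definition free_on a b H : Prop :=
  H = smallest subgroup [set a; b] /\
  forall w, reduced_word w -> w != [::] ->
    foldr (fun l g => (letter a b l * g)%g) 1%g w <> 1%g.

Definition free_of_rank2 H : Prop := exists a b, free_on a b H.

End Subgroups.

Section IsometryGroup.
Variables (R : realType) (X : metricType R).

Record isom := Isom {
  isom_fun :> X -> X ;
  isom_dist : forall x y, mdist (isom_fun x) (isom_fun y) = mdist x y ;
  isom_surj : forall y, exists x, isom_fun x = y }.

Lemma isomP (f g : isom) : (f : X -> X) = g -> f = g.
Proof.
case: f g => [f fd fs] [g gd gs] /= fg; move: fd fs; rewrite {}fg => fd fs.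
by congr Isom; exact: Prop_irrelevance.
Qed.

Definition isom_one : isom :=
  @Isom idfun (fun _ _ => erefl) (fun y => ex_intro _ y erefl).

Lemma isom_mul_dist (f g : isom) x y : mdist (f (g x)) (f (g y)) = mdist x y.
Proof. by rewrite !isom_dist. Qed.

Lemma isom_mul_surj (f g : isom) y : exists x, f (g x) = y.
Proof.
have [z <-] := isom_surj f y; have [x <-] := isom_surj g z.
by exists x.
Qed.

Definition isom_mul (f g : isom) : isom :=
  @Isom (f \o g) (isom_mul_dist f g) (isom_mul_surj f g).

Definition isom_inv_fun (f : isom) (y : X) : X := sval (cid (isom_surj f y)).

Lemma isom_inv_funK (f : isom) : cancel (isom_inv_fun f) f.
Proof. by move=> y; rewrite /isom_inv_fun; case: cid. Qed.

Lemma isom_funK (f : isom) : cancel f (isom_inv_fun f).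
Proof.
move=> x; apply: (@mdist_positivity R).
by rewrite -(isom_dist f) isom_inv_funK mdistxx.
Qed.

Lemma isom_inv_dist (f : isom) x y :
  mdist (isom_inv_fun f x) (isom_inv_fun f y) = mdist x y.
Proof. by rewrite -(isom_dist f) !isom_inv_funK. Qed.

Lemma isom_inv_surj (f : isom) y : exists x, isom_inv_fun f x = y.
Proof. by exists (f y); rewrite isom_funK. Qed.

Definition isom_inv (f : isom) : isom :=
  @Isom (isom_inv_fun f) (isom_inv_dist f) (isom_inv_surj f).

Lemma isom_mulA : associative isom_mul.
Proof. by move=> f g h; exact: isomP. Qed.

Lemma isom_mul1g : left_id isom_one isom_mul.
Proof. by move=> f; exact: isomP. Qed.

Lemma isom_mulg1 : right_id isom_one isom_mul.
Proof. by move=> f; exact: isomP. Qed.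

Lemma isom_mulVg : left_inverse isom_one isom_inv isom_mul.
Proof. by move=> f; apply/isomP/funext => x /=; rewrite isom_funK. Qed.

Lemma isom_mulgV : right_inverse isom_one isom_inv isom_mul.
Proof. by move=> f; apply/isomP/funext => x /=; rewrite isom_inv_funK. Qed.

HB.instance Definition _ := gen_eqMixin isom.
HB.instance Definition _ := gen_choiceMixin isom.
HB.instance Definition _ := isGroup.Build isom
  isom_mulA isom_mul1g isom_mulg1 isom_mulVg isom_mulgV.

End IsometryGroup.

Section CAT0.
Variables (R : realType) (X : metricType R).

Definition proper_space : Prop :=
  forall (x : X) (r : R), compact [set y | mdist x y <= r].

(* The euclidean distance of the plane; the one that R * R carries in the
   library is the sup distance. *)
Definition edist (p q : R * R) : R :=
  Num.sqrt ((p.1 - q.1) ^+ 2 + (p.2 - q.2) ^+ 2).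

(* The geodesic segment from x to y, extended by the constant y beyond its
   length. *)
Definition segment (x y : X) (c : {nonneg R} -> X) : Prop :=
  [/\ c 0%:nng = x,
      forall t, mdist x y <= t%:num -> c t = y &
      forall s t, s%:num <= mdist x y -> t%:num <= mdist x y ->
        mdist (c s) (c t) = `|s%:num - t%:num|].

Definition geodesic_space : Prop := forall x y : X, exists c, segment x y c.

(* Two points on different sides of a geodesic triangle lie on sides that
   issue from a common vertex, here x; for two points on the same side the
   comparison inequality is an equality. The hypotheses on p and q say that
   they are the points of the comparison sides [x', y'] and [x', z'] at
   distances s and t from x'. *)
Definition cat0 : Prop :=
  geodesic_space /\
  forall (x y z : X) (c d : {nonneg R} -> X), segment x y c -> segment x z d ->
  forall x' y' z' : R * R,
    edist x' y' = mdist x y -> edist y' z' = mdist y z ->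
    edist x' z' = mdist x z ->
  forall (s t : {nonneg R}) (p q : R * R),
    edist x' p = s%:num -> edist p y' = mdist x y - s%:num ->
    edist x' q = t%:num -> edist q z' = mdist x z - t%:num ->
  mdist (c s) (d t) <= edist p q.

End CAT0.

Arguments proper_space {R} X.
Arguments cat0 {R} X.

Section RankOne.
Variables (R : realType) (X : metricType R).
Implicit Types (g : isom X) (c : R -> X).

Definition min_displacement g (tau : R) : Prop :=
  (exists x, mdist x (g x) = tau) /\ forall x, tau <= mdist x (g x).

Definition axial g : Prop := exists2 tau, 0 < tau & min_displacement g tau.

Definition geodesic_line c : Prop :=
  forall s t, mdist (c s) (c t) = `|s - t|.

Definition axis g c : Prop :=
  geodesic_line c /\
  exists tau, [/\ 0 < tau, min_displacement g tau &
                  forall t, g (c t) = c (t + tau)].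

(* F is only relevant on the half-plane 0 <= p.2; in a CAT(0) space the image
   of an isometric embedding of it is totally geodesic. *)
Definition bounds_flat_half_plane c : Prop :=
  exists F : R * R -> X,
    (forall p q, 0 <= p.2 -> 0 <= q.2 -> mdist (F p) (F q) = edist p q) /\
    forall t, F (t, 0) = c t.

Definition rank_one g : Prop :=
  axial g /\ exists2 c, axis g c & ~ bounds_flat_half_plane c.

End RankOne.

Section Boundary.
Variables (R : realType) (X : metricType R).

(* Maps from the half-line to X, with the topology of uniform convergence on
   bounded sets. *)
Definition curve : Type :=
  {family (fun A : set {nonneg R} => exists r : R, forall t, A t -> t%:num <= r),
     {nonneg R} -> X}.

HB.instance Definition _ := Uniform.on curve.

Variable o : X.
Implicit Types (xi eta : curve) (g : isom X) (G : set (isom X)).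

(* The visual boundary as the set of geodesic rays issuing from o. Together
   with the segments issuing from o, which stand for their endpoints, it is
   the compactification of X; its topology is that of curve. *)
Definition boundary : set curve :=
  [set xi | xi 0%:nng = o /\
    forall s t, mdist (xi s) (xi t) = `|s%:num - t%:num|].

Definition asymptotic xi eta : Prop :=
  exists K : R, forall t, mdist (xi t) (eta t) <= K.

(* In a complete CAT(0) space there is exactly one ray issuing from o that is
   asymptotic to g \o xi, so that the default value is not used. *)
Definition bd_act g xi : curve :=
  xget (g \o xi : curve)
    [set eta | boundary eta /\ asymptotic eta (g \o xi : curve)].

Definition bd_fixed g : set curve :=
  [set xi | boundary xi /\ bd_act g xi = xi].

Definition orbit_in_compactification G : set curve :=
  [set c | exists2 g, G g & segment o (g o) c].

Definition limit_set G : set curve :=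
  boundary `&` limit_point (orbit_in_compactification G).

Definition elementary G : Prop :=
  (limit_set G #<= `I_2)%card \/
  exists2 xi, boundary xi & forall g, G g -> bd_act g xi = xi.

Definition bd_orbit G xi : set curve := [set bd_act g xi | g in G].

Definition bd_orbit2 G (p : curve * curve) : set (curve * curve) :=
  [set (bd_act g p.1, bd_act g p.2) | g in G].

Definition rank_one_fixed_pairs G : set (curve * curve) :=
  [set p | p.1 <> p.2 /\
    exists g, [/\ G g, rank_one g, bd_fixed g p.1 & bd_fixed g p.2]].

End Boundary.

Definition dense_in {T : topologicalType} (S A : set T) : Prop :=
  A `<=` S /\ S `<=` closure A.

Definition off_diagonal {T : Type} (A : set T) : set (T * T) :=
  [set p | [/\ A p.1, A p.2 & p.1 <> p.2]].

(* Main.v *)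
Require Import Defs.
From mathcomp Require Import all_boot all_order all_algebra.
From mathcomp Require Import all_classical all_reals all_analysis.
From mathcomp Require Import ring lra.

Set Implicit Arguments.
Unset Strict Implicit.
Unset Printing Implicit Defensive.

Import Order.TTheory GRing.Theory Num.Theory.
Import numFieldNormedType.Exports Defs.

Local Open Scope classical_set_scope.
Local Open Scope ring_scope.

(** The flat strip theorem shows that the lines parallel to the axis c of a
    rank-one isometry stay at bounded distance w from c, for otherwise the wide
    strips converge, after translation and along an ultrafilter, to a flat
    half-plane bounded by c. With properness this replaces hyperbolicity along
    c: geodesics from c 0 to points which project far out on c fellow-travel
    with c, and segments whose ends project far apart pass close to c. Hence a
    rank-one isometry acts on the boundary with north-south dynamics.
    Conversely, let g map the complement of U into V, where segments from U to
    V pass through a fixed ball and V is far away. Then the segments from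
    g^-n x to g^n x all meet that ball, so the displacement of g attains its
    infimum, and no axis of g bounds a half-plane: g is rank-one. Minimality
    and density of the pairs of fixed points come from the dynamics and from
    this criterion applied to b^m a^-n, where a and b are rank-one with poles
    near prescribed points. A point with a dense orbit is built as the limit of
    a nested sequence of neighbourhoods, and Schottky half-spaces for powers of
    two independent rank-one elements give the free subgroup. *)

(** * Comparison and convexity *)

(** The width bound concerns complete lines parallel to [c], while the dynamics requires statements
    on segments. The limits taken to bridge this gap need not be lines: points at a fixed distance
    along segments towards far points converge only to a 1-Lipschitz curve along half of [c], and
    translations by the isometry are used once more to straighten it.

    All constants come from arguments by contradiction, so positions are known only up to bounded
    errors. This is enough because rays from [o] at distance [C] at radius [t] are at distance at
    most [r / t * C] at radius [r]: an estimate up to a constant at every radius amounts to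
    convergence.

    The ping-pong sets are half-spaces of [X] cut out by projection to axes, not subsets of the
    boundary. The criterion has to find a point of minimal displacement in [X], and an isometry
    translating an axis adds exactly [tau] to projections, so pushing half-spaces involves no error
    at all. *)

Section Plane.
Variable R : realType.
Implicit Types p q r : R * R.

Lemma edist_ge0 p q : 0 <= edist p q.
Proof. exact: sqrtr_ge0. Qed.

Lemma edist_sqr p q : edist p q ^+ 2 = (p.1 - q.1) ^+ 2 + (p.2 - q.2) ^+ 2.
Proof. by rewrite sqr_sqrtr// addr_ge0// sqr_ge0. Qed.

Lemma edist_eq p q (a : R) : 0 <= a ->
  (p.1 - q.1) ^+ 2 + (p.2 - q.2) ^+ 2 = a ^+ 2 -> edist p q = a.
Proof. by move=> a0 h; rewrite /edist h sqrtr_sqr ger0_norm. Qed.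

(** The side of length [a] is put on the first axis; [u] is then the abscissa of the third vertex by
    the law of cosines, and both bounds on [u] come from factored differences of squares that the
    triangle inequalities make nonnegative. *)
Lemma comparison_triangle (a b c : R) : 0 <= a -> 0 <= b -> 0 <= c ->
  a <= b + c -> b <= a + c -> c <= a + b ->
  exists x y z : R * R, [/\ edist x y = a, edist y z = c & edist x z = b].
Proof.
move=> a0 b0 c0 abc bac cab.
have [a00|an0] := eqVneq a 0.
  exists (0, 0), (0, 0), (b, 0); split; apply: edist_eq => //=; rewrite ?a00; try ring.
  have -> : c = b by apply/eqP; rewrite eq_le; apply/andP; split; lra.
  ring.
have agt0 : 0 < a by rewrite lt_neqAle eq_sym an0.
pose u := (a ^+ 2 + b ^+ 2 - c ^+ 2) / (2 * a).
have ua : 2 * a * u = a ^+ 2 + b ^+ 2 - c ^+ 2 by rewrite /u; field.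
have ub : u ^+ 2 <= b ^+ 2.
  have u1 : u <= b.
    rewrite -(ler_pM2l (_ : 0 < 2 * a)) ?mulr_gt0// ua.
    have : 0 <= (c - a + b) * (c + a - b) by apply: mulr_ge0; lra.
    nra.
  have u2 : - b <= u.
    rewrite -(ler_pM2l (_ : 0 < 2 * a)) ?mulr_gt0// ua.
    have : 0 <= (a + b - c) * (c + a + b) by apply: mulr_ge0; lra.
    nra.
  nra.
exists (0, 0), (a, 0), (u, Num.sqrt (b ^+ 2 - u ^+ 2)).
have v2 : Num.sqrt (b ^+ 2 - u ^+ 2) ^+ 2 = b ^+ 2 - u ^+ 2.
  by rewrite sqr_sqrtr// subr_ge0.
by split; apply: edist_eq => //=; [ring|nra|nra].
Qed.

End Plane.

Section Basics.
Variables (R : realType) (X : metricType R).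
Implicit Types (x y z p q : X) (l s t : R).
Local Notation d := (@mdist R X).

Definition between l x y p := d x p = l * d x y /\ d p y = (1 - l) * d x y.

Hypothesis Xcat0 : cat0 X.

(** Stewart's theorem is an identity in the plane; comparing a point of one side with the far end of
    the other, that is with the opposite vertex, carries it over as an inequality. The comparison
    axiom is applied only here. *)
Lemma stewart_segment x y z (c : {nonneg R} -> X) l (s : {nonneg R}) :
  segment x y c -> 0 <= l <= 1 -> s%:num = l * d x y ->
  d z (c s) ^+ 2 <= (1 - l) * d z x ^+ 2 + l * d z y ^+ 2
    - l * (1 - l) * d x y ^+ 2.
Proof.
move=> xyc /andP[l0 l1] sl.
have [e xze] := Xcat0.1 x z.
have [x' [y' [z' [xy yz xz]]]] :=
  @comparison_triangle R (d x y) (d x z) (d y z) (mdist_ge0 _ _) (mdist_ge0 _ _)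
    (mdist_ge0 _ _) ltac:(rewrite (metric_sym y z); exact: metric_triangle)
    (metric_triangle _ _ _) ltac:(rewrite (metric_sym x y); exact: metric_triangle).
pose p := (x'.1 + l * (y'.1 - x'.1), x'.2 + l * (y'.2 - x'.2)).
have dxy := edist_sqr x' y'; have dyz := edist_sqr y' z'.
have dxz := edist_sqr x' z'.
have := @Xcat0.2 x y z c e xyc xze x' y' z' xy yz xz s (NngNum (mdist_ge0 x z)) p z'.
have -> : e (NngNum (mdist_ge0 x z)) = z by case: xze => _ -> //=.
move=> H; have {}H : d z (c s) <= edist p z'.
  rewrite metric_sym; apply: H => //=.
  - apply: edist_eq; first exact: ge0.
    by rewrite sl exprMn -xy dxy /p /=; ring.
  - have -> : d x y - s%:num = (1 - l) * d x y by rewrite sl; ring.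
    apply: edist_eq; first by rewrite mulr_ge0 ?mdist_ge0 ?subr_ge0.
    by rewrite exprMn -xy dxy /p /=; ring.
  - rewrite subrr; apply: edist_eq => //; ring.
have H2 : d z (c s) ^+ 2 <= edist p z' ^+ 2.
  by rewrite lerXn2r ?nnegrE ?mdist_ge0 ?edist_ge0.
apply: (le_trans H2); rewrite (metric_sym z x) (metric_sym z y) -xy -yz -xz.
rewrite dxy dyz dxz edist_sqr /p /=.
by rewrite le_eqVlt; apply/orP; left; apply/eqP; ring.
Qed.

Lemma segment_dist x y (c : {nonneg R} -> X) (s : {nonneg R}) :
  segment x y c -> s%:num <= d x y -> d x (c s) = s%:num.
Proof.
move=> [c0 _ cdist] sd; rewrite -[in LHS]c0 cdist//; last exact: mdist_ge0.
by rewrite /= add0r normrN ger0_norm.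
Qed.

(** Point and inequality are produced together, because the uniqueness that extends the inequality
    to every such point is itself deduced from it. *)
Lemma between_exists x y l : 0 <= l <= 1 -> exists p, between l x y p /\
  forall z, d z p ^+ 2 <= (1 - l) * d z x ^+ 2 + l * d z y ^+ 2
    - l * (1 - l) * d x y ^+ 2.
Proof.
move=> l01; have /andP[l0 l1] := l01; have [c xyc] := Xcat0.1 x y.
have s0 : 0 <= l * d x y by rewrite mulr_ge0 ?mdist_ge0.
have sd : l * d x y <= d x y by rewrite ler_piMl ?mdist_ge0.
exists (c (NngNum s0)); split; last by move=> z; exact: (stewart_segment _ xyc).
have [c0 cd cdist] := xyc; split.
  exact: (segment_dist xyc (s := NngNum s0)).
have := cdist (NngNum s0) (NngNum (mdist_ge0 x y)) sd (lexx _).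
rewrite (cd (NngNum (mdist_ge0 x y)))//= ler0_norm ?subr_le0// opprB => ->.
by rewrite mulrBl mul1r.
Qed.

Lemma sqr_le0_eq x y : d x y ^+ 2 <= 0 -> x = y.
Proof.
move=> h; apply: (@mdist_positivity R); apply/eqP; rewrite -sqrf_eq0.
by rewrite eq_le h sqr_ge0.
Qed.

Lemma between_unique l x y p q : 0 <= l <= 1 -> between l x y p ->
  between l x y q -> p = q.
Proof.
move=> l01; have /andP[l0 l1] := l01.
have [m [_ mT]] := between_exists x y l01.
(* For [z := p'] the right side of the inequality vanishes. *)
have eqm p' : between l x y p' -> p' = m.
  move=> [h1 h2]; apply: sqr_le0_eq; apply: (le_trans (mT p')).
  rewrite (metric_sym p' x) h1 h2 !exprMn.
  by rewrite le_eqVlt; apply/orP; left; apply/eqP; ring.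
by move=> /eqm -> /eqm ->.
Qed.

Lemma stewart l x y p z : 0 <= l <= 1 -> between l x y p ->
  d z p ^+ 2 <= (1 - l) * d z x ^+ 2 + l * d z y ^+ 2
    - l * (1 - l) * d x y ^+ 2.
Proof.
move=> l01 bp; have [m [bm mT]] := between_exists x y l01.
by rewrite (between_unique l01 bp bm).
Qed.

Definition pnt l x y : X := xget x [set p | between l x y p].

Lemma pntP l x y : 0 <= l <= 1 -> between l x y (pnt l x y).
Proof.
move=> l01; rewrite /pnt; case: xgetP => // h.
by have [m [bm _]] := between_exists x y l01; have := h m bm.
Qed.

Lemma pnt_unique l x y p : 0 <= l <= 1 -> between l x y p -> p = pnt l x y.
Proof. by move=> l01 h; apply: (between_unique l01 h); exact: pntP. Qed.

Lemma pnt_sym l x y : 0 <= l <= 1 -> pnt (1 - l) y x = pnt l x y.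
Proof.
move=> /andP[l0 l1]; apply: pnt_unique; first by rewrite l0.
have [h1 h2] : between (1 - l) y x (pnt (1 - l) y x) by apply: pntP; lra.
split; first by rewrite metric_sym h2 (metric_sym y x); ring.
by rewrite metric_sym h1 (metric_sym y x).
Qed.

(* Two instances of Stewart's inequality; the terms in [d p x] and [d q x]
   cancel. *)
Lemma pnt_thales l x y z : 0 <= l <= 1 ->
  d (pnt l x y) (pnt l x z) <= l * d y z.
Proof.
move=> l01; have /andP[l0 l1] := l01.
set p := pnt l x y; set q := pnt l x z.
have bp : between l x y p by exact: pntP.
have bq : between l x z q by exact: pntP.
have h1 := stewart q l01 bp; have h2 := stewart y l01 bq.
rewrite -(@ler_pXn2r _ 2) ?nnegrE ?mulr_ge0 ?mdist_ge0//.
rewrite metric_sym; apply: (le_trans h1).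
have -> : d q y ^+ 2 = d y q ^+ 2 by rewrite metric_sym.
have : l * d y q ^+ 2 <= l * ((1 - l) * d y x ^+ 2 + l * d y z ^+ 2
    - l * (1 - l) * d x z ^+ 2) by exact: ler_wpM2l.
rewrite (metric_sym q x) bq.1 (metric_sym y x) !exprMn; nra.
Qed.

Lemma pnt_convex l x y x' y' : 0 <= l <= 1 ->
  d (pnt l x y) (pnt l x' y') <= (1 - l) * d x x' + l * d y y'.
Proof.
move=> l01; apply: le_trans (metric_triangle _ (pnt l x y') _) _.
rewrite addrC lerD ?pnt_thales// -(pnt_sym x) // -(pnt_sym x')//.
by apply: pnt_thales; move: l01 => /andP[? ?]; lra.
Qed.

Lemma pnt0 x y : pnt 0 x y = x.
Proof.
apply/esym/pnt_unique; first by rewrite lexx ler01.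
by split; rewrite ?mdistxx ?mul0r// subr0 mul1r.
Qed.

Lemma pnt1 x y : pnt 1 x y = y.
Proof.
apply/esym/pnt_unique; first by rewrite lexx ler01.
by split; rewrite ?mdistxx ?mul1r// subrr mul0r.
Qed.

(** Arc-length version of [pnt]. For [x = y] the quotient is zero by convention and the point is
    [x], so degenerate segments are covered. *)
Definition alg x y t : X := pnt (t / d x y) x y.

Lemma alg_frac x y t : 0 <= t <= d x y -> 0 <= t / d x y <= 1 /\
  t / d x y * d x y = t.
Proof.
move=> /andP[t0 td]; have [d0|dn0] := eqVneq (d x y) 0.
  have -> : t = 0 by apply/eqP; rewrite eq_le t0 -d0 td.
  by rewrite !mul0r lexx ler01.
have dgt0 : 0 < d x y by rewrite lt_neqAle eq_sym dn0 mdist_ge0.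
by rewrite divfK// divr_ge0 ?mdist_ge0//= ler_pdivrMr// mul1r.
Qed.

Lemma alg_dist x y t : 0 <= t <= d x y ->
  d x (alg x y t) = t /\ d (alg x y t) y = d x y - t.
Proof.
move=> /alg_frac[l01 lt]; have [-> ->] := pntP x y l01; split=> //.
by rewrite mulrBl lt mul1r.
Qed.

Lemma alg_unique x y t p : 0 <= t <= d x y -> d x p = t ->
  d p y = d x y - t -> p = alg x y t.
Proof.
move=> /alg_frac[l01 lt] h1 h2; apply: pnt_unique => //; split.
  by rewrite lt.
by rewrite mulrBl lt mul1r.
Qed.

Lemma alg0 x y : alg x y 0 = x.
Proof. by rewrite /alg mul0r pnt0. Qed.

Lemma alg_end x y : alg x y (d x y) = y.
Proof.
apply/esym/alg_unique; first by rewrite mdist_ge0 lexx.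
  by [].
by rewrite mdistxx subrr.
Qed.

Lemma alg_alg x y s t : 0 <= s <= t -> t <= d x y ->
  alg x (alg x y t) s = alg x y s.
Proof.
move=> /andP[s0 st] td.
have [h1 h2] : d x (alg x y t) = t /\ d (alg x y t) y = d x y - t.
  by apply: alg_dist; lra.
have [g1 g2] := @alg_dist x (alg x y t) s ltac:(lra).
apply: alg_unique => //; first by lra.
apply/eqP; rewrite eq_le; apply/andP; split.
  have := metric_triangle (alg x (alg x y t) s) (alg x y t) y; lra.
have := metric_triangle x (alg x (alg x y t) s) y; lra.
Qed.

Lemma alg_dist2 x y s t : 0 <= s <= t -> t <= d x y ->
  d (alg x y s) (alg x y t) = t - s.
Proof.
move=> /andP[s0 st] td.
rewrite -(@alg_alg x y s t) ?s0//.
have [h1 h2] : d x (alg x y t) = t /\ d (alg x y t) y = d x y - t.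
  by apply: alg_dist; lra.
by have [_ ->] := @alg_dist x (alg x y t) s ltac:(lra); rewrite h1.
Qed.

Lemma alg_cone x y s t : 0 <= s <= t -> 0 < t -> t <= d x y -> forall z, t <= d x z ->
  d (alg x y s) (alg x z s) <= s / t * d (alg x y t) (alg x z t).
Proof.
move=> /andP[s0 st] t0 td z tz.
have h a : t <= d x a -> alg x a s = pnt (s / t) x (alg x a t).
  move=> ta; rewrite -(@alg_alg x a s t) ?s0// /alg.
  by rewrite -/(alg x a t) (alg_dist (_ : 0 <= t <= d x a)).1 // ltW.
rewrite h// h//; apply: pnt_thales => //.
by rewrite divr_ge0 ?(ltW t0)//= ler_pdivrMr// mul1r.
Qed.

(** Points at equal fractions of the two segments are within [d p q]; the second summand is the cost
    of passing from equal fractions to equal arc lengths. It vanishes as [x] moves away, which makes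
    the limit curve in [thin_cone] 1-Lipschitz. *)
Lemma alg_fellow p q x t : 0 <= t <= d p x -> t <= d q x -> 0 < d p x ->
  d (alg p x t) (alg q x t) <= d p q + t * d p q / d p x.
Proof.
move=> tp tq dpx0; have [l01 lt] := alg_frac tp.
set l := t / d p x in l01 lt.
apply: (le_trans (metric_triangle _ (pnt l q x) _)).
have h1 : d (alg p x t) (pnt l q x) <= d p q.
  apply: (le_trans (pnt_convex p x q x l01)).
  rewrite mdistxx mulr0 addr0 ler_piMl ?mdist_ge0//.
  by move: l01 => /andP[]; lra.
have h2 : pnt l q x = alg q x (l * d q x).
  apply: alg_unique; first by rewrite mulr_ge0 ?ler_piMl ?mdist_ge0//; case/andP: l01.
    by rewrite (pntP q x l01).1.
  by rewrite (pntP q x l01).2; ring.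
have h3 : d (pnt l q x) (alg q x t) = `|l * d q x - t|.
  have lq : 0 <= l * d q x <= d q x.
    by rewrite mulr_ge0 ?ler_piMl ?mdist_ge0//; case/andP: l01.
  move: lq tp => /andP[a1 a2] /andP[b1 b2].
  rewrite h2; have [h|h] := leP t (l * d q x).
    by rewrite metric_sym alg_dist2 ?b1// ger0_norm ?subr_ge0.
  by rewrite alg_dist2 ?a1 ?(ltW h)// ler0_norm ?opprB// subr_le0 ltW.
apply: lerD => //; rewrite h3.
have -> : l * d q x - t = l * (d q x - d p x) by rewrite mulrBr lt.
rewrite normrM ger0_norm; last by case/andP: l01.
rewrite /l mulrAC -mulrA -mulrA ler_wpM2l//; first by case/andP: tp.
rewrite ler_wpM2r ?invr_ge0 ?mdist_ge0//.
rewrite ler_norml; have := metric_triangle p q x; have := metric_triangle q p x.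
rewrite (metric_sym q p); lra.
Qed.

Lemma alg_fellow2 p q x t : 0 <= t <= d p x -> t <= d q x ->
  d (alg p x t) (alg q x t) <= 2 * d p q.
Proof.
move=> tp tq; have [d0|dn0] := eqVneq (d p x) 0.
  have -> : t = 0 by apply/eqP; rewrite eq_le -{1}d0 andbC.
  by rewrite !alg0; have := mdist_ge0 p q; lra.
have dgt0 : 0 < d p x by rewrite lt_neqAle eq_sym dn0 mdist_ge0.
apply: le_trans (alg_fellow tp tq dgt0) _.
have : t * d p q / d p x <= d p q.
  rewrite mulrAC ler_piMl ?mdist_ge0// ler_pdivrMr// mul1r.
  by case/andP: tp.
lra.
Qed.

Lemma alg_isom (g : isom X) x y t : 0 <= t <= d x y ->
  g (alg x y t) = alg (g x) (g y) t.
Proof.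
by move=> ht; have [h1 h2] := alg_dist ht; apply: alg_unique; rewrite !isom_dist.
Qed.

(* The midpoint of one diagonal, seen from the endpoints of the other. *)
Lemma quadrilateral x y z w :
  d x z ^+ 2 + d y w ^+ 2 <=
  d x y ^+ 2 + d y z ^+ 2 + d z w ^+ 2 + d w x ^+ 2.
Proof.
have l01 : 0 <= (2^-1 : R) <= 1 by lra.
have b := pntP x z l01; set m := pnt _ _ _ in b.
have h1 := stewart y l01 b; have h2 := stewart w l01 b.
have h3 := metric_triangle y m w.
have h4 : d y w ^+ 2 <= (d y m + d m w) ^+ 2.
  by rewrite lerXn2r ?nnegrE ?addr_ge0 ?mdist_ge0.
have h5 : 0 <= (d y m - d w m) ^+ 2 by exact: sqr_ge0.
rewrite (metric_sym m w) in h4; rewrite (metric_sym x y) (metric_sym z w).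
nra.
Qed.

End Basics.

(** * Ultralimits *)

Lemma ultrafilter_nat_exists :
  exists F : set_system nat, UltraFilter F /\ \oo `<=` F.
Proof. exact: ultraFilterLemma. Qed.

(** One nonprincipal ultrafilter serves for all limits, so the limits of a family of sequences
    indexed by the reals, such as the points of a sequence of curves, are compatible without
    diagonal extraction. *)
Definition omega : set_system nat := sval (cid ultrafilter_nat_exists).

Lemma omega_ultra : UltraFilter omega.
Proof. by have [] := svalP (cid ultrafilter_nat_exists). Qed.

#[global] Existing Instance omega_ultra.

Lemma omega_ge N : omega [set n | (N <= n)%N].
Proof.
have [_ h] := svalP (cid ultrafilter_nat_exists).
by apply: h; exists N.
Qed.

Section Ultralimits.
Variables (R : realType) (X : metricType R).
Local Notation d := (@mdist R X).
Implicit Types (x y : nat -> X) (p q : X).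

Definition ucvg x p := forall e : R, 0 < e -> omega [set n | d (x n) p < e].

Definition ulim x : X := xget (x 0%N) (ucvg x).

Hypothesis Xproper : proper_space X.

Lemma ulimP x p (r : R) : omega [set n | d p (x n) <= r] -> ucvg x (ulim x).
Proof.
move=> xr; rewrite /ulim; case: xgetP => [y -> //|nex].
have := @Xproper p r; rewrite compact_ultra => /(_ (x @ omega)).
case=> [||q [_ qlim]].
- split; first exact: fmap_proper_filter.
  move=> H HF sub; apply/seteqP; split=> [A HA|]; last exact: sub.
  have [//|nA] := in_ultra_setVsetC (x @^-1` A) omega_ultra.
  have : H (~` A) by apply: sub.
  move=> HnA; have H0 : H set0 by rewrite -(setICr A); exact: filterI.
  by have [] := filter_ex H0.
- exact: xr.
exfalso; apply: (nex q) => e e0.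
move/cvg_ball : qlim => /(_ _ e0); rewrite /ucvg.
by apply: filterS => n /=; rewrite ballEmdist /= metric_sym.
Qed.

Lemma ucvg_cst p : ucvg (fun=> p) p.
Proof. by move=> e e0; apply: filterE => n /=; rewrite mdistxx. Qed.

Lemma ucvg_le x y p q (a : R) : ucvg x p -> ucvg y q ->
  (forall e, 0 < e -> omega [set n | d (x n) (y n) <= a + e]) -> d p q <= a.
Proof.
move=> xp yq h; apply/ler_addgt0Pr => e e0.
have e3 : 0 < e / 3 by lra.
have [n [[h1 h2] h3]] := filter_ex (filterI (filterI (xp _ e3) (yq _ e3)) (h _ e3)).
have := metric_triangle p (x n) q; have := metric_triangle (x n) (y n) q.
move: h1 h2 h3 => /=; rewrite (metric_sym (x n) p); lra.
Qed.

Lemma ucvg_ge x y p q (a : R) : ucvg x p -> ucvg y q ->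
  (forall e, 0 < e -> omega [set n | a <= d (x n) (y n) + e]) -> a <= d p q.
Proof.
move=> xp yq h; apply/ler_addgt0Pr => e e0.
have e3 : 0 < e / 3 by lra.
have [n [[h1 h2] h3]] := filter_ex (filterI (filterI (xp _ e3) (yq _ e3)) (h _ e3)).
have := metric_triangle (x n) p (y n); have := metric_triangle p q (y n).
move: h1 h2 h3 => /=; rewrite (metric_sym (y n) q); lra.
Qed.

Lemma ucvg_eq x y p q (a : R) : ucvg x p -> ucvg y q ->
  omega [set n | d (x n) (y n) = a] -> d p q = a.
Proof.
move=> xp yq h; apply/eqP; rewrite eq_le; apply/andP; split.
  by apply: (ucvg_le xp yq) => e e0; apply: filterS h => n /= ->; rewrite lerDl ltW.
by apply: (ucvg_ge xp yq) => e e0; apply: filterS h => n /= ->; rewrite lerDl ltW.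
Qed.

End Ultralimits.

(** * Flat strips *)

Section Lines.
Variables (R : realType) (X : metricType R).
Local Notation d := (@mdist R X).
Implicit Types (c r : R -> X) (x y : X) (s t l a b h k e K W : R).
Hypothesis Xcat0 : cat0 X.

Definition geodesic_on a b c := forall s t, a <= s <= b -> a <= t <= b ->
  d (c s) (c t) = `|s - t|.

Definition is_ray r := forall s t, 0 <= s -> 0 <= t -> d (r s) (r t) = `|s - t|.

Lemma geodesic_on_pnt a b c l : a <= b -> geodesic_on a b c -> 0 <= l <= 1 ->
  c (a + l * (b - a)) = pnt l (c a) (c b).
Proof.
move=> ab cg l01; have /andP[l0 l1] := l01.
have h1 : 0 <= l * (b - a) by rewrite mulr_ge0// subr_ge0.
have h2 : l * (b - a) <= b - a by rewrite ler_piMl// subr_ge0.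
apply: pnt_unique => //; split.
  rewrite !cg ?lexx ?ab//; try lra.
  rewrite !ler0_norm ?subr_le0//; try lra.
rewrite !cg ?lexx ?ab//; try lra.
rewrite !ler0_norm ?subr_le0//; try lra.
Qed.

Lemma geodesic_on_convex a b c c' l : a <= b -> geodesic_on a b c ->
  geodesic_on a b c' -> 0 <= l <= 1 ->
  d (c (a + l * (b - a))) (c' (a + l * (b - a))) <=
  (1 - l) * d (c a) (c' a) + l * d (c b) (c' b).
Proof.
by move=> ab cg cg' l01; rewrite !geodesic_on_pnt//; exact: pnt_convex.
Qed.

Lemma geodesic_on_alg a b c t : geodesic_on a b c -> 0 <= t <= b - a ->
  c (a + t) = alg (c a) (c b) t.
Proof.
move=> cg ht; have dab : d (c a) (c b) = b - a.
  by rewrite cg ?ler0_norm; lra.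
apply: alg_unique => //; rewrite ?dab// cg; try lra.
  by rewrite ler0_norm; lra.
by rewrite ler0_norm; lra.
Qed.

Lemma is_ray_on r b : is_ray r -> geodesic_on 0 b r.
Proof. by move=> rr s t /andP[? _] /andP[? _]; exact: rr. Qed.

Lemma line_on c a b : geodesic_line c -> geodesic_on a b c.
Proof. by move=> cl s t _ _; exact: cl. Qed.

Lemma ray_alg r s t : is_ray r -> 0 <= s <= t -> alg (r 0) (r t) s = r s.
Proof.
move=> rr st; have := @geodesic_on_alg 0 t r s (is_ray_on rr).
by rewrite subr0 add0r => ->.
Qed.

Lemma ray_dist0 r t : is_ray r -> 0 <= t -> d (r 0) (r t) = t.
Proof. by move=> rr t0; rewrite rr// add0r normrN ger0_norm. Qed.

Lemma ray_cone r r' s t : is_ray r -> is_ray r' -> r 0 = r' 0 -> 0 <= s <= t ->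
  0 < t -> d (r s) (r' s) <= s / t * d (r t) (r' t).
Proof.
move=> rr rr' r0 st t0; have /andP[s0 st'] := st.
have := @geodesic_on_convex 0 t r r' (s / t) (ltW t0) (is_ray_on rr) (is_ray_on rr').
rewrite subr0 add0r divfK ?gt_eqF// r0 mdistxx mulr0 add0r; apply.
by rewrite divr_ge0 ?(ltW t0)//= ler_pdivrMr// mul1r.
Qed.

(** A bounded convex function on a half-line does not increase: on [[0, T]] the value at [t] exceeds
    that at [0] by at most [t / T * K], and [T] is arbitrary. *)
Lemma asymptotic_nonincreasing r r' (K : R) : is_ray r -> is_ray r' ->
  (forall t, 0 <= t -> d (r t) (r' t) <= K) ->
  forall t, 0 <= t -> d (r t) (r' t) <= d (r 0) (r' 0).
Proof.
move=> rr rr' hK t t0; apply/ler_addgt0Pr => e e0.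
have K0 : 0 <= K by apply: le_trans (hK 0 (lexx _)); exact: mdist_ge0.
pose T := t + t * K / e + 1.
have te : 0 <= t * K / e by rewrite divr_ge0 ?mulr_ge0// ltW.
have T0 : 0 < T by rewrite /T; lra.
have tT : 0 <= t / T <= 1.
  by rewrite divr_ge0 ?(ltW T0)//= ler_pdivrMr// mul1r /T; lra.
have := geodesic_on_convex (ltW T0) (is_ray_on rr) (is_ray_on rr') tT.
rewrite subr0 add0r divfK ?gt_eqF// => /le_trans; apply.
apply: lerD.
  by rewrite ler_piMl ?mdist_ge0//; move: tT => /andP[]; lra.
apply: (@le_trans _ _ (t / T * K)).
  by apply: ler_wpM2l; [case/andP: tT|apply: hK; exact: ltW].
rewrite mulrAC ler_pdivrMr// -ler_pdivrMl//.
by rewrite mulrC /T; lra.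
Qed.

Lemma parallel_cst c c' (K : R) : geodesic_line c -> geodesic_line c' ->
  (forall t, d (c t) (c' t) <= K) ->
  forall s t, d (c s) (c' s) = d (c t) (c' t).
Proof.
move=> cl cl' hK.
suff h s t : d (c t) (c' t) <= d (c s) (c' s).
  by move=> s t; apply/eqP; rewrite eq_le !h.
have [st|/ltW ts] := leP s t.
  have := @asymptotic_nonincreasing (fun u => c (s + u)) (fun u => c' (s + u)) K.
  move=> /(_ _ _ _ (t - s)); rewrite addr0 subrKC; apply; rewrite ?subr_ge0//.
  - by move=> u v _ _; rewrite cl; congr (Num.norm _); ring.
  - by move=> u v _ _; rewrite cl'; congr (Num.norm _); ring.
have := @asymptotic_nonincreasing (fun u => c (s - u)) (fun u => c' (s - u)) K.
move=> /(_ _ _ _ (s - t)); rewrite subr0 subKr; apply; rewrite ?subr_ge0//.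
- by move=> u v _ _; rewrite cl -normrN; congr (Num.norm _); ring.
- by move=> u v _ _; rewrite cl' -normrN; congr (Num.norm _); ring.
Qed.

Lemma dist_line_lip c x s t : geodesic_line c ->
  `|d x (c s) - d x (c t)| <= `|s - t|.
Proof.
move=> cl; rewrite -(cl s t) ler_norml.
have := metric_triangle x (c s) (c t); have := metric_triangle x (c t) (c s).
rewrite (metric_sym (c t) (c s)); lra.
Qed.

Lemma dist_line_continuous c x : geodesic_line c ->
  continuous (fun s => d x (c s)).
Proof.
move=> cl s; apply/cvgrPdist_lt => e e0; near=> t.
apply: le_lt_trans (dist_line_lip x s t cl) _.
by near: t; exact: (cvgrPdist_lt _ _).1 (@cvg_id _ (nbhs s)) e e0.
Unshelve. all: by end_near. Qed.

Definition nearest c x s := forall u, d x (c s) <= d x (c u).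

Lemma nearest_exists c x : geodesic_line c -> exists s, nearest c x s.
Proof.
move=> cl; pose M := 2 * d x (c 0).
have M0 : 0 <= M by rewrite mulr_ge0 ?mdist_ge0.
have [||s _ hs] := @EVT_min R (fun s => d x (c s)) (- M) M.
- by lra.
- by apply: continuous_subspaceT; exact: dist_line_continuous.
exists s => u; have [h|h] := boolP (u \in `[- M, M]); first exact: hs.
have h0 : d x (c s) <= d x (c 0) by apply: hs; rewrite in_itv /= ; lra.
apply: (le_trans h0).
have : M < `|u|.
  move: h; rewrite in_itv /= -ler_norml -ltNge //.
have := metric_triangle (c 0) x (c u); rewrite cl sub0r normrN (metric_sym (c 0)) /M.
lra.
Qed.

(** The angle at a nearest point is at least a right angle. Stewart's inequality a fraction [l] of
    the way to [c u], compared with the minimum at [s] and divided by [l], gives the claim with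
    error [l * (u - s) ^+ 2]. *)
Lemma nearest_pythagoras c x s u : geodesic_line c -> nearest c x s ->
  d x (c s) ^+ 2 + (u - s) ^+ 2 <= d x (c u) ^+ 2.
Proof.
move=> cl ns; apply/ler_addgt0Pr => e e0.
have q0 : 0 < (u - s) ^+ 2 + 1 by have := sqr_ge0 (u - s); lra.
pose l := Num.min 1 (e / ((u - s) ^+ 2 + 1)).
have l0 : 0 < l by rewrite lt_min ltr01 divr_gt0.
have l1 : l <= 1 by rewrite ge_min lexx.
have le : l * (u - s) ^+ 2 <= e.
  have : l <= e / ((u - s) ^+ 2 + 1) by rewrite ge_min lexx orbT.
  by rewrite ler_pdivlMr//; nra.
have l01 : 0 <= l <= 1 by rewrite ltW.
have b : between l (c s) (c u) (c (s + l * (u - s))).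
  rewrite /between !cl; split.
    have -> : s - (s + l * (u - s)) = l * (s - u) by ring.
    by rewrite normrM (ger0_norm (ltW l0)).
  have -> : s + l * (u - s) - u = (1 - l) * (s - u) by ring.
  by rewrite normrM ger0_norm// subr_ge0.
have h1 := stewart Xcat0 x l01 b.
have h2 : d x (c s) ^+ 2 <= d x (c (s + l * (u - s))) ^+ 2.
  by rewrite lerXn2r ?nnegrE ?mdist_ge0.
rewrite cl -normrX ger0_norm ?sqr_ge0// in h1.
have : l * (d x (c s) ^+ 2 + (u - s) ^+ 2) <= l * (d x (c u) ^+ 2 + e) by nra.
by rewrite ler_pM2l.
Qed.

Lemma nearest_unique c x s u : geodesic_line c -> nearest c x s ->
  nearest c x u -> s = u.
Proof.
move=> cl ns nu; have h := nearest_pythagoras u cl ns.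
have h2 : d x (c u) ^+ 2 <= d x (c s) ^+ 2.
  by rewrite lerXn2r ?nnegrE ?mdist_ge0.
have : (u - s) ^+ 2 <= 0 by lra.
by move=> h3; apply/eqP; rewrite -subr_eq0 -sqrf_eq0 -sqrrN opprB eq_le h3 sqr_ge0.
Qed.

(** Here [c' b] is the foot of [c 0]. Shifting both lines changes no distance, so a parallelogram
    with sides [W] and [|a|] has squared diagonals that are each at least [W ^+ 2 + a ^+ 2] by
    projection and sum to at most twice that by [quadrilateral]. *)
Lemma parallel_shift c c' (K : R) : geodesic_line c -> geodesic_line c' ->
  (forall t, d (c t) (c' t) <= K) ->
  exists b, exists2 W, 0 <= W &
    forall t a, d (c t) (c' (t + b + a)) ^+ 2 = W ^+ 2 + a ^+ 2.
Proof.
move=> cl cl' hK; have [b hb] := nearest_exists (c 0) cl'.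
have cst a t : d (c t) (c' (t + b + a)) = d (c 0) (c' (b + a)).
  have cl2 : geodesic_line (fun t => c' (t + (b + a))).
    by move=> u v; rewrite cl'; congr (Num.norm _); ring.
  have := @parallel_cst c _ (K + `|b + a|) cl cl2 _ t 0.
  rewrite /= add0r addrA; apply=> u.
  apply: le_trans (metric_triangle _ (c' u) _) _; apply: lerD => //.
  by rewrite cl' opprD addrA subrr add0r normrN.
exists b, (d (c 0) (c' b)); first exact: mdist_ge0.
have lo a : d (c 0) (c' b) ^+ 2 + a ^+ 2 <= d (c 0) (c' (b + a)) ^+ 2.
  by have := nearest_pythagoras (b + a) cl' hb; rewrite [b + a - b]addrAC subrr add0r.
move=> t a; rewrite cst; apply/eqP; rewrite eq_le lo andbT.
have := quadrilateral Xcat0 (c 0) (c a) (c' (b + a)) (c' b).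
have -> : d (c a) (c' b) = d (c 0) (c' (b - a)).
  by rewrite -(cst (- a) a); congr (d _ (c' _)); ring.
have -> : d (c a) (c' (b + a)) = d (c 0) (c' b).
  by rewrite -[in RHS](addr0 b) -(cst 0 a); congr (d _ (c' _)); ring.
have -> : d (c' b) (c 0) = d (c 0) (c' b) by rewrite metric_sym.
have lo2 := lo (- a); rewrite !cl cl' -!normrX !(@ger0_norm _ (_ ^+ 2)) ?sqr_ge0//.
rewrite sqrrN in lo2; nra.
Qed.

Lemma le_add_sqr (D x h e : R) : 0 <= D -> 0 <= x -> 0 < e -> h ^+ 2 <= 2 * x * e ->
  D ^+ 2 <= x ^+ 2 + h ^+ 2 -> D <= x + e.
Proof.
move=> D0 x0 e0 he hD; rewrite -(@ler_pXn2r _ 2) ?nnegrE ?addr_ge0 ?(ltW e0)//.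
nra.
Qed.

(** No length can be lost: on the way from [c (- S)] to [c S] through [c' s] and [c' t] the outer
    pieces exceed [S + s] and [S - t] by an amount that vanishes as [S] grows, while the whole has
    length at least [2 * S]. *)
Lemma onelip_is_line c c' (h : R) : geodesic_line c ->
  (forall s t, d (c' s) (c' t) <= `|s - t|) ->
  (forall t a, d (c (t + a)) (c' t) ^+ 2 <= a ^+ 2 + h ^+ 2) ->
  geodesic_line c'.
Proof.
move=> cl lip hc.
suff main s t : s <= t -> t - s <= d (c' s) (c' t).
  move=> s t; apply/eqP; rewrite eq_le lip /=.
  have [st|/ltW ts] := leP s t.
    by rewrite ler0_norm ?subr_le0// opprB main.
  by rewrite ger0_norm ?subr_ge0// metric_sym main.
move=> st; apply/ler_addgt0Pr => e e0; have e2 : 0 < e / 2 by lra.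
pose S := `|s| + `|t| + h ^+ 2 / e.
have he : 0 <= h ^+ 2 / e by rewrite divr_ge0 ?sqr_ge0// ltW.
have hee : h ^+ 2 = h ^+ 2 / e * e by rewrite divfK ?gt_eqF.
have s1 : - s <= `|s| by rewrite -normrN ler_norm.
have t2 : t <= `|t| by rewrite ler_norm.
have s2 := normr_ge0 s; have t1 := normr_ge0 t.
have S1 : h ^+ 2 / e <= S + s by rewrite /S; have := normr_ge0 t; lra.
have S2 : h ^+ 2 / e <= S - t by rewrite /S; have := normr_ge0 s; lra.
have A : d (c (- S)) (c' s) <= S + s + e / 2.
  apply: (@le_add_sqr _ _ h) => //; rewrite ?mdist_ge0//; first by lra.
    by nra.
  have := hc s (- S - s); rewrite subrKC => /le_trans; apply.
  by rewrite le_eqVlt; apply/orP; left; apply/eqP; ring.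
have B : d (c S) (c' t) <= S - t + e / 2.
  apply: (@le_add_sqr _ _ h) => //; rewrite ?mdist_ge0//; first by lra.
    by nra.
  by have := hc t (S - t); rewrite subrKC.
have := metric_triangle (c (- S)) (c' s) (c S).
have := metric_triangle (c' s) (c' t) (c S).
rewrite (metric_sym (c' t) (c S)) cl.
have : 2 * S <= `|- S - S|.
  by rewrite -normrN; apply: le_trans (ler_norm _); lra.
lra.
Qed.

(** [parallel_shift] gives the formula up to a shift [b] of the feet, and the assumed upper bound at
    [a = - b] forces [b = 0]. *)
Lemma parallel_orthogonal c c' (h : R) : geodesic_line c -> geodesic_line c' ->
  (forall t, d (c t) (c' t) = h) ->
  (forall t a, d (c t) (c' (t + a)) ^+ 2 <= a ^+ 2 + h ^+ 2) ->
  forall t a, d (c t) (c' (t + a)) ^+ 2 = a ^+ 2 + h ^+ 2.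
Proof.
move=> cl cl' ch up.
have [b [W W0 eqW]] := @parallel_shift c c' h cl cl' ltac:(by move=> t; rewrite ch).
have eqW' t a : d (c t) (c' (t + a)) ^+ 2 = W ^+ 2 + (a - b) ^+ 2.
  by rewrite -(eqW t (a - b)); congr (d _ (c' _) ^+ 2); ring.
have h0 := eqW' 0 0; rewrite addr0 ch in h0.
have b0 : b = 0.
  have := up 0 (- b); rewrite eqW' => hb.
  have b2 : b ^+ 2 <= 0 by nra.
  by apply/eqP; rewrite -sqrf_eq0 eq_le b2 sqr_ge0.
by move=> t a; rewrite eqW'; move: h0; rewrite b0 => ->; ring.
Qed.

(** [F t h] has height [h] on the segment between corresponding points. Stewart's inequality bounds
    distances by the euclidean ones, the horizontal slices are 1-Lipschitz and hence lines, and
    [parallel_orthogonal] turns the bounds into equalities, first between [c] and a slice, then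
    between two slices. *)
Lemma flat_strip c c' (K : R) : geodesic_line c -> geodesic_line c' ->
  (forall t, d (c t) (c' t) <= K) ->
  exists (W : R) (F : R -> R -> X), [/\ exists a, d (c 0) (c' a) = W,
    forall t, F t 0 = c t &
    forall s t h k, 0 <= h <= W -> 0 <= k <= W ->
      d (F s h) (F t k) ^+ 2 = (s - t) ^+ 2 + (h - k) ^+ 2].
Proof.
move=> cl cl'0 hK.
have [b [W W0 eqW]] := parallel_shift cl cl'0 hK.
pose c2 t := c' (t + b).
have el : geodesic_line c2 by move=> s t; rewrite /c2 cl'0; congr (Num.norm _); ring.
have ceW t : d (c t) (c2 t) = W.
  have := eqW t 0; rewrite addr0 expr0n /= addr0 -/(c2 t) => /eqP.
  by rewrite eqrXn2 ?mdist_ge0// => /eqP.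
have {eqW} ceq t a : d (c t) (c2 (t + a)) ^+ 2 = W ^+ 2 + a ^+ 2.
  by rewrite -(eqW t a); congr (d _ (c' _) ^+ 2); ring.
pose F t h := alg (c t) (c2 t) h.
have cF t h : 0 <= h <= W -> d (c t) (F t h) = h.
  by move=> hW; rewrite (alg_dist Xcat0 _).1 // ceW.
have FF t h k : 0 <= h <= k -> k <= W -> d (F t h) (F t k) = k - h.
  by move=> hk kW; rewrite (alg_dist2 Xcat0) // ceW.
(* Stewart's inequality in the right triangle [c t], [c2 t], [c s]. *)
have cFle s t h : 0 <= h <= W -> d (c s) (F t h) ^+ 2 <= (s - t) ^+ 2 + h ^+ 2.
  move=> hW; have hW' : 0 <= h <= d (c t) (c2 t) by rewrite ceW.
  have [l01 lh] := alg_frac hW'.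
  have := stewart Xcat0 (c s) l01 (pntP Xcat0 (c t) (c2 t) l01); rewrite -/(F t h).
  have := ceq s (t - s); rewrite subrKC => ->; rewrite cl.
  rewrite -normrX ger0_norm ?sqr_ge0// => /le_trans; apply; rewrite -[in leRHS]lh ceW.
  by rewrite le_eqVlt; apply/orP; left; apply/eqP; ring.
have Fl h : 0 <= h <= W -> geodesic_line (F^~ h).
  move=> hW; apply: (@onelip_is_line c _ h cl) => [s t|t a]; last first.
    by have := cFle (t + a) t h hW; rewrite addrAC subrr add0r.
  have hW' u : 0 <= h <= d (c u) (c2 u) by rewrite ceW.
  have [l01 lh] := alg_frac (hW' s).
  rewrite /F /alg !ceW in l01 *.
  apply: (le_trans (pnt_convex Xcat0 _ _ _ _ l01)); rewrite cl el.
  by rewrite le_eqVlt; apply/orP; left; apply/eqP; ring.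
have cFeq s t h : 0 <= h <= W -> d (c s) (F t h) ^+ 2 = (s - t) ^+ 2 + h ^+ 2.
  move=> hW.
  have := @parallel_orthogonal c (F^~ h) h cl (Fl h hW) (fun t => cF t h hW) _ s (t - s).
  rewrite subrKC => ->; first by ring.
  move=> u a; have := cFle u (u + a) h hW => /le_trans; apply.
  by rewrite le_eqVlt; apply/orP; left; apply/eqP; ring.
have FFle s t h k : 0 <= h <= k -> k <= W ->
    d (F s h) (F t k) ^+ 2 <= (t - s) ^+ 2 + (k - h) ^+ 2.
  move=> hk kW; have kW' : 0 <= k <= W by lra.
  have hk' : 0 <= h <= d (c s) (F s k) by rewrite cF.
  have [l01 lh] := alg_frac hk'.
  have := stewart Xcat0 (F t k) l01 (pntP Xcat0 (c s) (F s k) l01).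
  rewrite -/(alg (c s) (F s k) h) (alg_alg Xcat0) ?ceW// -/(F s h).
  rewrite metric_sym => /le_trans; apply; rewrite cF// in lh *.
  rewrite (metric_sym (F t k) (c s)) (cFeq s t k kW') (Fl k kW') -normrX.
  rewrite ger0_norm ?sqr_ge0//; set l := h / k in lh *; rewrite -lh.
  by rewrite le_eqVlt; apply/orP; left; apply/eqP; ring.
have FFeq s t h k : 0 <= h <= k -> k <= W ->
    d (F s h) (F t k) ^+ 2 = (t - s) ^+ 2 + (k - h) ^+ 2.
  move=> hk kW; have hW : 0 <= h <= W by lra.
  have kW' : 0 <= k <= W by lra.
  have := @parallel_orthogonal (F^~ h) (F^~ k) (k - h) (Fl h hW) (Fl k kW')
    (fun t => FF t h k hk kW) _ s (t - s).
  rewrite subrKC; apply=> u a; have := FFle u (u + a) h k hk kW => /le_trans; apply.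
  by rewrite le_eqVlt; apply/orP; left; apply/eqP; ring.
exists W, F; split.
- by exists b; rewrite -(ceW 0) /c2 add0r.
- by move=> t; rewrite /F alg0.
move=> s t h k /andP[h0 hW] /andP[k0 kW]; have [hk|/ltW kh] := leP h k.
  by rewrite FFeq ?h0//; ring.
by rewrite metric_sym FFeq ?k0//; ring.
Qed.

Hypothesis Xproper : proper_space X.

(** The distance is that of the lines as sets, so no parametrisations have to be matched. All the
    wide strips have [c] itself as edge; hence points with given coordinates stay in a ball, and the
    strips converge pointwise. *)
Lemma parallel_width c : geodesic_line c -> ~ bounds_flat_half_plane c ->
  exists2 w : R, 0 < w & forall c' K, geodesic_line c' ->
    (forall t, d (c t) (c' t) <= K) -> ~ forall s t, w <= d (c s) (c' t).
Proof.
move=> cl nflat; apply: contrapT => nw.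
have strips (n : nat) : exists F : R -> R -> X, (forall t, F t 0 = c t) /\
    forall s t h k, 0 <= h <= n%:R -> 0 <= k <= n%:R ->
      d (F s h) (F t k) ^+ 2 = (s - t) ^+ 2 + (h - k) ^+ 2.
  apply: contrapT => nF; apply: nw; exists (n%:R + 1) => [|c' K cl' hK far].
    by have := ler0n R n; lra.
  have [W [F [[a aW] F0 FF]]] := flat_strip cl cl' hK.
  apply: nF; exists F; split=> // s t h k hn kn.
  by have := far 0 a; rewrite aW => nW; apply: FF; lra.
have [F FP] := choice strips; apply: nflat.
exists (fun p => ulim (fun n => F n p.1 p.2)).
have cvF p : 0 <= p.2 -> ucvg (fun n => F n p.1 p.2) (ulim (fun n => F n p.1 p.2)).
  move=> p0; apply: (@ulimP _ _ Xproper _ (c p.1) p.2).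
  apply: filterS (omega_ge (Num.truncn p.2).+1) => n /= hn.
  have pn : p.2 <= n%:R.
    apply/ltW/(lt_le_trans (truncnS_gt p.2)).
    by rewrite ler_nat.
  have [F0 FF] := FP n; rewrite -F0.
  rewrite -(@ler_pXn2r _ 2) ?nnegrE ?mdist_ge0// FF ?lexx ?p0 ?pn ?ler0n//.
  by rewrite subrr expr0n /= add0r sub0r sqrrN.
split=> [p q p0 q0|t]; last first.
  apply: (@mdist_positivity R); apply: (ucvg_eq (cvF (t, 0) (lexx _)) (ucvg_cst (c t))).
  by apply: filterE => n /=; have [-> _] := FP n; rewrite mdistxx.
apply: (ucvg_eq (cvF p p0) (cvF q q0)).
apply: filterS (omega_ge (Num.truncn (Num.max p.2 q.2)).+1) => n /= hn.
have pqn : Num.max p.2 q.2 <= n%:R.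
  by apply/ltW/(lt_le_trans (truncnS_gt _)); rewrite ler_nat.
move: pqn; rewrite ge_max => /andP[pn qn].
have [F0 FF] := FP n; apply/eqP; rewrite -(@eqrXn2 _ 2) ?mdist_ge0 ?edist_ge0//.
by rewrite FF ?p0 ?q0// edist_sqr.
Qed.

End Lines.

Section IsomGroup.
Variables (R : realType) (X : metricType R).
Implicit Types (f g : isom X) (x : X).

Lemma isomM f g x : (f * g)%g x = f (g x). Proof. by []. Qed.

Lemma isom1 x : (1%g : isom X) x = x. Proof. by []. Qed.

Lemma isomK f x : (f^-1)%g (f x) = x. Proof. exact: isom_funK. Qed.

Lemma isomVK f x : f ((f^-1)%g x) = x. Proof. exact: isom_inv_funK. Qed.

Lemma isomXS f n x : (f ^+ n.+1)%g x = f ((f ^+ n)%g x).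
Proof. by rewrite expgS. Qed.

Lemma isomXSr f n x : (f ^+ n.+1)%g x = (f ^+ n)%g (f x).
Proof. by rewrite expgSr. Qed.

End IsomGroup.

Lemma omega_real (R : realType) (r : R) : omega [set n | r <= n%:R].
Proof.
apply: filterS (omega_ge (Num.truncn r).+1) => n /= hn.
by apply/ltW/(lt_le_trans (truncnS_gt r)); rewrite ler_nat.
Qed.

(** * Lines without flat half-planes *)

Section Thin.
Variables (R : realType) (X : metricType R).
Local Notation d := (@mdist R X).
Implicit Types (c : R -> X) (x y : X) (s t l a b h k e K W w u v r tau : R).
Hypothesis Xcat0 : cat0 X.
Hypothesis Xproper : proper_space X.

Definition thin c w := forall c' K, geodesic_line c' ->
  (forall t, d (c t) (c' t) <= K) -> ~ forall s t, w <= d (c s) (c' t).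

Definition translates (g : isom X) c tau :=
  [/\ geodesic_line c, 0 < tau & forall t, g (c t) = c (t + tau)].

Lemma translatesX g c tau n t : translates g c tau ->
  (g ^+ n)%g (c t) = c (t + tau * n%:R).
Proof.
move=> [_ _ gc]; elim: n t => [|n IH] t; first by rewrite mulr0 addr0.
by rewrite isomXS IH gc -natr1; congr c; ring.
Qed.

Lemma translatesVX g c tau n t : translates g c tau ->
  ((g ^+ n)^-1)%g (c t) = c (t - tau * n%:R).
Proof.
by move=> h; rewrite -[in LHS](subrK (tau * n%:R) t) -(translatesX n _ h) isomK.
Qed.

Definition reversed c : R -> X := fun t => c (- t).

Lemma rev_line c : geodesic_line c -> geodesic_line (reversed c).
Proof. by move=> cl s t; rewrite /reversed cl -normrN; congr (Num.norm _); ring. Qed.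

Lemma translates_rev g c tau : translates g c tau ->
  translates (g^-1)%g (reversed c) tau.
Proof.
move=> [cl t0 gc]; split=> // [|t]; first exact: rev_line.
by rewrite /reversed -[in LHS](subrK tau (- t)) -gc isomK; congr c; ring.
Qed.

Lemma thin_rev c w : thin c w -> thin (reversed c) w.
Proof.
move=> th c' K cl hK far; apply: (th (reversed c') K (rev_line cl)) => [t|s t].
  by have := hK (- t); rewrite /reversed opprK.
by have := far (- s) (- t); rewrite /reversed opprK.
Qed.

Lemma nearest_rev c x s : nearest c x s -> nearest (reversed c) x (- s).
Proof. by move=> ns u; rewrite /reversed opprK. Qed.

(* The defect of a 1-Lipschitz curve near c is bounded and superadditive, so it
   vanishes in the limit under translations. *)
Lemma thin_no_ray g c tau w a v c' : translates g c tau -> thin c w ->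
  (forall s t, a <= s -> a <= t -> d (c' s) (c' t) <= `|s - t|) ->
  (forall s, a <= s -> d (c s) (c' s) <= v) ->
  ~ (forall s u, a <= s -> a <= u -> w <= d (c s) (c' u)).
Proof.
move=> tr th lip near_c far; have [cl tau0 gc] := tr.
pose def t := t - a - d (c' a) (c' t).
pose A := [set def t | t in [set t | a <= t]].
have defle t : a <= t -> def t <= 2 * v.
  move=> at_; have := metric_triangle (c a) (c' a) (c t).
  have := metric_triangle (c' a) (c' t) (c t).
  have := near_c a (lexx _); have := near_c t at_.
  by rewrite (metric_sym (c' t)) cl ler0_norm ?subr_le0// /def; lra.
have supA : has_sup A.
  by split; [exists (def a), a => /=|exists (2 * v) => _ [t /= at_ <-]; exact: defle].
have defect e : 0 < e -> exists2 T, a <= T & forall s t, T <= s -> s <= t ->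
    t - s <= d (c' s) (c' t) + e.
  move=> e0; have [_ [T /= aT <-] hT] := sup_adherent e0 supA.
  exists T => // s t Ts st.
  have at_ : a <= t by lra.
  have aS : a <= s by lra.
  have h1 : def t <= sup A by apply: (ub_le_sup supA.2); exists t.
  have h2 : def T <= def s.
    have := metric_triangle (c' a) (c' T) (c' s).
    have := lip T s aT aS; rewrite ler0_norm ?subr_le0// /def; lra.
  have := metric_triangle (c' a) (c' s) (c' t).
  by move: h1 h2 hT; rewrite /def; lra.
(* Pulling back by [g ^+ n] shows ever later parts of [c'] next to the fixed point [c s]. Beyond the
   threshold [T] of [defect] these parts are geodesic up to [e]. *)
pose y s (n : nat) := ((g ^+ n)^-1)%g (c' (s + tau * n%:R)).
have large b s : omega [set n | b <= s + tau * n%:R].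
  apply: filterS (omega_real ((b - s) / tau)) => n /=.
  by rewrite ler_pdivrMr// mulrC; lra.
have dcy s u n : d (c s) (y u n) = d (c (s + tau * n%:R)) (c' (u + tau * n%:R)).
  by rewrite /y -[c s](isomK (g ^+ n)%g) isom_dist (translatesX _ _ tr).
have cvy s : ucvg (y s) (ulim (y s)).
  apply: (@ulimP _ _ Xproper _ (c s) v); apply: filterS (large a s) => n /= hn.
  by rewrite dcy near_c.
apply: (th (fun s => ulim (y s)) v) => [s t|t|s u].
- wlog st : s t / s <= t.
    move=> H; have [/H//|/ltW /H] := leP s t.
    by rewrite metric_sym -normrN opprB.
  apply/eqP; rewrite eq_le; apply/andP; split.
    apply: (ucvg_le (cvy s) (cvy t)) => e e0.
    apply: filterS (filterI (large a s) (large a t)) => n /= [h1 h2].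
    rewrite isom_dist; apply: le_trans (lip _ _ h1 h2) _.
    by rewrite opprD addrACA subrr addr0 lerDl ltW.
  apply: (ucvg_ge (cvy s) (cvy t)) => e e0; have [T aT hT] := defect e e0.
  apply: filterS (large T s) => n /= h1.
  rewrite isom_dist ler0_norm ?subr_le0//.
  have := hT _ (t + tau * n%:R) h1; rewrite lerD2r => /(_ st).
  by rewrite opprD addrACA subrr addr0 opprB.
- apply: (ucvg_le (ucvg_cst _) (cvy t)) => e e0.
  apply: filterS (large a t) => n /= hn; rewrite dcy.
  by apply: le_trans (near_c _ hn) _; lra.
apply: (ucvg_ge (ucvg_cst _) (cvy u)) => e e0.
apply: filterS (filterI (large a s) (large a u)) => n /= [h1 h2].
by rewrite dcy; apply: le_trans (far _ _ h1 h2) _; rewrite lerDl ltW.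
Qed.

Lemma dist_line_convex c x s u : geodesic_line c -> 0 < s <= u ->
  d x (c s) - d x (c 0) <= s / u * (d x (c u) - d x (c 0)).
Proof.
move=> cl /andP[s0 su]; have u0 : 0 < u by lra.
have l01 : 0 <= s / u <= 1.
  by rewrite divr_ge0 ?(ltW s0) ?(ltW u0)//= ler_pdivrMr// mul1r.
have := @geodesic_on_pnt _ _ Xcat0 0 u c (s / u) (ltW u0) (line_on cl) l01.
rewrite subr0 add0r divfK ?gt_eqF// => ->.
have := pnt_convex Xcat0 x x (c 0) (c u) l01.
have [_] := pntP Xcat0 x x l01; rewrite mdistxx mulr0.
move=> /(@mdist_positivity R) -> h.
by lra.
Qed.

Lemma dist_line_decreasing c x s t u : geodesic_line c -> nearest c x t ->
  s <= u -> u <= t -> d x (c u) <= d x (c s).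
Proof.
move=> cl nt su ut; have [st|] := ltP s t; last first.
  by move=> ts; have -> : u = s by lra.
have := @dist_line_convex (fun v => c (s + v)) x (u - s) (t - s).
rewrite addr0 !subrKC; have [->//|us] := eqVneq u s.
have cl' : geodesic_line (fun v => c (s + v)).
  by move=> p q; rewrite cl; congr (Num.norm _); ring.
have us' : 0 < u - s <= t - s.
  by rewrite lerD2r ut subr_gt0 lt_neqAle eq_sym us su.
move=> /(_ cl' us') h; have l0 : 0 <= (u - s) / (t - s) by rewrite divr_ge0; lra.
by have := nt s; nra.
Qed.

Lemma nearest_far c x s : geodesic_line c -> nearest c x s -> `|s| <= 2 * d (c 0) x.
Proof.
move=> cl ns; have := metric_triangle (c 0) x (c s).
by rewrite cl sub0r normrN; have := ns 0; rewrite (metric_sym x (c 0)); lra.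
Qed.

(** A failure gives points [x n] projecting ever farther whose geodesics from [c 0] have left [c] at
    radius [r]. The distance to [x n] then decreases along [c] at a rate bounded away from 1, so
    moving from [c s] towards [x n] leads away from [c]; points at a fixed distance [v] on the way
    converge to a curve that [thin_no_ray] excludes. *)
Lemma thin_cone g c tau w : translates g c tau -> thin c w -> 0 < w ->
  forall r e, 0 < r -> 0 < e -> exists T, forall x s, nearest c x s -> T <= s ->
    r <= d (c 0) x /\ d (alg (c 0) x r) (c r) <= e.
Proof.
move=> tr th w0 r e r0 e0; have [cl tau0 gc] := tr.
apply: contrapT => nT.
have seqx (n : nat) : exists xs : X * R, [/\ nearest c xs.1 xs.2, n%:R <= xs.2,
    2 * r <= xs.2 & e < d (alg (c 0) xs.1 r) (c r)].
  apply: contrapT => nx; apply: nT; exists (n%:R + 2 * r) => x s ns Ts.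
  have n0 := ler0n R n.
  have rx : r <= d (c 0) x.
    by have := nearest_far cl ns; have := ler_norm s; lra.
  split=> //; rewrite leNgt; apply/negP => es; apply: nx; exists (x, s).
  by split => //=; lra.
have [xs xsP] := choice seqx.
pose x n := (xs n).1; pose f n u := d (x n) (c u).
(* By Stewart's inequality, a bound for the distance from [c 0] to the midpoint of two points at
   distance [r] from it and more than [e] apart. *)
pose rho := Num.sqrt (r ^+ 2 - e ^+ 2 / 4).
have rho_r : rho < r.
  rewrite -[ltRHS](ger0_norm (ltW r0)) -sqrtr_sqr ltr_sqrt ?exprn_gt0//.
  by have : 0 < e ^+ 2 by [rewrite exprn_gt0]; lra.
have rho0 : 0 <= rho by exact: sqrtr_ge0.
(* [1 - del = rho / r] bounds the mean rate of decrease of the distance to [x n] between [c 0] and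
   [c r]; convexity extends the bound to later parameters in [slope]. *)
pose del := (r - rho) / r.
have delr : del * r = r - rho by rewrite /del divfK ?gt_eqF.
have del0 : 0 < del by rewrite divr_gt0// subr_gt0.
have del1 : del <= 1 by rewrite ler_pdivrMr// mul1r; lra.
have slope0 n : f n 0 - (1 - del) * r <= f n r.
  have [ns _ s2 es] := xsP n.
  have rx : r <= d (c 0) (x n).
    by have := nearest_far cl ns; have := ler_norm (xs n).2; rewrite -/(x n); lra.
  have l01 : 0 <= (2^-1 : R) <= 1 by lra.
  set z := alg (c 0) (x n) r in es *.
  have [z1 z2] : d (c 0) z = r /\ d z (x n) = d (c 0) (x n) - r.
    by apply: alg_dist => //; rewrite ltW.
  have bm := pntP Xcat0 z (c r) l01; set m := pnt _ _ _ in bm.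
  have h1 := stewart Xcat0 (c 0) l01 bm.
  have h2 := pnt_convex Xcat0 z (c r) (x n) (x n) l01.
  have h3 : d (c 0) m <= rho.
    rewrite -[leLHS]ger0_norm ?mdist_ge0// -sqrtr_sqr ler_wsqrtr//.
    move: h1; rewrite z1 cl sub0r normrN (ger0_norm (ltW r0)).
    have : e ^+ 2 <= d z (c r) ^+ 2.
      by rewrite lerXn2r ?nnegrE ?mdist_ge0 ?(ltW e0)//; exact: ltW.
    lra.
  have [_] := pntP Xcat0 (x n) (x n) l01; rewrite mdistxx mulr0.
  move=> /(@mdist_positivity R) mx; rewrite mx in h2.
  have := metric_triangle (c 0) m (x n).
  rewrite /f (metric_sym (x n) (c 0)) (metric_sym (x n) (c r)) -/m in h2 *.
  by rewrite z2 in h2; lra.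
have slope n s u : r <= s -> s <= u -> f n s - (1 - del) * (u - s) <= f n u.
  move=> rs su; have s0 : 0 < s by lra.
  have u0 : 0 < u by lra.
  have h1 : f n r - f n 0 <= r / s * (f n s - f n 0).
    by apply: dist_line_convex => //; rewrite r0.
  have h2 : f n s - f n 0 <= s / u * (f n u - f n 0).
    by apply: dist_line_convex => //; rewrite s0.
  rewrite mulrAC ler_pdivlMr// in h1; rewrite mulrAC ler_pdivlMr// in h2.
  have h3 : - (1 - del) * s <= f n s - f n 0.
    rewrite -(ler_pM2l r0); apply: le_trans h1.
    by have := slope0 n; nra.
  rewrite -(ler_pM2l s0); nra.
have decr n s u : s <= u -> u <= n%:R -> f n u <= f n s.
  move=> su un; have [ns nx _ _] := xsP n.
  by apply: dist_line_decreasing cl ns su _; lra.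
have fn0 n s : n%:R - s <= 2 * f n s.
  have [ns nx _ _] := xsP n; have := metric_triangle (c s) (x n) (c (xs n).2).
  have := ns s; rewrite cl (metric_sym (c s)) -/(x n) /f -normrN opprB.
  by have := ler_norm ((xs n).2 - s); lra.
(* This [v] keeps the limit curve [w]-far from every [c u]. Up to [u - s = v * (1 + del / 2)] the
   point [y s n] is nearer to [x n] than [c u] is by at least [w]; beyond, the triangle inequality
   through [c s] suffices. *)
pose v := 2 * w / del.
have vd : v * del = 2 * w by rewrite /v divfK ?gt_eqF.
have v0 : 0 < v by rewrite divr_gt0// mulr_gt0.
pose y s n := alg (c s) (x n) v.
have fbig b s : omega [set n | b <= f n s].
  apply: filterS (omega_real (2 * b + s)) => n /= hn.
  by have := fn0 n s; lra.
have ydist s n : v <= f n s -> d (c s) (y s n) = v /\ d (y s n) (x n) = f n s - v.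
  rewrite /f metric_sym => vf; have := @alg_dist _ _ Xcat0 (c s) (x n) v.
  by rewrite ltW//= metric_sym; apply; rewrite metric_sym.
have cvy s : ucvg (y s) (ulim (y s)).
  apply: (@ulimP _ _ Xproper _ (c s) v); apply: filterS (fbig v s) => n /= hn.
  by have [-> _] := ydist s n hn.
apply: (thin_no_ray (a := r) (v := v) (c' := fun s => ulim (y s)) tr th).
- move=> s t rs rt; apply: (ucvg_le (cvy s) (cvy t)) => e1 e10.
  pose M := v * `|s - t| / e1.
  apply: filterS (filterI (filterI (fbig v s) (fbig v t)) (fbig (M + 1) s)).
  move=> n /= [[hs ht] hM].
  have M0 : 0 <= M.
    apply: divr_ge0; last exact: ltW.
    by apply: mulr_ge0; [exact: ltW|exact: normr_ge0].
  rewrite /f !(metric_sym (x n)) in hs ht hM.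
  have f0 : 0 < d (c s) (x n) by lra.
  have vs : 0 <= v <= d (c s) (x n) by rewrite ltW.
  have := alg_fellow Xcat0 vs ht f0; rewrite cl => /le_trans; apply.
  rewrite lerD2l ler_pdivrMr// [e1 * _]mulrC -ler_pdivrMr//.
  by rewrite -/M; lra.
- move=> s rs; apply: (ucvg_le (ucvg_cst _) (cvy s)) => e1 e10.
  by apply: filterS (fbig v s) => n /= hn; have [-> _] := ydist s n hn; rewrite lerDl ltW.
move=> u s ru rs; apply: (ucvg_ge (ucvg_cst _) (cvy s)) => e1 e10.
apply: filterS (filterI (filterI (fbig v s) (omega_real s)) (omega_real u)).
move=> n /= [[vf sn] un]; have [y1 y2] := ydist s n vf.
have h1 : v + f n u - f n s <= d (c u) (y s n).
  have := metric_triangle (c u) (y s n) (x n).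
  by rewrite (metric_sym (c u) (x n)) -/(f n u) y2; lra.
have h2 : u - s - v <= d (c u) (y s n).
  have := metric_triangle (c u) (y s n) (c s).
  rewrite (metric_sym (y s n) (c s)) y1 cl.
  by have := ler_norm (u - s); lra.
have [us|su] := leP u s.
  have := decr n u s us sn; nra.
have h3 := slope n s u rs (ltW su).
suff : w <= d (c u) (y s n) by lra.
have [hu|hu] := leP (v * (1 + del / 2)) (u - s); first by nra.
have : (1 - del) * (u - s) <= (1 - del) * (v * (1 + del / 2)).
  by apply: ler_wpM2l; lra.
nra.
Qed.

End Thin.

(** * Subsegments and deformation of segments *)

Section Segments.
Variables (R : realType) (X : metricType R).
Local Notation d := (@mdist R X).
Implicit Types (c : R -> X) (x y p q : X) (s t l a b h k e K W w u v r tau : R).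
Hypothesis Xcat0 : cat0 X.

Definition on_segment x y p := d x p + d p y = d x y.

Lemma on_segment_sym x y p : on_segment x y p -> on_segment y x p.
Proof.
by rewrite /on_segment => h; rewrite addrC (metric_sym p x) (metric_sym y p) (metric_sym y x).
Qed.

Lemma on_segment_alg x y p : on_segment x y p -> p = alg x y (d x p).
Proof.
rewrite /on_segment => h; apply: alg_unique => //; last by lra.
by have := mdist_ge0 p y; have := mdist_ge0 x p; lra.
Qed.

Lemma alg_on_segment x y t : 0 <= t <= d x y -> on_segment x y (alg x y t).
Proof. by move=> ht; rewrite /on_segment; have [-> ->] := alg_dist Xcat0 ht; lra. Qed.

Lemma pnt_on_segment x y l : 0 <= l <= 1 -> on_segment x y (pnt l x y).
Proof. by move=> l01; rewrite /on_segment; have [-> ->] := pntP Xcat0 x y l01; lra. Qed.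

Lemma pnt_alg x y l : 0 <= l <= 1 -> pnt l x y = alg x y (l * d x y).
Proof.
move=> l01; have /andP[l0 l1] := l01; have [h1 h2] := pntP Xcat0 x y l01.
apply: alg_unique => //; last by lra.
by rewrite mulr_ge0 ?mdist_ge0//= ler_piMl ?mdist_ge0.
Qed.

Lemma on_segment_pnt x y p : on_segment x y p ->
  exists2 l, 0 <= l <= 1 & p = pnt l x y.
Proof.
move=> h; exists (d x p / d x y); last exact: on_segment_alg.
have [] // := @alg_frac _ _ x y (d x p).
by move: h; rewrite /on_segment; have := mdist_ge0 p y; have := mdist_ge0 x p; lra.
Qed.

Lemma pnt_dist x y l k : 0 <= l <= k -> k <= 1 ->
  d (pnt l x y) (pnt k x y) = (k - l) * d x y.
Proof.
move=> /andP[l0 lk] k1; have d0 := mdist_ge0 x y; rewrite !pnt_alg; try lra.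
rewrite alg_dist2 //; first by ring.
  by rewrite mulr_ge0//= ler_wpM2r.
by rewrite ler_piMl.
Qed.

Lemma alg_suffix x y p t : on_segment x y p -> 0 <= t <= d p y ->
  alg x y (d x p + t) = alg p y t.
Proof.
move=> xyp /andP[t0 tp]; have := xyp; rewrite /on_segment => h.
have x0 := mdist_ge0 x p.
have [h1 h2] := @alg_dist _ _ Xcat0 x y (d x p + t) ltac:(lra).
apply: alg_unique => //; [by lra| |by rewrite h2; lra].
by rewrite {1}(on_segment_alg xyp) alg_dist2//; lra.
Qed.

Lemma alg_prefix x y p t : on_segment x y p -> 0 <= t <= d x p ->
  alg x y (d x p - t) = alg p x t.
Proof.
move=> xyp /andP[t0 tp]; have := xyp; rewrite /on_segment => h.
have x0 := mdist_ge0 x p; have y0 := mdist_ge0 p y.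
have [h1 h2] := @alg_dist _ _ Xcat0 x y (d x p - t) ltac:(lra).
apply: alg_unique => //; first by rewrite metric_sym t0.
  by rewrite {1}(on_segment_alg xyp) metric_sym alg_dist2//; lra.
by rewrite metric_sym h1 (metric_sym p x).
Qed.

(** A discrete intermediate value argument: the deformation is cut into [N] steps that move each end
    by at most 1. Somewhere a good segment is followed by a bad one, which by convexity still comes
    within [D + 1] of [q]. *)
Lemma slide q D x0 y0 x1 y1 :
  (exists2 p, on_segment x0 y0 p & d q p <= D) ->
  (forall p, on_segment x1 y1 p -> D < d q p) ->
  exists l, [/\ 0 <= l <= 1,
    exists2 p, on_segment (pnt l x0 x1) (pnt l y0 y1) p & d q p <= D + 1 &
    forall p, on_segment (pnt l x0 x1) (pnt l y0 y1) p -> D < d q p].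
Proof.
move=> good0 bad1; pose M := d x0 x1 + d y0 y1 + 1.
pose N := (Num.truncn M).+1.
have MN : M <= N%:R by exact/ltW/truncnS_gt.
have N0 : 0 < N%:R :> R by rewrite ltr0n.
pose good l := exists2 p, on_segment (pnt l x0 x1) (pnt l y0 y1) p & d q p <= D.
have [i [iN gi ngi]] : exists i, [/\ (i < N)%N, good (i%:R / N%:R) &
    ~ good (i.+1%:R / N%:R)].
  apply: contrapT => H.
  have allgood i : (i <= N)%N -> good (i%:R / N%:R).
    elim: i => [|i IH] iN; first by rewrite mul0r /good !pnt0.
    by apply: contrapT => ng; apply: H; exists i; split=> //; apply/IH/ltnW.
  have := allgood N (leqnn _); rewrite divff ?gt_eqF// /good !pnt1//.
  by case=> p /bad1; rewrite ltNge => /negP.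
have iN' : i%:R + 1 <= N%:R :> R by rewrite natr1 ler_nat.
have i0 : 0 <= i%:R :> R by exact: ler0n.
rewrite -natr1 in ngi.
have l0 : 0 <= (i%:R / N%:R : R) <= ((i%:R + 1) / N%:R : R).
  by have := divr_ge0 i0 (ltW N0) => ->/=; rewrite ler_pM2r ?invr_gt0//; lra.
have l1 : ((i%:R + 1) / N%:R : R) <= 1 by rewrite ler_pdivrMr// mul1r.
exists ((i%:R + 1) / N%:R); split; first by lra.
  have [p pxy qp] := gi; have [m m01 pm] := on_segment_pnt pxy.
  set x := pnt (_ / _) x0 x1 in pm; set y := pnt (_ / _) y0 y1 in pm.
  set x' := pnt _ x0 x1; set y' := pnt _ y0 y1.
  have step z z' : d z z' <= N%:R ->
      d (pnt (i%:R / N%:R) z z') (pnt ((i%:R + 1) / N%:R) z z') <= 1.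
    move=> zN; rewrite pnt_dist// -mulrBl addrAC subrr add0r mulrC.
    by rewrite mul1r ler_pdivrMr// mul1r.
  have xx' : d x x' <= 1.
    by apply: step; move: MN; rewrite /M; have := mdist_ge0 y0 y1; lra.
  have yy' : d y y' <= 1.
    by apply: step; move: MN; rewrite /M; have := mdist_ge0 x0 x1; lra.
  exists (pnt m x' y'); first exact: pnt_on_segment.
  apply: le_trans (metric_triangle _ p _) _; apply: lerD => //.
  rewrite pm; apply: le_trans (pnt_convex Xcat0 x y x' y' m01) _.
  by case/andP: m01 => m0 m1; nra.
by move=> p pxy; rewrite ltNge; apply/negP => h; apply: ngi; exists p.
Qed.

Lemma nearest_slide c x s l : 0 <= l <= 1 -> nearest c x s ->
  nearest c (pnt l (c s) x) s.
Proof.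
move=> l01 ns u; have [h1 h2] := pntP Xcat0 (c s) x l01.
have := metric_triangle x (pnt l (c s) x) (c u).
have := ns u; rewrite (metric_sym x (pnt _ _ _)) (metric_sym _ (c s)).
by rewrite (metric_sym (pnt _ _ _) (c s)) h1 h2; lra.
Qed.

End Segments.

Section Visibility.
Variables (R : realType) (X : metricType R).
Local Notation d := (@mdist R X).
Implicit Types (c : R -> X) (x y p q : X) (s t l a b h k e K W w u v r tau : R).
Hypothesis Xcat0 : cat0 X.
Hypothesis Xproper : proper_space X.

(* Otherwise points x and y whose projections to c go to the two ends can be
   slid towards c until the segment from x to y stays at distance about w from
   c 0; these segments converge to a line parallel to c. *)
Lemma thin_visible g c tau w : translates g c tau -> thin c w -> 0 < w ->
  exists T, forall x y s t, nearest c x s -> nearest c y t -> s <= - T -> T <= t ->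
    exists2 p, on_segment x y p & d (c 0) p <= w.
Proof.
move=> tr th w0; have [cl tau0 gc] := tr.
apply: contrapT => nT.
have seqx (n : nat) : exists xy : X * X * X, [/\
    exists2 s, nearest c xy.1.1 s & s <= - n%:R,
    exists2 t, nearest c xy.1.2 t & n%:R <= t,
    on_segment xy.1.1 xy.1.2 xy.2,
    d (c 0) xy.2 <= w + 1 &
    forall p, on_segment xy.1.1 xy.1.2 p -> w < d (c 0) p].
  apply: contrapT => nx; apply: nT; exists n%:R => x y s t ns nt sn tn.
  apply: contrapT => bad; apply: nx; have n0 := ler0n R n.
  have [||l [l01 [p pxy pw] far]] := @slide _ _ Xcat0 (c 0) w (c s) (c t) x y.
  - exists (c 0); last by rewrite mdistxx ltW.
    by rewrite /on_segment !cl !ler0_norm; lra.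
  - by move=> p pxy; rewrite ltNge; apply/negP => pw; apply: bad; exists p.
  exists (pnt l (c s) x, pnt l (c t) y, p); split => //=.
    by exists s => //; exact: nearest_slide.
  by exists t => //; exact: nearest_slide.
have [xy xyP] := choice seqx.
pose x n := (xy n).1.1; pose y n := (xy n).1.2; pose p n := (xy n).2.
pose m n := d (x n) (p n).
pose rho t n := alg (x n) (y n) (m n + t).
(* A nearest parameter is at most twice the distance from [c 0], and [p n] is within [w + 1] of
   [c 0]. *)
have far_end n : n%:R / 2 <= m n + (w + 1) /\ n%:R / 2 <= d (p n) (y n) + (w + 1).
  have [[s ns sn] [t nt tn] _ pw _] := xyP n.
  have := nearest_far cl ns; have := nearest_far cl nt.
  have := metric_triangle (c 0) (p n) (x n); have := metric_triangle (c 0) (p n) (y n).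
  rewrite /m (metric_sym (x n)) -/(x n) -/(y n) -/(p n) in pw *.
  by have := ler_norm (- s); have := ler_norm t; rewrite normrN; lra.
have large b : omega [set n | b <= m n /\ b <= d (p n) (y n)].
  apply: filterS (omega_real (2 * (b + w + 1))) => n /= hn.
  by have [] := far_end n; lra.
have large2 b : omega [set n | `|b| <= m n /\ `|b| <= d (p n) (y n)] by exact: large.
have rho_in n t : `|t| <= m n -> `|t| <= d (p n) (y n) ->
    0 <= m n + t <= d (x n) (y n).
  have [_ _ seg _ _] := xyP n; rewrite !ler_norml => /andP[h1 _] /andP[_ h2].
  by move: seg; rewrite /on_segment -/(x n) -/(y n) -/(p n) -/(m n); lra.
have rho_rho n s t : `|s| <= m n -> `|s| <= d (p n) (y n) ->
    `|t| <= m n -> `|t| <= d (p n) (y n) -> d (rho s n) (rho t n) = `|s - t|.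
  move=> s1 s2 t1 t2; wlog st : s t s1 s2 t1 t2 / s <= t.
    move=> H; have [/H->//|/ltW ts] := leP s t.
    by rewrite metric_sym H// -normrN opprB.
  have := rho_in n s s1 s2; have := rho_in n t t1 t2 => ht hs.
  by rewrite alg_dist2 ?ler0_norm//; lra.
have pE n : p n = rho 0 n.
  by rewrite /rho addr0; apply: on_segment_alg; have [] := xyP n.
have pw n : d (c 0) (p n) <= w + 1 by have [] := xyP n.
have cvrho t : ucvg (rho t) (ulim (rho t)).
  apply: (@ulimP _ _ Xproper _ (c 0) (w + 1 + `|t|)); apply: filterS (large2 t) => n /= [h1 h2].
  apply: le_trans (metric_triangle _ (p n) _) _; apply: lerD => //.
  have z0 : `|0 : R| = 0 by rewrite normr0.
  rewrite pE rho_rho ?z0 ?mdist_ge0//; by rewrite sub0r normrN.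
have near_c t : omega [set n | d (c t) (rho t n) <= 2 * (w + 1) + 1].
  have [-> | t0] := eqVneq t 0.
    by apply: filterE => n /=; rewrite -pE; have := pw n; lra.
  have ta : 0 < `|t| by rewrite normr_gt0.
  have one : 0 < 1 :> R by [].
  (* Serves both ends of [c]: the segment from [p n] to [z n] stays within [2 * (w + 1)] of the one
     from [c 0], which follows [c] by [thin_cone]. *)
  have aux z c' : c' 0 = c 0 -> forall n,
      `|t| <= d (p n) (z n) ->
      `|t| <= d (c 0) (z n) /\ d (alg (c 0) (z n) `|t|) (c' `|t|) <= 1 ->
      d (c' `|t|) (alg (p n) (z n) `|t|) <= 2 * (w + 1) + 1.
    move=> c'0 n h1 [h2 h3]; apply: le_trans (metric_triangle _ (alg (c 0) (z n) `|t|) _) _.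
    rewrite addrC (metric_sym (c' _)) lerD//.
    have h1' : 0 <= `|t| <= d (c 0) (z n) by rewrite normr_ge0.
    by apply: le_trans (alg_fellow2 Xcat0 h1' h1) _; have := pw n; lra.
  have [tp|tn] := ltP 0 t.
    have [T hT] := thin_cone Xcat0 Xproper tr th w0 ta one.
    apply: filterS (filterI (omega_real T) (large2 t)) => n /= [nT' [h1 h2]].
    have [_ [s ns sn] seg _ _] := xyP n.
    have := aux y c erefl n h2 (hT _ _ ns (le_trans nT' sn)).
    by rewrite gtr0_norm// /rho /m alg_suffix// ltW//=; rewrite gtr0_norm in h2.
  have tn' : t < 0 by rewrite lt_neqAle t0.
  have [T hT] := thin_cone Xcat0 Xproper (translates_rev tr) (thin_rev th) w0 ta one.
  apply: filterS (filterI (omega_real T) (large2 t)) => n /= [nT' [h1 h2]].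
  have [[s ns sn] _ seg _ _] := xyP n.
  have h1' : `|t| <= d (p n) (x n) by rewrite metric_sym.
  have rT : T <= - s by lra.
  have := hT _ _ (nearest_rev ns) rT; rewrite {1 2}/reversed oppr0 => hT'.
  have := aux x (reversed c) _ n h1' hT'; rewrite /reversed oppr0 => /(_ erefl).
  have tE : - `|t| = t by rewrite ltr0_norm// opprK.
  have -> : rho t n = alg (p n) (x n) `|t|.
    by rewrite /rho -[in LHS]tE /m alg_prefix// normr_ge0.
  by rewrite tE.
pose ell t := ulim (rho t).
have ell_line : geodesic_line ell.
  move=> s t; apply: (ucvg_eq (cvrho s) (cvrho t)).
  by apply: filterS (filterI (large2 s) (large2 t)) => n /= [[? ?] [? ?]]; exact: rho_rho.
have ell_near t : d (c t) (ell t) <= 2 * (w + 1) + 1.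
  apply: (ucvg_le (ucvg_cst _) (cvrho t)) => e e0.
  by apply: filterS (near_c t) => n /= h; lra.
apply: (th ell _ ell_line ell_near) => s t.
(* The segments are known to avoid only the ball about [c 0]; since the distance between parallel
   lines is constant, the bound carries over to any [c s]. *)
have cs : geodesic_line (fun u => c (s + u)).
  by move=> a b; rewrite cl; congr (Num.norm _); ring.
have et : geodesic_line (fun u => ell (t + u)).
  by move=> a b; rewrite ell_line; congr (Num.norm _); ring.
have := @parallel_cst _ _ Xcat0 _ _ (`|s - t| + (2 * (w + 1) + 1)) cs et _ 0 (- s).
rewrite !addr0 subrr => ->.
  apply: (ucvg_ge (ucvg_cst _) (cvrho (t - s))) => e e0.
  apply: filterS (large2 (t - s)) => n /= [h1 h2].
  have [_ _ _ _ far] := xyP n.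
  have := far (rho (t - s) n) (alg_on_segment Xcat0 (rho_in _ _ h1 h2)).
  by lra.
move=> u; apply: le_trans (metric_triangle _ (c (t + u)) _) _.
by apply: lerD => //; rewrite cl opprD addrACA subrr addr0.
Qed.

End Visibility.

(** * Axes of isometries that attain a positive minimal displacement *)

Section AxisExistence.
Variables (R : realType) (X : metricType R).
Local Notation d := (@mdist R X).
Implicit Types (c : R -> X) (x y p q : X) (s t l a b k e K W w u v r tau : R).
Implicit Types (g h : isom X).
Hypothesis Xcat0 : cat0 X.

Lemma isom_distX g n x : d x ((g ^+ n)%g x) <= n%:R * d x (g x).
Proof.
elim: n => [|n IH]; first by rewrite mul0r mdistxx.
apply: le_trans (metric_triangle _ ((g ^+ n)%g x) _) _.
by rewrite isomXSr isom_dist -natr1 mulrDl mul1r lerD2r.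
Qed.

Lemma pnt_isom g l x y : 0 <= l <= 1 -> g (pnt l x y) = pnt l (g x) (g y).
Proof.
move=> l01; apply: pnt_unique => //; have [h1 h2] := pntP Xcat0 x y l01.
by split; rewrite !isom_dist.
Qed.

Lemma on_segment_isom g x y p : on_segment x y p -> on_segment (g x) (g y) (g p).
Proof. by rewrite /on_segment !isom_dist. Qed.

(* g maps the midpoint of [x, g x] to that of [g x, g (g x)]. *)
Lemma displacement_double g tau : (forall x, tau <= d x (g x)) ->
  forall x, 2 * tau <= d x (g (g x)).
Proof.
move=> gt x; have l01 : 0 <= (2^-1 : R) <= 1 by lra.
have l01' : 0 <= (1 - 2^-1 : R) <= 1 by lra.
have := gt (pnt 2^-1 x (g x)); rewrite pnt_isom// -(pnt_sym Xcat0 x)//.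
have -> : 1 - 2^-1 = 2^-1 :> R by lra.
have := pnt_thales Xcat0 (g x) x (g (g x)) l01.
by lra.
Qed.

Lemma displacement_pow2 g tau : (forall x, tau <= d x (g x)) ->
  forall (k : nat) x, (2 ^ k)%:R * tau <= d x ((g ^+ (2 ^ k))%g x).
Proof.
move=> gt; elim=> [|k IH] x; first by rewrite mul1r.
have := displacement_double IH x.
by rewrite -isomM -expgnDr addnn -mul2n -expnS mulrA -natrM -expnS.
Qed.

(** Doubling gives the lower bound only at powers of two. As [n <= 2 ^ n], a shortfall at exponent
    [n] would by the triangle inequality persist at exponent [2 ^ n]. *)
Lemma displacement_pow g tau q : (forall x, tau <= d x (g x)) -> d q (g q) = tau ->
  forall n, d q ((g ^+ n)%g q) = n%:R * tau.
Proof.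
move=> gt gq n; apply/eqP; rewrite eq_le -{1}gq isom_distX /=.
have n2 : (n <= 2 ^ n)%N by exact/ltnW/ltn_expl.
have := displacement_pow2 gt n q; rewrite -{1 2}(subnKC n2) expgnDr isomM.
have := metric_triangle q ((g ^+ n)%g q) ((g ^+ n)%g ((g ^+ (2 ^ n - n))%g q)).
rewrite isom_dist; have := isom_distX g (2 ^ n - n) q.
by rewrite gq natrD; lra.
Qed.

Lemma alg_sub x y p q t : on_segment x y p -> on_segment p y q -> 0 <= t <= d p q ->
  alg p q t = alg x y (d x p + t).
Proof.
move=> xyp pyq /andP[t0 tq]; have := pyq; rewrite /on_segment => h.
have q0 := mdist_ge0 q y.
rewrite alg_suffix//; last by lra.
by rewrite (on_segment_alg Xcat0 pyq) alg_alg// ?t0//; lra.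
Qed.

(** By [displacement_pow] the orbit of a point [q] of minimal displacement lies in order on
    geodesics, so the segments from [g^-n q] to [g^n q] are nested and their union is the axis;
    [cn n] parametrises the [n]-th one with [q] at time 0. *)
Lemma displacement_axis g tau : 0 < tau -> min_displacement g tau ->
  exists c, axis g c.
Proof.
move=> tau0 [[q gq] gt].
pose lo n : X := ((g ^+ n)^-1)%g q; pose hi n := (g ^+ n)%g q.
have dpow := displacement_pow gt gq.
have loE n m : lo n = ((g ^+ (m + n))^-1)%g (hi m).
  by rewrite /lo /hi -isomM expgnDr invgM -mulgA mulVg mulg1.
have dlo n m : d (lo (m + n)%N) (lo n) = m%:R * tau.
  rewrite -(dpow m) (loE n m) /lo isom_dist; by [].
have dlohi n m : d (lo n) (hi m) = (n + m)%:R * tau.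
  by rewrite -(dpow (n + m)%N) -(isom_dist (g ^+ n)%g) /lo isomVK expgnDr.
have dhi n m : d (hi n) (hi (n + m)%N) = m%:R * tau.
  by rewrite /hi expgnDr isomM isom_dist.
pose cn n t := alg (lo n) (hi n) (t + n%:R * tau).
have inn n t : `|t| <= n%:R * tau -> 0 <= t + n%:R * tau <= d (lo n) (hi n).
  by rewrite ler_norml dlohi natrD; lra.
have cnS n t : `|t| <= n%:R * tau -> cn n t = cn n.+1 t.
  move=> tn; have t2 := inn n t tn; rewrite /cn.
  rewrite (@alg_sub (lo n.+1) (hi n.+1) (lo n) (hi n))//.
  - by rewrite -(add1n n) (dlo n 1%N) -natr1; congr alg; rewrite natrD; ring.
  - by rewrite /on_segment -(add1n n) (dlo n 1%N) !dlohi -mulrDl -natrD addnA.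
  - by rewrite /on_segment -(addn1 n) dhi !dlohi -mulrDl -natrD addnA.
have cnD n m t : `|t| <= n%:R * tau -> cn n t = cn (n + m)%N t.
  move=> tn; elim: m => [|m ->]; first by rewrite addn0.
  rewrite addnS cnS//; apply: (le_trans tn).
  by rewrite ler_pM2r// ler_nat leq_addr.
pose N t := (Num.truncn (`|t| / tau)).+1.
have NP t : `|t| <= (N t)%:R * tau.
  by rewrite -ler_pdivrMr//; exact/ltW/truncnS_gt.
pose c t := cn (N t) t.
have cE t n : (N t <= n)%N -> c t = cn n t.
  by move=> h; rewrite -(subnKC h) /c; apply: cnD.
have NPn t n : (N t <= n)%N -> `|t| <= n%:R * tau.
  by move=> h; apply: (le_trans (NP t)); rewrite ler_pM2r// ler_nat.
have gcn n t : `|t| <= n%:R * tau -> g (cn n t) = cn n.+1 (t + tau).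
  move=> tn; have t2 := inn n t tn.
  (* Stage 0 is the single point [q], and its image is the right end of stage 1. *)
  rewrite /cn (alg_isom Xcat0)//; case: n tn t2 => [|n] tn t2.
    move: t2; rewrite dlohi mul0r addr0 => t2.
    have -> : t = 0 by lra.
    rewrite !add0r mul1r alg0//.
    have glo : g (lo 0%N) = hi 1%N by rewrite /lo /hi invg1 isom1 expg1.
    by rewrite glo -[LHS](alg_end Xcat0 (lo 1%N)) dlohi; congr alg; ring.
  have gloE : g (lo n.+1) = lo n by rewrite /lo expgSr invgM isomM isomVK.
  have ghiE : g (hi n.+1) = hi n.+2 by rewrite /hi [in RHS]isomXS.
  rewrite gloE ghiE (@alg_sub (lo n.+2) (hi n.+2) (lo n) (hi n.+2)).
  - rewrite -(add2n n) (dlo n 2%N); congr alg.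
    by rewrite add2n -!natr1; ring.
  - by rewrite /on_segment -(add2n n) (dlo n 2%N) !dlohi -mulrDl -natrD addnA.
  - by rewrite /on_segment mdistxx addr0.
  - move: t2; rewrite !dlohi; congr (_ && (_ <= _ * _)).
    by rewrite !addnS addSn.
exists c; split.
  move=> s t; wlog st : s t / s <= t.
    move=> H; have [/H//|/ltW ts] := leP s t.
    by rewrite metric_sym H// -normrN opprB.
  have h1 := leq_maxl (N s) (N t); have h2 := leq_maxr (N s) (N t).
  rewrite (cE _ _ h1) (cE _ _ h2).
  have := inn _ _ (NPn _ _ h1); have := inn _ _ (NPn _ _ h2) => i1 i2.
  rewrite /cn alg_dist2// ?ler0_norm; lra.
exists tau; split=> //; first by split=> //; exists q.
move=> t; have h1 := leq_maxl (N t) (N (t + tau)).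
have h2 := leq_maxr (N t) (N (t + tau)).
by rewrite (cE t _ h1) gcn ?(NPn _ _ h1)// -(cE _ _ (leqW h2)).
Qed.

End AxisExistence.

(** * A ping-pong criterion for rank-one isometries *)

Section Criterion.
Variables (R : realType) (X : metricType R).
Local Notation d := (@mdist R X).
Implicit Types (c : R -> X) (x y p q : X) (s t l a b k e K W w u v r tau : R).
Implicit Types (g h : isom X) (U V : set X).
Hypothesis Xcat0 : cat0 X.
Hypothesis Xproper : proper_space X.

(** [N] depends on the radius [s] alone, because in [visible_not_flat] the points are chosen after
    [N]. *)
Definition orbits_visible g q K := forall s, exists N, forall n x y, (N <= n)%N ->
  d q x <= s -> d q y <= s ->
  exists2 p, on_segment (((g ^+ n)^-1)%g x) ((g ^+ n)%g y) p & d q p <= K.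

Lemma displacement_convex g x y p : on_segment x y p ->
  d p (g p) <= Num.max (d x (g x)) (d y (g y)).
Proof.
move=> /(on_segment_pnt Xcat0)[l l01 ->]; rewrite (pnt_isom Xcat0)//.
apply: le_trans (pnt_convex Xcat0 _ _ _ _ l01) _.
set M := Num.max _ _.
have h1 : d x (g x) <= M by rewrite le_max lexx.
have h2 : d y (g y) <= M by rewrite le_max lexx orbT.
case/andP: l01 => l0 l1; nra.
Qed.

(** Both ends of the segment from [g^-N x] to [g^N x] have the displacement of [x], and displacement
    is convex along segments; so [back] replaces [x] by a point of a fixed ball with no larger
    displacement, and properness yields a minimum. *)
Lemma visible_min_displacement g q K : orbits_visible g q K ->
  exists tau, min_displacement g tau.
Proof.
move=> vis.
have back x : exists2 y, d q y <= K & d y (g y) <= d x (g x).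
  have [N /(_ N x x (leqnn _) (lexx _) (lexx _))[p seg pK]] := vis (d q x).
  exists p => //; apply: le_trans (displacement_convex g seg) _.
  have gV : g (((g ^+ N)^-1)%g x) = ((g ^+ N)^-1)%g (g x).
    by rewrite -!isomM; congr isom_fun; apply/commuteV/commuteX.
  have gX : g ((g ^+ N)%g x) = (g ^+ N)%g (g x) by rewrite -isomXS isomXSr.
  by rewrite gV gX !isom_dist maxxx.
pose A := [set d x (g x) | x in setT].
have infA : has_inf A.
  by split; [exists (d q (g q)), q|exists 0 => _ [x _ <-]; exact: mdist_ge0].
have seqy (n : nat) : exists y, d q y <= K /\ d y (g y) <= inf A + n.+1%:R^-1.
  have n0 : 0 < n.+1%:R^-1 :> R by rewrite invr_gt0 ltr0n.
  have [_ [x _ <-] xA] := inf_adherent n0 infA.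
  by have [y yK yx] := back x; exists y; split=> //; exact/ltW/(le_lt_trans yx).
have [y yP] := choice seqy; have inf_le x : inf A <= d x (g x).
  by apply: ge_inf => //; [exact: infA.2|exists x].
have cvy : ucvg y (ulim y).
  by apply: (@ulimP _ _ Xproper _ q K); apply: filterE => n /=; have [] := yP n.
have cvgy : ucvg (fun n => g (y n)) (g (ulim y)).
  by move=> e e0; apply: filterS (cvy e e0) => n /=; rewrite isom_dist.
exists (inf A); split=> //; exists (ulim y); apply/eqP; rewrite eq_le inf_le andbT.
apply: (ucvg_le cvy cvgy) => e e0; apply: filterS (omega_real e^-1) => n /= hn.
have [_ h] := yP n; apply: (le_trans h); rewrite lerD2l.
rewrite invf_ple ?posrE ?ltr0n//; apply: (le_trans hn).
by rewrite ler_nat.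
Qed.

(** [x'] and [y'] lie at height [m] over [c (- tau N)] and [c (tau N)]. Whatever [g] does to the
    half-plane, [g^N x'] and [g^-N y'] are at distance [m] from [c 0], so visibility applies; but
    the segment from [x'] to [y'] stays at height [m], out of reach of the ball about [q]. *)
Lemma visible_not_flat g q K c : orbits_visible g q K -> axis g c ->
  ~ bounds_flat_half_plane c.
Proof.
move=> vis [cl [tau [tau0 _ gc]]] [F [FF F0]].
have tr : translates g c tau by [].
pose s := K + d q (c 0) + 1.
have [N /(_ N)] := vis (Num.max 0 s + d q (c 0)); set m := Num.max 0 s.
have m0 : 0 <= m by rewrite le_max lexx.
have sm : s <= m by rewrite le_max lexx orbT.
pose x' := F (- (tau * N%:R), m); pose y' := F (tau * N%:R, m).
move=> /(_ ((g ^+ N)%g x') (((g ^+ N)^-1)%g y') (leqnn _)).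
have Fv t : d (F (t, m)) (c t) = m.
  rewrite -F0 FF//=; apply: edist_eq => //=; ring.
have TN0 : 0 <= tau * N%:R by rewrite mulr_ge0 ?ler0n// ltW.
case.
- apply: le_trans (metric_triangle _ (c 0) _) _; rewrite addrC lerD2r.
  rewrite metric_sym -(isom_dist ((g ^+ N)^-1)%g) isomK (translatesVX _ _ tr).
  by rewrite sub0r Fv.
- apply: le_trans (metric_triangle _ (c 0) _) _; rewrite addrC lerD2r.
  rewrite metric_sym -(isom_dist (g ^+ N)%g) isomVK (translatesX _ _ tr).
  by rewrite add0r Fv.
move=> p; rewrite isomK isomVK => seg pK.
have dxy : d x' y' = 2 * (tau * N%:R).
  rewrite FF//=; apply: edist_eq => /=; [lra|ring].
have pE : p = F (d x' p - tau * N%:R, m).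
  have p0 := mdist_ge0 x' p; have p1 := mdist_ge0 p y'.
  rewrite [LHS](on_segment_alg Xcat0 seg); apply/esym/(alg_unique Xcat0).
  - by rewrite p0; move: seg; rewrite /on_segment; lra.
  - by rewrite FF//=; apply: edist_eq => //=; ring.
  - rewrite FF//=; apply: edist_eq => /=; last by rewrite dxy; ring.
    by move: seg; rewrite /on_segment; lra.
have : m <= d p (c 0).
  rewrite pE -F0 FF//= -(@ler_pXn2r _ 2) ?nnegrE ?edist_ge0// edist_sqr /=.
  by rewrite !subr0 lerDr sqr_ge0.
have := metric_triangle p q (c 0); rewrite (metric_sym p q).
by move: sm; rewrite /s; lra.
Qed.

(** Unbounded orbits exclude minimal displacement 0, since a fixed point would keep every orbit in a
    ball. *)
Lemma visible_rank_one g q K : orbits_visible g q K ->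
  (forall B, exists n, B < d q ((g ^+ n)%g q)) -> rank_one g.
Proof.
move=> vis unb; have [tau md] := visible_min_displacement vis.
have tau0 : 0 < tau.
  have [[x gx] _] := md; rewrite lt_neqAle -gx mdist_ge0 andbT eq_sym.
  apply/eqP => /(@mdist_positivity R) xE; have [n] := unb (2 * d q x).
  have gn : (g ^+ n)%g x = x by elim: n => // n IH; rewrite isomXS IH.
  have := metric_triangle q x ((g ^+ n)%g q).
  by rewrite -{2}gn isom_dist (metric_sym x q); lra.
split; first by exists tau.
have [c ax] := displacement_axis Xcat0 tau0 md.
by exists c => //; exact: visible_not_flat vis ax.
Qed.

(** Table-tennis for one isometry with two metric additions: segments from [U] to [V] pass near [q],
    and [g] moves [q] by more than the [2 * K] that may be lost there at each turn. *)
Definition ping_pong g U V q K := [/\ forall x, ~ U x -> V (g x),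
  forall x, U x -> ~ V x, ~ U q /\ ~ V q,
  forall x y, U x -> V y -> exists2 p, on_segment x y p & d q p <= K &
  2 * K < d q (g q)].

Lemma ping_pongV g U V q K : ping_pong g U V q K -> ping_pong (g^-1)%g V U q K.
Proof.
move=> [h1 h2 [h3 h4] h5 h6]; split=> //.
- by move=> x nV; apply: contrapT => nU; apply: nV; rewrite -(isomVK g x); exact: h1.
- by move=> x Vx Ux; exact: h2 Vx.
- move=> x y Vx Uy; have [p seg pK] := h5 _ _ Uy Vx; exists p => //.
  exact: on_segment_sym.
- by rewrite metric_sym -(isom_dist g) isomVK.
Qed.

Lemma ping_pong_iter g U V q K n x : ping_pong g U V q K -> ~ U x ->
  V ((g ^+ n.+1)%g x).
Proof.
move=> [h1 h2 _ _ _] nU; elim: n => [|n IH]; first by rewrite expg1; exact: h1.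
by rewrite isomXS; apply: h1 => /h2.
Qed.

(** The segment from [g^-1 q] to [g^n q] joins [U] to [V] and passes within [K] of [q], so each
    application gains [d q (g q)] up to a loss of [2 * K]. *)
Lemma ping_pong_growth g U V q K n : ping_pong g U V q K ->
  n%:R * (d q (g q) - 2 * K) <= d q ((g ^+ n)%g q).
Proof.
move=> pp; have [_ _ [nU nV] vis big] := pp.
elim: n => [|[|n] IH]; first by rewrite mul0r mdist_ge0.
  have [p _ pK] := vis _ _ (ping_pong_iter 0 (ping_pongV pp) nV) (ping_pong_iter 0 pp nU).
  by rewrite mul1r expg1; have := mdist_ge0 q p; lra.
have [] := vis ((g^-1)%g q) ((g ^+ n.+1)%g q).
- by have := ping_pong_iter 0 (ping_pongV pp) nV; rewrite expg1.
- exact: ping_pong_iter pp nU.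
move=> p; rewrite /on_segment => seg pK.
rewrite -natr1 mulrDl mul1r.
have -> : d q ((g ^+ n.+2)%g q) = d ((g^-1)%g q) ((g ^+ n.+1)%g q).
  by rewrite -[RHS](isom_dist g) isomVK -isomXS.
have := metric_triangle ((g^-1)%g q) p q; have := metric_triangle q p ((g ^+ n.+1)%g q).
have -> : d ((g^-1)%g q) q = d q (g q) by rewrite -[LHS](isom_dist g) isomVK.
by rewrite (metric_sym p q); lra.
Qed.

(** A point of the ball may start in [U]. Were it still there after [M] steps, the segment to
    [g^M q], of length at most [s], would pass near [q], against the growth of [g^M q]. *)
Lemma ping_pong_uniform g U V q K : ping_pong g U V q K -> forall s,
  exists N, forall n x, (N <= n)%N -> d q x <= s -> V ((g ^+ n)%g x).
Proof.
move=> pp s; have [h1 h2 [nU nV] vis big] := pp.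
have L0 : 0 < d q (g q) - 2 * K by lra.
pose M := (Num.truncn ((K + s) / (d q (g q) - 2 * K))).+1.
have MP : K + s < M%:R * (d q (g q) - 2 * K).
  by rewrite -ltr_pdivrMr//; exact: truncnS_gt.
(* Once out of [U], one more step leads into [V]. *)
exists M.+1 => n x Mn xs.
have [UM|nUM] := pselect (U ((g ^+ M)%g x)).
  have [p seg pK] := vis _ _ UM (ping_pong_iter M.-1 pp nU).
  have := ping_pong_growth M pp.
  have := metric_triangle q p ((g ^+ M)%g q); move: seg; rewrite /on_segment.
  rewrite isom_dist (metric_sym x q); have := mdist_ge0 ((g ^+ M)%g x) p.
  by lra.
have -> : n = ((n - M.+1).+1 + M)%N by rewrite addSnnS subnK.
by rewrite expgnDr isomM; exact: ping_pong_iter pp nUM.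
Qed.

Lemma ping_pong_rank_one g U V q K : ping_pong g U V q K -> rank_one g.
Proof.
move=> pp; have [h1 h2 [nU nV] vis big] := pp.
apply: (@visible_rank_one g q K) => [s|B].
  have [N hN] := ping_pong_uniform pp s.
  have [M hM] := ping_pong_uniform (ping_pongV pp) s.
  exists (maxn N M) => n x y; rewrite geq_max => /andP[Nn Mn] xs ys.
  by apply: vis; [rewrite -expVgn; exact: hM|exact: hN].
have L0 : 0 < d q (g q) - 2 * K by lra.
exists (Num.truncn (B / (d q (g q) - 2 * K))).+1.
apply: lt_le_trans (ping_pong_growth _ pp).
by rewrite -ltr_pdivrMr//; exact: truncnS_gt.
Qed.

End Criterion.

(** * The boundary *)

Section Curves.
Variables (R : realType) (X : metricType R).
Local Notation d := (@mdist R X).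
Implicit Types (xi eta zeta : curve X) (x y p q o : X) (s t r e K : R) (g h : isom X).

(** Extends a curve evenly to real parameters, so that times can be added and compared in [R]. *)
Definition pt xi t : X := xi (NngNum (normr_ge0 t)).

Lemma pt_nng xi (t : {nonneg R}) : pt xi t%:num = xi t.
Proof. by congr (xi _); apply: val_inj => /=; rewrite ger0_norm. Qed.

Lemma curve_ext xi eta : (forall t, 0 <= t -> pt xi t = pt eta t) -> xi = eta.
Proof. by move=> h; apply/funext => t; rewrite -!pt_nng h. Qed.

Definition curve_of (r : R -> X) : curve X := fun t : {nonneg R} => r t%:num.

Lemma pt_curve_of (r : R -> X) t : 0 <= t -> pt (curve_of r) t = r t.
Proof. by move=> t0; rewrite /pt /curve_of /= ger0_norm. Qed.

Lemma boundaryP o xi : boundary o xi <-> is_ray (pt xi) /\ pt xi 0 = o.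
Proof.
split=> [[xi0 xid]|[xid xi0]].
  split; first by move=> s t s0 t0; rewrite /pt xid /= (ger0_norm s0) (ger0_norm t0).
  by rewrite -xi0; congr (xi _); apply: val_inj; rewrite /= normr0.
split; first by rewrite -xi0 -pt_nng.
by move=> s t; rewrite -!pt_nng xid.
Qed.

Lemma asymptoticP xi eta :
  asymptotic xi eta <-> exists K, forall t, 0 <= t -> d (pt xi t) (pt eta t) <= K.
Proof.
split=> [[K hK]|[K hK]]; exists K => t; first by move=> _; exact: hK.
by rewrite -!pt_nng; exact: hK.
Qed.

Definition dball xi r e := [set eta | forall t, 0 <= t <= r -> d (pt xi t) (pt eta t) < e].

Lemma nbhs_dball xi r e : 0 < e -> nbhs xi (dball xi r e).
Proof.
move=> e0.
pose E := [set p : X * X | d p.1 p.2 < e].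
have entE : entourage E.
  rewrite -entourage_ballE; exists e => // -[x y] /=.
  by rewrite ballEmdist.
have := @fam_nbhs {nonneg R} X
  (fun A : set {nonneg R} => exists r : R, forall t : {nonneg R}, A t -> t%:num <= r)
  [set t : {nonneg R} | t%:num <= r] E xi entE (ex_intro _ r (fun _ k => k)).
move=> H; apply: (@filterS _ _ (@nbhs_filter (curve X) xi) _ _ _ H).
move=> eta /= h t /andP[t0 tr].
by apply: h => /=; rewrite ger0_norm.
Qed.

Lemma dball_nbhs xi (A : set (curve X)) : nbhs xi A ->
  exists r, exists2 e, 0 < e & dball xi r e `<=` A.
Proof.
(* The sets [dball xi r e] generate a filter; that it converges to [xi] says that each neighbourhood
   contains one of them. *)
pose F := filter_from [set p : R * R | 0 < p.2] (fun p : R * R => dball xi p.1 p.2).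
have FF : Filter F.
  apply: filter_from_filter; first by exists (0, 1) => /=.
  move=> [r e] [r' e'] /= e0 e'0; exists (Num.max r r', Num.min e e') => /=.
    by rewrite lt_min e0.
  move=> eta h; split=> t /andP[t0 tr].
    by have := h t; rewrite t0 le_max tr lt_min => /(_ isT)/andP[].
  by have := h t; rewrite t0 le_max tr orbT lt_min => /(_ isT)/andP[].
have Fxi : F --> xi.
  apply/(@fam_cvgP {nonneg R} X _ F xi) => B [r Br] P /uniform_nbhs[E [entE EP]].
  move: entE; rewrite -entourage_ballE => -[e /= e0 eE].
  exists (r, e) => // eta h; apply: EP => t Bt; apply: eE => /=.
  rewrite ballEmdist /= -!pt_nng; apply: h.
  by rewrite ge0/= Br.
by move=> /Fxi[[r e] /= e0 sub]; exists r, e.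
Qed.

Lemma closure_dball (A : set (curve X)) xi :
  closure A xi <-> forall r e, 0 < e -> exists2 eta, A eta & dball xi r e eta.
Proof.
split=> [cl r e e0|h B /dball_nbhs[r [e e0 sub]]].
  by have [eta [? ?]] := cl _ (nbhs_dball xi r e0); exists eta.
by have [eta ? ?] := h r e e0; exists eta; split=> //; exact: sub.
Qed.

Lemma limit_point_dball (A : set (curve X)) xi :
  limit_point A xi <->
  forall r e, 0 < e -> exists eta, [/\ eta <> xi, A eta & dball xi r e eta].
Proof.
split=> [cl r e e0|h B /dball_nbhs[r [e e0 sub]]].
  by have [eta [/eqP ? ? ?]] := cl _ (nbhs_dball xi r e0); exists eta.
have [eta [/eqP ? ? ?]] := h r e e0.
by exists eta; split=> //; exact: sub.
Qed.

Lemma closure_dball2 (A : set (curve X * curve X)) xi eta :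
  (forall r e, 0 < e -> exists p : curve X * curve X,
    [/\ A p, dball xi r e p.1 & dball eta r e p.2]) ->
  closure A (xi, eta).
Proof.
move=> h B [[B1 B2] /= [/dball_nbhs[r1 [e1 e10 s1]] /dball_nbhs[r2 [e2 e20 s2]]] sub].
have e0 : 0 < Num.min e1 e2 by rewrite lt_min e10.
have [[x1 x2] /= [Ax h1 h2]] := h (Num.max r1 r2) _ e0.
exists (x1, x2); split=> //; apply: sub; split => /=.
  apply: s1 => t /andP[t0 t1]; have := h1 t.
  by rewrite t0 le_max t1 lt_min => /(_ isT)/andP[].
apply: s2 => t /andP[t0 t1]; have := h2 t.
by rewrite t0 le_max t1 orbT lt_min => /(_ isT)/andP[].
Qed.

End Curves.

Section Boundary.
Variables (R : realType) (X : metricType R) (o : X).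
Local Notation d := (@mdist R X).
Implicit Types (xi eta zeta : curve X) (x y p q : X) (s t r e K : R) (g h : isom X).
Hypothesis Xcat0 : cat0 X.
Hypothesis Xproper : proper_space X.

Lemma bd_ray xi : boundary o xi -> is_ray (pt xi).
Proof. by move=> /boundaryP[]. Qed.

Lemma bd0 xi : boundary o xi -> pt xi 0 = o.
Proof. by move=> /boundaryP[]. Qed.

Lemma bd_dist0 xi t : boundary o xi -> 0 <= t -> d o (pt xi t) = t.
Proof. by move=> xib t0; rewrite -(bd0 xib) ray_dist0//; exact: bd_ray. Qed.

Lemma bd_alg xi s t : boundary o xi -> 0 <= s <= t -> alg o (pt xi t) s = pt xi s.
Proof. by move=> xib st; rewrite -(bd0 xib) ray_alg//; exact: bd_ray. Qed.

Lemma bd_cone xi eta s t : boundary o xi -> boundary o eta -> 0 <= s <= t -> 0 < t ->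
  d (pt xi s) (pt eta s) <= s / t * d (pt xi t) (pt eta t).
Proof.
move=> xb eb st t0; apply: ray_cone => //; [exact: bd_ray|exact: bd_ray|].
by rewrite !bd0.
Qed.

Lemma bd_dball xi eta r e : boundary o xi -> boundary o eta -> 0 < r ->
  d (pt xi r) (pt eta r) < e -> dball xi r e eta.
Proof.
move=> xb eb r0 h t /andP[t0 tr]; apply: le_lt_trans h.
apply: (le_trans (bd_cone xb eb _ r0)); first by rewrite t0.
by rewrite ler_piMl ?mdist_ge0// ler_pdivrMr// mul1r.
Qed.

Lemma bd_eq xi eta K : boundary o xi -> boundary o eta ->
  (forall t, 0 <= t -> d (pt xi t) (pt eta t) <= K) -> xi = eta.
Proof.
move=> xb eb hK; apply: curve_ext => t t0; apply: (@mdist_positivity R).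
have := asymptotic_nonincreasing Xcat0 (bd_ray xb) (bd_ray eb) hK t0.
rewrite !bd0// mdistxx => h; apply/eqP; rewrite eq_le h; exact: mdist_ge0.
Qed.

Lemma bd_neq xi eta : boundary o xi -> boundary o eta -> xi <> eta ->
  exists2 r, 0 < r & 0 < d (pt xi r) (pt eta r).
Proof.
move=> xb eb ne; apply: contrapT => H; apply: ne; apply: curve_ext => t t0.
apply: (@mdist_positivity R); apply: contrapT => /eqP h; apply: H; exists t.
  rewrite lt_neqAle t0 andbT; apply/eqP => t00; move/eqP: h; apply.
  by rewrite -t00 !bd0// mdistxx.
by rewrite lt_neqAle eq_sym h mdist_ge0.
Qed.

Lemma bd_eq_close xi eta : boundary o xi -> boundary o eta ->
  (forall r e, 0 < r -> 0 < e -> d (pt xi r) (pt eta r) <= e) -> xi = eta.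
Proof.
move=> xb eb h; apply: contrapT => /(bd_neq xb eb)[r r0 dr].
have := h r (d (pt xi r) (pt eta r) / 2) r0; lra.
Qed.

(** The distance between two rays from [o] grows at least linearly once it is positive. Separation
    by an arbitrary constant pays for the bounded errors of later estimates. *)
Lemma bd_neq_sep xi eta C : boundary o xi -> boundary o eta -> xi <> eta ->
  exists2 r, 0 < r & C < d (pt xi r) (pt eta r).
Proof.
move=> xb eb ne; have [r r0 dr] := bd_neq xb eb ne.
pose t := r + r * (`|C| + 1) / d (pt xi r) (pt eta r).
have q0 : 0 <= r * (`|C| + 1) / d (pt xi r) (pt eta r).
  by rewrite divr_ge0 ?mulr_ge0 ?addr_ge0 ?(ltW r0) ?(ltW dr).
have t0 : 0 < t by rewrite /t; lra.
exists t => //; have := @bd_cone xi eta r t xb eb; rewrite (ltW r0) /=.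
have -> : r <= t by rewrite /t; lra.
move=> /(_ isT t0); rewrite mulrAC ler_pdivlMr// => h.
have : r * (`|C| + 1) < d (pt xi r) (pt eta r) * t.
  rewrite /t; set D := d (pt xi r) _ in dr *.
  have -> : D * (r + r * (`|C| + 1) / D) = D * r + r * (`|C| + 1).
    by rewrite mulrDr; congr (_ + _); rewrite mulrC divfK ?gt_eqF.
  by rewrite ltrDr mulr_gt0.
have := ler_norm C; nra.
Qed.

(** The ray is the limit of the segments from [p] to [r n]. Fellow-travelling first gives the bound
    [2 * H], which convexity improves to the value at time 0. *)
Lemma ray_from p (r : R -> X) : is_ray r -> exists r' : R -> X, [/\ is_ray r', r' 0 = p &
  forall t, 0 <= t -> d (r' t) (r t) <= d p (r 0)].
Proof.
move=> rr; pose H := d p (r 0); pose y t (n : nat) := alg p (r n%:R) t.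
have big t (n : nat) : t + H <= n%:R -> t <= d p (r n%:R).
  have := metric_triangle (r 0) p (r n%:R); rewrite (metric_sym _ p) -/H.
  by rewrite ray_dist0// ?ler0n//; lra.
have H0 : 0 <= H by exact: mdist_ge0.
have cvy t : 0 <= t -> ucvg (y t) (ulim (y t)).
  move=> t0; apply: (@ulimP _ _ Xproper _ p t).
  apply: filterS (omega_real (t + H)) => n /= hn.
  by rewrite (alg_dist Xcat0 _).1 ?lexx// t0 big.
exists (fun t => ulim (y t)).
have ray' : is_ray (fun t => ulim (y t)).
  move=> s t s0 t0; apply: (ucvg_eq (cvy s s0) (cvy t t0)).
  apply: filterS (filterI (omega_real (s + H)) (omega_real (t + H))) => n /= [hs ht].
  have {}hs := big _ _ hs; have {}ht := big _ _ ht.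
  have [st|/ltW ts] := leP s t.
    by rewrite alg_dist2 ?s0// ler0_norm ?subr_le0// opprB.
  by rewrite metric_sym alg_dist2 ?t0// ger0_norm ?subr_ge0.
have y0 : ulim (y 0) = p.
  apply: (@mdist_positivity R); apply: (ucvg_eq (cvy 0 (lexx _)) (ucvg_cst p)).
  by apply: filterE => n /=; rewrite /y alg0// mdistxx.
split=> // t t0; rewrite -y0.
apply: (asymptotic_nonincreasing Xcat0 ray' rr (K := 2 * H)) => // s s0.
apply: (ucvg_le (cvy s s0) (ucvg_cst _)) => e e0.
apply: filterS (omega_real (s + H)) => n /= hn.
have sn : 0 <= s <= n%:R by rewrite s0/=; lra.
have -> : r s = alg (r 0) (r n%:R) s by rewrite ray_alg.
apply: (@le_trans _ _ (2 * H)); last by rewrite lerDl ltW.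
apply: alg_fellow2 => //; first by rewrite s0 big.
by rewrite ray_dist0 ?ler0n//; lra.
Qed.

Lemma bd_from (r : R -> X) : is_ray r -> exists xi, boundary o xi /\
  forall t, 0 <= t -> d (pt xi t) (r t) <= d o (r 0).
Proof.
move=> rr; have [r' [rr' r'0 hr']] := ray_from o rr.
exists (curve_of r'); split=> [|t t0]; last by rewrite pt_curve_of// hr'.
apply/boundaryP; split=> [s t s0 t0|]; first by rewrite !pt_curve_of// rr'.
by rewrite pt_curve_of.
Qed.

Lemma isom_ray g (r : R -> X) : is_ray r -> is_ray (g \o r).
Proof. by move=> rr s t s0 t0 /=; rewrite isom_dist rr. Qed.

Lemma bd_actP g xi : boundary o xi -> boundary o (bd_act o g xi) /\
  forall t, 0 <= t -> d (pt (bd_act o g xi) t) (g (pt xi t)) <= d o (g o).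
Proof.
move=> xb; have rr := bd_ray xb.
have [eta [eb heta]] := bd_from (isom_ray g rr).
rewrite /bd_act; case: xgetP => [zeta -> [zb /asymptoticP[K hK]]|/(_ eta)[]]; last first.
  by split=> //; apply/asymptoticP; exists (d o (g (pt xi 0))).
split=> // t t0.
have := asymptotic_nonincreasing Xcat0 (bd_ray zb) (isom_ray g rr) (K := K) _ t0.
by rewrite /= (bd0 zb) (bd0 xb); apply => s s0; exact: hK.
Qed.

Lemma bd_act_bd g xi : boundary o xi -> boundary o (bd_act o g xi).
Proof. by case/(bd_actP g). Qed.

Lemma bd_act_unique g xi eta K : boundary o xi -> boundary o eta ->
  (forall t, 0 <= t -> d (pt eta t) (g (pt xi t)) <= K) -> bd_act o g xi = eta.
Proof.
move=> xb eb hK; have [ab ha] := bd_actP g xb.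
apply: (bd_eq (K := d o (g o) + K) ab eb) => t t0.
apply: le_trans (metric_triangle _ (g (pt xi t)) _) _.
by rewrite (metric_sym (g _)) lerD ?ha ?hK.
Qed.

Lemma bd_act1 xi : boundary o xi -> bd_act o 1%g xi = xi.
Proof.
by move=> xb; apply: (bd_act_unique (K := 0)) => // t t0; rewrite isom1 mdistxx.
Qed.

Lemma bd_actM g h xi : boundary o xi ->
  bd_act o (g * h)%g xi = bd_act o g (bd_act o h xi).
Proof.
move=> xb; have [hb hh] := bd_actP h xb; have [gb hg] := bd_actP g hb.
apply: (bd_act_unique (K := d o (g o) + d o (h o))) => // t t0.
apply: le_trans (metric_triangle _ (g (pt (bd_act o h xi) t)) _) _.
by rewrite lerD ?hg// isomM isom_dist hh.
Qed.

Lemma bd_actK g xi : boundary o xi -> bd_act o (g^-1)%g (bd_act o g xi) = xi.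
Proof. by move=> xb; rewrite -bd_actM// mulVg bd_act1. Qed.

Lemma bd_actVK g xi : boundary o xi -> bd_act o g (bd_act o (g^-1)%g xi) = xi.
Proof. by move=> xb; rewrite -bd_actM// mulgV bd_act1. Qed.

Lemma bd_act_lip g xi eta t : boundary o xi -> boundary o eta -> 0 <= t ->
  d (pt (bd_act o g xi) t) (pt (bd_act o g eta) t) <=
  2 * d o (g o) + d (pt xi t) (pt eta t).
Proof.
move=> xb eb t0; have [_ /(_ t t0) h1] := bd_actP g xb.
have [_ /(_ t t0) h2] := bd_actP g eb.
have := metric_triangle (pt (bd_act o g xi) t) (g (pt xi t)) (pt (bd_act o g eta) t).
have := metric_triangle (g (pt xi t)) (g (pt eta t)) (pt (bd_act o g eta) t).
by rewrite isom_dist (metric_sym (g (pt eta t))); lra.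
Qed.

(** At a large radius [t] the image rays are within [C], since the image ray follows the moved ray
    up to a constant; the cone inequality shrinks this to [r / t * C]. *)
Lemma bd_act_continuous g xi r e : boundary o xi -> 0 < r -> 0 < e ->
  exists2 t, 0 < t & forall eta, boundary o eta -> d (pt xi t) (pt eta t) <= 1 ->
    d (pt (bd_act o g xi) r) (pt (bd_act o g eta) r) <= e.
Proof.
move=> xb r0 e0; pose C := 2 * d o (g o) + 1.
have C0 : 0 < C by rewrite /C; have := mdist_ge0 o (g o); lra.
have q0 : 0 <= r * C / e by rewrite divr_ge0 ?mulr_ge0 ?ltW.
pose t := r + r * C / e.
have t0 : 0 < t by rewrite /t; lra.
exists t => // eta eb h.
have rt : 0 <= r <= t by rewrite /t; lra.
apply: le_trans (bd_cone (bd_act_bd g xb) (bd_act_bd g eb) rt t0) _.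
have h2 : d (pt (bd_act o g xi) t) (pt (bd_act o g eta) t) <= C.
  by apply: le_trans (bd_act_lip g xb eb (ltW t0)) _; rewrite /C; lra.
rewrite mulrAC ler_pdivrMr//; apply: (@le_trans _ _ (r * C)).
  by rewrite ler_pM2l.
have -> : e * t = e * r + r * C.
  by rewrite /t mulrDr; congr (_ + _); rewrite mulrC divfK ?gt_eqF.
by rewrite lerDr mulr_ge0 ?ltW.
Qed.

(** The trace on [X] of a basic neighbourhood of [xi] in the compactification. *)
Definition near_ray xi r e x := r <= d o x /\ d (alg o x r) (pt xi r) <= e.

Lemma near_ray_scale xi r s e x : boundary o xi -> 0 <= s <= r -> 0 < r ->
  near_ray xi r e x -> near_ray xi s (s / r * e) x.
Proof.
move=> xb sr r0 [rx h]; have /andP[s0 sr'] := sr; split; first by lra.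
rewrite -(@bd_alg xi s r)//.
have h2 := @alg_cone _ _ Xcat0 o x s r sr r0 rx (pt xi r).
rewrite bd_dist0 ?(ltW r0)// in h2; have {}h2 := h2 (lexx _).
rewrite (@bd_alg xi r r) ?lexx ?(ltW r0)// in h2.
apply: (le_trans h2); apply: ler_wpM2l => //.
by rewrite divr_ge0 ?(ltW r0).
Qed.

Lemma near_ray_pt xi eta r e t : boundary o eta -> 0 < r -> r <= t ->
  near_ray xi r e (pt eta t) -> d (pt eta r) (pt xi r) <= e.
Proof. by move=> eb r0 rt [_]; rewrite bd_alg// ltW. Qed.

Lemma near_ray2 xi eta r e e' x : near_ray xi r e x -> near_ray eta r e' x ->
  d (pt xi r) (pt eta r) <= e + e'.
Proof.
move=> [_ h1] [_ h2]; apply: le_trans (metric_triangle _ (alg o x r) _) _.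
by rewrite (metric_sym (pt xi r)) lerD.
Qed.

Lemma scale_radius r e C : 0 < r -> 0 < e -> 0 <= C -> exists t, [/\ r <= t, 0 < t &
  r / t * C <= e].
Proof.
move=> r0 e0 C0; have q0 := divr_ge0 (mulr_ge0 (ltW r0) C0) (ltW e0).
exists (r + r * C / e); split; [by lra|by lra|].
have t0 : 0 < r + r * C / e by lra.
rewrite mulrAC ler_pdivrMr//.
have -> : e * (r + r * C / e) = e * r + r * C.
  by rewrite mulrDr; congr (_ + _); rewrite mulrC divfK ?gt_eqF.
by rewrite lerDr mulr_ge0 ?ltW.
Qed.

Lemma near_ray_coarse xi r e C : boundary o xi -> 0 < r -> 0 < e -> 0 <= C ->
  exists t, [/\ 0 < t, r <= t & forall x, near_ray xi t C x -> near_ray xi r e x].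
Proof.
move=> xb r0 e0 C0; have [t [rt t0 hC]] := scale_radius r0 e0 C0.
exists t; split=> // x; have rt' : 0 <= r <= t by rewrite ltW.
move=> /(near_ray_scale xb rt' t0)[h1 h2]; split=> //.
exact: le_trans hC.
Qed.

Lemma bd_coarse r e C : 0 < r -> 0 < e -> 0 <= C -> exists t, [/\ 0 < t, r <= t &
  forall xi eta, boundary o xi -> boundary o eta ->
    d (pt xi t) (pt eta t) <= C -> d (pt xi r) (pt eta r) <= e].
Proof.
move=> r0 e0 C0; have [t [rt t0 hC]] := scale_radius r0 e0 C0.
exists t; split=> // xi eta xb eb h; apply: le_trans hC.
have rt' : 0 <= r <= t by rewrite ltW.
apply: le_trans (bd_cone xb eb rt' t0) _; apply: ler_wpM2l => //.
by rewrite divr_ge0 ?ltW.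
Qed.

Lemma alg_fellow_end x y s : 0 <= s <= d o x -> s <= d o y ->
  d (alg o x s) (alg o y s) <= 2 * d x y.
Proof.
move=> sx sy; have [l01 ls] := alg_frac sx; set l := s / d o x in l01 ls.
have h1 := pnt_thales Xcat0 o x y l01.
have /andP[l0 l1] := l01; have /andP[s0 _] := sx; have xy0 := mdist_ge0 x y.
have y0 := mdist_ge0 o y.
have t1 := metric_triangle o x y; have t2 := metric_triangle o y x.
rewrite (metric_sym y x) in t2.
have a1 := ler_wpM2l l0 t1; have a2 := ler_wpM2l l0 t2; rewrite !mulrDr in a1 a2.
have lxy : l * d x y <= d x y by rewrite ler_piMl.
have h2 : d (pnt l o y) (alg o y s) <= d x y.
  rewrite (pnt_alg Xcat0)//.
  have [h|/ltW h] := leP (l * d o y) s.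
    have lE : 0 <= l * d o y <= s by rewrite h mulr_ge0.
    by rewrite (alg_dist2 Xcat0 lE sy); lra.
  have sE : 0 <= s <= l * d o y by rewrite s0.
  have lE : l * d o y <= d o y by rewrite ler_piMl.
  by rewrite metric_sym (alg_dist2 Xcat0 sE lE); lra.
have := metric_triangle (alg o x s) (pnt l o y) (alg o y s).
by rewrite {1}/alg -/l; lra.
Qed.

Lemma near_ray_limit xi (x : R -> X) H r e : boundary o xi -> 0 < r -> 0 < e ->
  (forall t, 0 <= t -> d (x t) (pt xi t) <= H) ->
  exists2 t0, 0 <= t0 & forall t, t0 <= t -> near_ray xi r e (x t).
Proof.
move=> xb r0 e0 hx; have H0 : 0 <= H.
  by apply: le_trans (hx 0 (lexx _)); exact: mdist_ge0.
have [s [s0 rs hs]] := near_ray_coarse xb r0 e0 (mulr_ge0 (ler0n R 2) H0).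
exists (s + H); first by lra.
move=> t st; apply: hs; have t0 : 0 <= t by lra.
have xt := hx t t0; have xit := bd_dist0 xb t0.
have sx : s <= d o (x t) by have := metric_triangle o (x t) (pt xi t); lra.
split=> //; rewrite -(@bd_alg xi s t) ?(ltW s0)//=; last by lra.
apply: le_trans (alg_fellow_end _ _) _; rewrite ?(ltW s0)//.
  by rewrite xit; lra.
by rewrite ler_pM2l.
Qed.

Lemma limit_setP (G : set (isom X)) xi : limit_set o G xi <-> boundary o xi /\
  forall r e, 0 < r -> 0 < e -> exists2 g, G g & near_ray xi r e (g o).
Proof.
split=> [[xb /limit_point_dball lp]|[xb h]]; split=> //.
  (* A segment shorter than [r] would be constant on [[r, r + 1]], where [xi] advances by 1; two
     errors below [1 / 2] exclude this. *)
  move=> r e r0 e0; pose e' := Num.min e (1 / 2).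
  have e'0 : 0 < e' by rewrite lt_min e0 divr_gt0.
  have [eta [_ [g Gg [y0 yD yd]] hy]] := lp (r + 1) _ e'0.
  exists g => //; have D0 := mdist_ge0 o (g o).
  have far : r <= d o (g o).
    rewrite leNgt; apply/negP => Dr.
    have yr t : r <= t -> pt eta t = g o.
      by move=> rt; apply: yD => /=; rewrite ger0_norm; lra.
    have := hy r; have := hy (r + 1); rewrite !yr ?lerDl// !lt_min.
    have := bd_ray xb; move=> /(_ r (r + 1)).
    rewrite opprD addrA subrr add0r normrN normr1 => h1.
    have := metric_triangle (pt xi r) (g o) (pt xi (r + 1)).
    rewrite h1; [|lra|lra] => h2 h3 h4.
    have /andP[_ h3'] := h3 ltac:(lra); have /andP[_ h4'] := h4 ltac:(lra).
    by rewrite (metric_sym (g o)) in h2; lra.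
  split=> //; have /= := hy r; rewrite lt_min => /(_ _)/andP[|hr _]; first by lra.
  rewrite metric_sym; apply/ltW; suff <- : pt eta r = alg o (g o) r by [].
  have nr : `|r| <= d o (g o) by rewrite gtr0_norm.
  have nD : `|d o (g o)| <= d o (g o) by rewrite ger0_norm.
  apply: (alg_unique Xcat0); first by rewrite ltW.
    rewrite -[in LHS]y0 yd//= ?add0r ?normrN ?normr_id ?gtr0_norm//.
  have := yd (NngNum (normr_ge0 r)) (NngNum (normr_ge0 (d o (g o)))) nr nD.
  rewrite (yD (NngNum (normr_ge0 (d o (g o))))) /=; last by rewrite ger0_norm.
  by rewrite /pt => ->; rewrite (gtr0_norm r0) (ger0_norm D0) ler0_norm ?subr_le0// opprB.
apply/limit_point_dball => r e e0; pose r' := Num.max r 1.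
have r'0 : 0 < r' by rewrite lt_max ltr01 orbT.
have e2 : 0 < e / 2 by lra.
have [g Gg near_g] := h r' _ r'0 e2; have [far close] := near_g.
have D0 := mdist_ge0 o (g o); set D := d o (g o) in far D0.
pose m (t : {nonneg R}) := Num.min t%:num D.
have m01 (t : {nonneg R}) : 0 <= m t <= D by rewrite /m le_min ge0 D0 ge_min lexx orbT.
exists (fun t : {nonneg R} => alg o (g o) (m t)); split.
(* The segment differs from [xi] because it stops at time [D]. *)
- move=> eq; have := bd_dist0 xb (_ : 0 <= D + 1); rewrite -eq /pt => h1.
  have DD : m (NngNum (normr_ge0 (D + 1))) = D.
    by rewrite /m /= ger0_norm; [apply/min_idPr; lra|lra].
  have := h1 ltac:(lra); rewrite DD alg_end// -/D; lra.
- exists g => //; split=> [|t Dt|s t].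
  + rewrite -[RHS](alg0 Xcat0 o (g o)); congr alg; rewrite /m /=.
    by apply/min_idPl.
  + by rewrite /m; have /min_idPr -> := Dt; exact: alg_end.
  + rewrite /m -/D => sD tD; have /min_idPl -> := sD; have /min_idPl -> := tD.
    have [st|/ltW ts] := leP s%:num t%:num.
      by rewrite alg_dist2 ?ge0// ler0_norm ?subr_le0// opprB.
    by rewrite metric_sym alg_dist2 ?ge0// ger0_norm ?subr_ge0.
move=> t /andP[t0 tr]; have tr' : 0 <= t <= r' by rewrite t0 le_max tr.
have tD : t <= D by have /andP[_ ?] := tr'; exact: le_trans far.
have mt : m (NngNum (normr_ge0 t)) = t by rewrite /m /= ger0_norm//; exact/min_idPl.
rewrite metric_sym {1}/pt mt.
have [_ h2] := near_ray_scale xb tr' r'0 near_g.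
apply: le_lt_trans h2 _; apply: (@le_lt_trans _ _ (e / 2)); last by lra.
rewrite ler_piMl ?(ltW e2)// ler_pdivrMr// mul1r.
by case/andP: tr'.
Qed.

Lemma limit_set_bd (G : set (isom X)) xi : limit_set o G xi -> boundary o xi.
Proof. by case. Qed.

End Boundary.

(** * North-south dynamics *)

Section Projection.
Variables (R : realType) (X : metricType R).
Local Notation d := (@mdist R X).
Implicit Types (c : R -> X) (x y p q : X) (s t r e K T u w tau : R) (g h : isom X).
Hypothesis Xcat0 : cat0 X.
Hypothesis Xproper : proper_space X.

Definition proj c x : R := xget 0 (nearest c x).

Lemma projP c x : geodesic_line c -> nearest c x (proj c x).
Proof.
move=> cl; rewrite /proj; case: xgetP => [s -> //|h].
by have [s /h] := nearest_exists x cl.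
Qed.

Lemma proj_unique c x s : geodesic_line c -> nearest c x s -> proj c x = s.
Proof. by move=> cl ns; apply: (nearest_unique Xcat0 cl _ ns); exact: projP. Qed.

Lemma proj_line c t : geodesic_line c -> proj c (c t) = t.
Proof.
by move=> cl; apply: proj_unique => // u; rewrite mdistxx mdist_ge0.
Qed.

Lemma proj_rev c x : geodesic_line c -> proj (reversed c) x = - proj c x.
Proof.
move=> cl; apply: proj_unique; first exact: rev_line.
by apply: nearest_rev; exact: projP.
Qed.

Lemma proj_translate g c tau x : translates g c tau ->
  proj c (g x) = proj c x + tau.
Proof.
move=> [cl _ gc]; apply: proj_unique => // u.
rewrite -gc isom_dist -[c u](isomVK g).
have gV v : (g^-1)%g (c v) = c (v - tau) by rewrite -[in LHS](subrK tau v) -gc isomK.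
by rewrite isom_dist gV; exact: projP.
Qed.

Lemma proj_translateX g c tau n x : translates g c tau ->
  proj c ((g ^+ n)%g x) = proj c x + tau * n%:R.
Proof.
move=> tr; elim: n => [|n IH]; first by rewrite mulr0 addr0.
by rewrite isomXS (proj_translate _ tr) IH -natr1; ring.
Qed.

Lemma proj_far c x q : geodesic_line c ->
  `|proj c x| <= 2 * (d (c 0) q + d q x).
Proof.
move=> cl; apply: le_trans (nearest_far cl (projP x cl)) _.
by rewrite ler_pM2l ?ltr0n// metric_triangle.
Qed.

Lemma rev_rev c : reversed (reversed c) = c.
Proof. by apply/funext => t; rewrite /reversed opprK. Qed.

End Projection.

Section Dynamics.
Variables (R : realType) (X : metricType R) (o : X).
Local Notation d := (@mdist R X).
Implicit Types (c : R -> X) (x y p q : X) (s t r e K T u w tau : R) (g h : isom X).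
Implicit Types (xi eta zeta xm xp : curve X).
Hypothesis Xcat0 : cat0 X.
Hypothesis Xproper : proper_space X.

Definition ends_at c xi := boundary o xi /\
  exists K, forall t, 0 <= t -> d (c t) (pt xi t) <= K.

Definition loxodromic g c tau w xm xp :=
  [/\ translates g c tau, thin c w, 0 < w, ends_at (reversed c) xm & ends_at c xp].

Lemma line_ray c : geodesic_line c -> is_ray c.
Proof. by move=> cl s t _ _; exact: cl. Qed.

Lemma ends_at_exists c : geodesic_line c -> exists xi, ends_at c xi.
Proof.
move=> cl; have [xi [xb hx]] := bd_from o Xcat0 Xproper (line_ray cl).
by exists xi; split=> //; exists (d o (c 0)) => t t0; rewrite metric_sym hx.
Qed.

Lemma rank_one_loxodromic g : rank_one g ->
  exists c tau w xm xp, loxodromic g c tau w xm xp.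
Proof.
move=> [_ [c [cl [tau [tau0 _ gc]]] nflat]].
have [w w0 th] := parallel_width Xcat0 Xproper cl nflat.
have [xm hm] := ends_at_exists (rev_line cl); have [xp hp] := ends_at_exists cl.
by exists c, tau, w, xm, xp.
Qed.

Lemma loxodromicV g c tau w xm xp : loxodromic g c tau w xm xp ->
  loxodromic (g^-1)%g (reversed c) tau w xp xm.
Proof.
move=> [tr th w0 hm hp]; split=> //; first exact: translates_rev.
- exact: thin_rev.
- by rewrite rev_rev.
Qed.

Lemma ends_at_isom h c xi : ends_at c xi -> ends_at (h \o c) (bd_act o h xi).
Proof.
move=> [xb [K hK]]; have [ab ha] := bd_actP Xcat0 Xproper h xb.
split=> //; exists (K + d o (h o)) => t t0.
apply: le_trans (metric_triangle _ (h (pt xi t)) _) _.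
by rewrite /= isom_dist (metric_sym (h _)) lerD ?hK ?ha.
Qed.

Lemma loxodromicJ h g c tau w xm xp : loxodromic g c tau w xm xp ->
  loxodromic (h * g * h^-1)%g (h \o c) tau w (bd_act o h xm) (bd_act o h xp).
Proof.
move=> [[cl tau0 gc] th w0 hm hp]; split=> //.
- split=> // [s t|t]; first by rewrite /= isom_dist cl.
  by rewrite !isomM /comp isomK gc.
- move=> c' K c'l hK far.
  apply: (th ((h^-1)%g \o c') K) => [s t|t|s t]; rewrite /comp.
  + by rewrite isom_dist c'l.
  + by rewrite -(isom_dist h) isomVK; exact: hK.
  + by rewrite -(isom_dist h) isomVK; exact: far.
- exact: ends_at_isom hm.
- exact: ends_at_isom hp.
Qed.

Section Fixed.
Variables (g : isom X) (c : R -> X) (tau w : R) (xm xp : curve X).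
Hypothesis lox : loxodromic g c tau w xm xp.

Let tr : translates g c tau. Proof. by case: lox. Qed.
Let cl : geodesic_line c. Proof. by case: tr. Qed.
Let tau0 : 0 < tau. Proof. by case: tr. Qed.
Let xpb : boundary o xp. Proof. by case: lox => _ _ _ _ []. Qed.
Let xmb : boundary o xm. Proof. by case: lox => _ _ _ [] . Qed.

(** Two uses of [thin_cone]: at radius [t] for the direction, at radius [t + d o (c 0)] to have [x]
    far from [o]. Passing from [c 0] to [o], and from [c] to its asymptotic ray [xp], costs the
    constant [C]. *)
Lemma proj_near_ray r e : 0 < r -> 0 < e ->
  exists T, forall x, T <= proj c x -> near_ray o xp r e x.
Proof.
move=> r0 e0; have [_ th w0 _ [_ [K hK]]] := lox.
pose C := 2 * d o (c 0) + 1 + K.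
have C0 : 0 <= C.
  rewrite /C; have := mdist_ge0 o (c 0); have := mdist_ge0 (c 0) (pt xp 0).
  by have := hK 0 (lexx _); lra.
have [t [t0 rt ht]] := near_ray_coarse Xcat0 xpb r0 e0 C0.
have one : 0 < 1 :> R by [].
have th0 : 0 < t + d o (c 0) by have := mdist_ge0 o (c 0); lra.
have [T1 hT1] := thin_cone Xcat0 Xproper tr th w0 t0 one.
have [T2 hT2] := thin_cone Xcat0 Xproper tr th w0 th0 one.
exists (Num.max T1 T2) => x; rewrite ge_max => /andP[T1x T2x]; apply: ht.
have [h1 h2] := hT1 x _ (projP x cl) T1x; have [h3 _] := hT2 x _ (projP x cl) T2x.
have tx : t <= d o x.
  by have := metric_triangle (c 0) o x; rewrite (metric_sym (c 0) o); lra.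
split=> //; rewrite /C.
apply: le_trans (metric_triangle _ (c t) _) _; apply: lerD; last by apply: hK; exact: ltW.
apply: le_trans (metric_triangle _ (alg (c 0) x t) _) _; apply: lerD => //.
by apply: alg_fellow2 => //; rewrite ltW.
Qed.

Lemma proj_visible : exists T, forall n x y,
  proj c x <= tau * n%:R - T -> tau * n%:R + T <= proj c y ->
  exists2 p, on_segment x y p & d (c (tau * n%:R)) p <= w.
Proof.
have [_ th w0 _ _] := lox; have [T hT] := thin_visible Xcat0 Xproper tr th w0.
exists T => n x y xn yn.
have pV z : proj c (((g ^+ n)^-1)%g z) = proj c z - tau * n%:R.
  by rewrite -[in RHS](isomVK (g ^+ n)%g z) (proj_translateX Xcat0 _ _ tr); ring.
have [] := hT (((g ^+ n)^-1)%g x) (((g ^+ n)^-1)%g y) _ _ (projP _ cl) (projP _ cl).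
- by rewrite pV; lra.
- by rewrite pV; lra.
move=> p seg pw; exists ((g ^+ n)%g p).
  by have := on_segment_isom (g ^+ n)%g seg; rewrite !isomVK.
by have := translatesX n 0 tr; rewrite add0r => <-; rewrite isom_dist.
Qed.

Lemma loxodromic_fixed : bd_act o g xp = xp.
Proof.
have [_ _ _ _ [_ [K hK]]] := lox.
apply: (bd_act_unique (K := K + tau + K) Xcat0 Xproper xpb xpb) => t t0.
have [_ _ gc] := tr; have h1 := hK t t0.
apply: le_trans (metric_triangle _ (c (t + tau)) _) _; apply: lerD.
  apply: le_trans (metric_triangle _ (c t) _) _; rewrite metric_sym lerD//.
  by rewrite cl opprD addrA subrr add0r normrN gtr0_norm.
by rewrite -gc isom_dist.
Qed.

Lemma loxodromic_fixedX n : bd_act o (g ^+ n)%g xp = xp.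
Proof.
elim: n => [|n IH]; first by rewrite bd_act1.
by rewrite expgS bd_actM// IH loxodromic_fixed.
Qed.

Lemma loxodromic_neq : xm <> xp.
Proof.
move=> mp; have [_ _ _ [_ [K hK]] [_ [L hL]]] := lox.
have KL : 0 <= K + L.
  have := hK 0 (lexx _); have := hL 0 (lexx _).
  have := mdist_ge0 (reversed c 0) (pt xm 0); have := mdist_ge0 (c 0) (pt xp 0); lra.
have t0 : 0 <= K + L + 1 by lra.
have := hK _ t0; have := hL _ t0; rewrite mp /reversed; set t := K + L + 1.
have := metric_triangle (c (- t)) (pt xp t) (c t).
rewrite cl (metric_sym (pt xp t)).
have : 2 * t <= `|- t - t| by rewrite -normrN; apply: le_trans (ler_norm _); lra.
by rewrite /t; lra.
Qed.

Lemma ray_proj_bounded eta : boundary o eta -> eta <> xm ->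
  (forall r e, 0 < r -> 0 < e -> exists T, forall x, T <= - proj c x -> near_ray o xm r e x) ->
  exists T, exists2 t0, 0 <= t0 & forall t, t0 <= t -> T <= proj c (pt eta t).
Proof.
move=> eb ne hm; have [r r0 dr] := bd_neq eb xmb ne.
have e0 : 0 < d (pt eta r) (pt xm r) / 2 by lra.
have [T hT] := hm r _ r0 e0; exists (- T), r; first exact: ltW.
move=> t rt; rewrite leNgt; apply/negP => lt; have Tt : T <= - proj c (pt eta t) by lra.
by have := near_ray_pt Xcat0 eb r0 rt (hT _ Tt); lra.
Qed.

End Fixed.

(** As [eta <> xm], the points of the ray [eta] project to [c] above some [T] from some time on, and
    [g ^+ n] adds [tau * n]. A late point of the moved ray is then near both [xp] and the image of
    [eta]. *)
Lemma north_south g c tau w xm xp eta r e : loxodromic g c tau w xm xp ->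
  boundary o eta -> eta <> xm -> 0 < r -> 0 < e ->
  exists N, forall n, (N <= n)%N -> d (pt (bd_act o (g ^+ n)%g eta) r) (pt xp r) <= e.
Proof.
move=> lox eb ne r0 e0; have [tr _ _ _ [xpb _]] := lox.
have [cl tau0 _] := tr.
have [T [t0 t00 hT]] : exists T, exists2 t0, 0 <= t0 &
    forall t, t0 <= t -> T <= proj c (pt eta t).
  apply: (ray_proj_bounded lox eb ne) => r' e' r'0 e'0.
  have [T hT] := proj_near_ray (loxodromicV lox) r'0 e'0.
  by exists T => x Tx; apply: hT; rewrite proj_rev.
have e2 : 0 < e / 2 by lra.
have [T' hT'] := proj_near_ray lox r0 e2.
exists (Num.truncn ((T' - T) / tau)).+1 => n hn.
have nT : T' - T <= tau * n%:R.
  rewrite mulrC -ler_pdivrMr//; apply/ltW/(lt_le_trans (truncnS_gt _)).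
  by rewrite ler_nat.
have [gb hg] := bd_actP Xcat0 Xproper (g ^+ n)%g eb.
have [t1 t10 h1] := @near_ray_limit _ _ o Xcat0 _ (fun t => (g ^+ n)%g (pt eta t))
  (d o ((g ^+ n)%g o)) r (e / 2) gb r0 e2
  ltac:(by move=> t ?; rewrite metric_sym hg).
have := h1 (Num.max t0 t1); rewrite le_max lexx orbT => /(_ isT) n1.
have n2 : near_ray o xp r (e / 2) ((g ^+ n)%g (pt eta (Num.max t0 t1))).
  apply: hT'; rewrite (proj_translateX Xcat0 _ _ tr).
  by have := hT (Num.max t0 t1); rewrite le_max lexx => /(_ isT); lra.
by have := near_ray2 n1 n2; lra.
Qed.

Lemma loxodromic_fixed_only g c tau w xm xp eta : loxodromic g c tau w xm xp ->
  bd_fixed o g eta -> eta = xm \/ eta = xp.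
Proof.
move=> lox [eb geta]; have [|ne] := pselect (eta = xm); first by left.
right; have [_ _ _ _ [xpb _]] := lox.
apply: (bd_eq_close eb xpb) => r e r0 e0.
have [N /(_ N (leqnn _))] := north_south lox eb ne r0 e0.
suff -> : bd_act o (g ^+ N)%g eta = eta by [].
elim: N => [|N IH]; first by rewrite bd_act1.
by rewrite expgS bd_actM// IH.
Qed.

Lemma half_spaces_disjoint g c tau w xm xp g' c' tau' w' xm' xp' :
  loxodromic g c tau w xm xp -> loxodromic g' c' tau' w' xm' xp' -> xp <> xp' ->
  exists T, forall x, T <= proj c x -> T <= proj c' x -> False.
Proof.
move=> lox lox' ne; have [_ _ _ _ [xpb _]] := lox.
have [_ _ _ _ [xpb' _]] := lox'.
have [r r0 dr] := bd_neq_sep Xcat0 2 xpb xpb' ne.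
have one : 0 < 1 :> R by [].
have [T hT] := proj_near_ray lox r0 one; have [T' hT'] := proj_near_ray lox' r0 one.
exists (Num.max T T') => x; rewrite !ge_max => /andP[h1 _] /andP[_ h2].
by have := near_ray2 (hT x h1) (hT' x h2); lra.
Qed.

(** Points of the half-space of [c'] lie outside that of [c], so they project to [c] below [T];
    segments from them to points projecting far beyond pass close to an axis point [c (tau * n)] in
    between. *)
Lemma half_spaces_visible g c tau w xm xp g' c' tau' w' xm' xp' :
  loxodromic g c tau w xm xp -> loxodromic g' c' tau' w' xm' xp' -> xp <> xp' ->
  exists T K, forall x y, T <= proj c x -> T <= proj c' y ->
    exists2 p, on_segment x y p & d o p <= K.
Proof.
move=> lox lox' ne; have [tr _ _ _ _] := lox; have [cl tau0 _] := tr.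
have [T hT] := half_spaces_disjoint lox lox' ne.
have [S hS] := proj_visible lox.
pose n := (Num.truncn ((T + S) / tau)).+1.
have nT : T + S <= tau * n%:R.
  by rewrite mulrC -ler_pdivrMr//; exact/ltW/truncnS_gt.
exists (Num.max T (tau * n%:R + S)), (d o (c (tau * n%:R)) + w) => x y.
rewrite !ge_max => /andP[_ Sx] /andP[Ty _].
have yT : proj c y < T by rewrite ltNge; apply/negP => /hT; exact.
have [|p seg pw] := hS n y x _ Sx; first by lra.
exists p; first exact: on_segment_sym.
by apply: le_trans (metric_triangle _ (c (tau * n%:R)) _) _; rewrite lerD.
Qed.

Lemma half_space_far c B : geodesic_line c -> exists T, forall x, T <= proj c x ->
  B < d o x.
Proof.
move=> cl; exists (2 * (d (c 0) o + B) + 1) => x Tx.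
by have := proj_far x o cl; have := ler_norm (proj c x); lra.
Qed.

End Dynamics.

Section Subgroup.
Variables (gT : groupType) (G : set gT).
Hypothesis Gsub : subgroup G.

Lemma subgroup1 : G 1%g.
Proof. by have [/set_mem] := Gsub. Qed.

Lemma subgroupV g : G g -> G (g^-1)%g.
Proof. by move=> Gg; apply: set_mem; apply: (group_closedV Gsub); exact: mem_set. Qed.

Lemma subgroupM g h : G g -> G h -> G (g * h)%g.
Proof.
by move=> Gg Gh; apply: set_mem; apply: (group_closedM Gsub); exact: mem_set.
Qed.

Lemma subgroupX g n : G g -> G (g ^+ n)%g.
Proof.
move=> Gg; elim: n => [|n IH]; first exact: subgroup1.
by rewrite expgS; exact: subgroupM.
Qed.

End Subgroup.

(** * The limit set *)

Section LimitSet.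
Variables (R : realType) (X : metricType R) (G : set (isom X)) (o : X).
Local Notation d := (@mdist R X).
Local Notation L := (limit_set o G).
Implicit Types (c : R -> X) (x y p q : X) (s t r e K T u w tau C : R) (g h : isom X).
Implicit Types (xi eta zeta xm xp : curve X).
Hypothesis Xcat0 : cat0 X.
Hypothesis Xproper : proper_space X.
Hypothesis Gsub : subgroup G.

Let lbd xi : L xi -> boundary o xi. Proof. by case. Qed.

Lemma limit_set_coarse xi C : boundary o xi -> 0 <= C ->
  (forall t, 0 < t -> exists2 g, G g & near_ray o xi t C (g o)) -> L xi.
Proof.
move=> xb C0 h; apply/limit_setP => //; split=> // r e r0 e0.
have [t [t0 _ ht]] := near_ray_coarse Xcat0 xb r0 e0 C0.
by have [g Gg gt] := h t t0; exists g => //; exact: ht.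
Qed.

Lemma limit_set_near xi r e : L xi -> 0 < r -> 0 < e ->
  exists2 g, G g & near_ray o xi r e (g o).
Proof. by move=> /(limit_setP o Xcat0)[_ h] r0 e0; exact: h. Qed.

Lemma limit_set_closed eta C : boundary o eta -> 0 <= C ->
  (forall t, 0 < t -> exists2 xi, L xi & d (pt xi t) (pt eta t) <= C) -> L eta.
Proof.
move=> eb C0 h; apply: (limit_set_coarse (C := 1 + C)) => //; first by lra.
move=> t t0; have [xi Lxi hxi] := h t t0.
have [g Gg [far near]] := limit_set_near Lxi t0 ltr01.
exists g => //; split=> //.
by apply: le_trans (metric_triangle _ (pt xi t) _) _; rewrite lerD.
Qed.

Lemma limit_set_act h xi : G h -> L xi -> L (bd_act o h xi).
Proof.
move=> Gh Lxi; have xb := lbd Lxi; have [hb hh] := bd_actP Xcat0 Xproper h xb.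
set H := d o (h o) in hh; have H0 : 0 <= H by exact: mdist_ge0.
apply: (limit_set_coarse (C := 2 * H + 1 + H)) => //; first by lra.
move=> t t0; have tH0 : 0 < t + H by lra.
have tH : 0 <= t <= t + H by lra.
have [g Gg near] := limit_set_near Lxi tH0 ltr01.
have [far _] := near; have [far' near'] := near_ray_scale Xcat0 xb tH tH0 near.
exists (h * g)%g; first exact: subgroupM.
rewrite isomM; have far2 : t <= d o (h (g o)).
  have := metric_triangle (h o) o (h (g o)); rewrite isom_dist (metric_sym (h o)) -/H.
  by lra.
split=> //.
apply: le_trans (metric_triangle _ (h (pt xi t)) _) _; apply: lerD; last first.
  by rewrite metric_sym; apply: hh; exact: ltW.
apply: le_trans (metric_triangle _ (h (alg o (g o) t)) _) _; apply: lerD.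
  rewrite (alg_isom Xcat0) ?(ltW t0)//=.
  by apply: (alg_fellow2 Xcat0); rewrite ?(ltW t0)//= isom_dist.
rewrite isom_dist; apply: (le_trans near').
by rewrite mulr1 ler_pdivrMr// mul1r; case/andP: tH.
Qed.

Lemma loxodromic_limit g c tau w xm xp : G g -> loxodromic o g c tau w xm xp -> L xp.
Proof.
move=> Gg lox; have [tr _ _ _ [xpb _]] := lox; have [cl tau0 _] := tr.
apply/(limit_setP o Xcat0); split=> // r e r0 e0.
have [T hT] := proj_near_ray Xcat0 Xproper lox r0 e0.
pose n := (Num.truncn ((T - proj c o) / tau)).+1.
exists (g ^+ n)%g; first exact: subgroupX.
apply: hT; rewrite (proj_translateX Xcat0 _ _ tr).
have : T - proj c o <= tau * n%:R.
  by rewrite mulrC -ler_pdivrMr//; exact/ltW/truncnS_gt.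
by lra.
Qed.

(** The segment from [h^-1 o] to a far point of [c] passes near [c (tau * n)], hence near [o].
    Applying [h], segments from [o] towards [bd_act o h xp] pass within [C] of [h o], so this
    boundary point lies roughly in the direction of [h o]. [C'] is left free so that both ends of
    [c] can share one constant. *)
Lemma half_orbit g c tau w xm xp : loxodromic o g c tau w xm xp ->
  exists2 C, 0 <= C & forall C' eta h t, C <= C' -> boundary o eta -> 0 < t ->
    near_ray o eta (t + C') 1 (h o) -> proj c ((h^-1)%g o) <= 0 ->
    d (pt (bd_act o h xp) t) (pt eta t) <= 2 * C' + 3.
Proof.
move=> lox; have [tr _ w0 _ ends_p] := lox; have [cl tau0 _] := tr.
have [xpb _] := ends_p.
have [S hS] := proj_visible Xcat0 Xproper lox.
pose n := (Num.truncn (S / tau)).+1.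
have nS : S <= tau * n%:R.
  by rewrite mulrC -ler_pdivrMr//; exact/ltW/truncnS_gt.
have n0 : 0 <= tau * n%:R by rewrite mulr_ge0 ?ler0n// ltW.
pose C := d o (c 0) + tau * n%:R + w.
have C0 : 0 <= C by rewrite /C; have := mdist_ge0 o (c 0); lra.
exists C => // C' eta h t CC' eb t0 near pr.
have C'0 : 0 <= C' by lra.
have [hb [K hK]] := ends_at_isom Xcat0 Xproper h ends_p.
have [s1 s10 hs1] := near_ray_limit Xcat0 hb t0 ltr01 hK.
pose s := Num.max s1 (tau * n%:R + S).
have ss1 : s1 <= s by rewrite le_max lexx.
have sS : tau * n%:R + S <= s by rewrite le_max lexx orbT.
have [||q seg qw] := hS n ((h^-1)%g o) (c s).
- by lra.
- by rewrite proj_line.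
have seg' := on_segment_isom h seg; rewrite isomVK in seg'.
have hq : d (h o) (h q) <= C.
  rewrite isom_dist /C; apply: le_trans (metric_triangle _ (c (tau * n%:R)) _) _.
  apply: lerD => //; apply: le_trans (metric_triangle _ (c 0) _) _.
  by rewrite cl sub0r normrN ger0_norm.
have tC0 : 0 < t + C' by lra.
have tC : 0 <= t <= t + C' by lra.
have [far _] := near; have [far' near'] := near_ray_scale Xcat0 eb tC tC0 near.
have near1 := hs1 s ss1.
have tq : t <= d o (h q) by have := metric_triangle o (h q) (h o); rewrite (metric_sym (h q)); lra.
have near2 : near_ray o eta t (2 * C' + 1) (h (c s)).
  have := seg'; rewrite /on_segment => segE.
  split; first by have := mdist_ge0 (h q) (h (c s)); lra.
  have -> : alg o (h (c s)) t = alg o (h q) t.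
    rewrite [in RHS](on_segment_alg Xcat0 seg') alg_alg ?(ltW t0)//.
    by rewrite -segE lerDl mdist_ge0.
  apply: le_trans (metric_triangle _ (alg o (h o) t) _) _; apply: lerD.
    have tt : 0 <= t <= d o (h q) by rewrite ltW.
    apply: le_trans (alg_fellow_end Xcat0 tt far') _.
    by rewrite metric_sym; lra.
  apply: (le_trans near').
  by rewrite mulr1 ler_pdivrMr// mul1r; case/andP: tC.
by have := near_ray2 near1 near2; lra.
Qed.

Lemma limit_near_ends g c tau w xm xp eta r e : loxodromic o g c tau w xm xp ->
  L eta -> 0 < r -> 0 < e -> exists2 h, G h &
    d (pt (bd_act o h xp) r) (pt eta r) <= e \/
    d (pt (bd_act o h xm) r) (pt eta r) <= e.
Proof.
move=> lox Leta r0 e0; have [tr _ _ [xmb _] [xpb _]] := lox.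
have [cl _ _] := tr; have eb := lbd Leta.
have [C1 C10 h1] := half_orbit lox.
have [C2 C20 h2] := half_orbit (loxodromicV lox).
pose C := Num.max C1 C2.
have C1C : C1 <= C by rewrite le_max lexx.
have C2C : C2 <= C by rewrite le_max lexx orbT.
have C30 : 0 <= 2 * C + 3 by lra.
have [t [t0 rt ht]] := bd_coarse o Xcat0 r0 e0 C30.
have tC0 : 0 < t + C by lra.
have [h Gh near] := limit_set_near Leta tC0 ltr01.
exists h => //; have [pr|pr] := leP (proj c ((h^-1)%g o)) 0.
  left; apply: ht => //; [exact: bd_act_bd|exact: (h1 C eta h t C1C eb t0 near pr)].
right; apply: ht => //; first exact: bd_act_bd.
apply: (h2 C eta h t C2C eb t0 near).
by rewrite proj_rev// oppr_le0 ltW.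
Qed.

Hypothesis Gne : ~ elementary o G.

Lemma limit_third xi eta : exists zeta, [/\ L zeta, zeta <> xi & zeta <> eta].
Proof.
apply: contrapT => H; apply: Gne; left.
have sub : L `<=` (fun n : nat => if n == 0%N then xi else eta) @` `I_2.
  move=> zeta Lz; have [->|nx] := pselect (zeta = xi); first by exists 0%N.
  have [->|ny] := pselect (zeta = eta); first by exists 1%N.
  by exfalso; apply: H; exists zeta.
by apply: card_le_trans (subset_card_le sub) _; exact: card_image_le.
Qed.

(** If all of [G] sent [xi] to [xm], the identity would give [xi = xm] and [G] would fix [xi]. So
    some image of [xi] avoids [xm] and is attracted by powers of [g]. *)
Lemma orbit_near_attracting g c tau w xm xp xi r e : G g ->
  loxodromic o g c tau w xm xp -> boundary o xi -> 0 < r -> 0 < e ->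
  exists2 h, G h & d (pt (bd_act o h xi) r) (pt xp r) <= e.
Proof.
move=> Gg lox xb r0 e0.
have [h [Gh ne]] : exists h, G h /\ bd_act o h xi <> xm.
  apply: contrapT => H; apply: Gne; right; exists xi => // h Gh.
  have fix_m k : G k -> bd_act o k xi = xm.
    by move=> Gk; apply: contrapT => ne; apply: H; exists k.
  by rewrite fix_m// -(fix_m 1%g) ?bd_act1//; exact: subgroup1.
have hb := bd_act_bd Xcat0 Xproper h xb.
have [N /(_ N (leqnn _)) hN] := north_south Xcat0 Xproper lox hb ne r0 e0.
exists (g ^+ N * h)%g; first by apply: subgroupM => //; exact: subgroupX.
by rewrite bd_actM.
Qed.

Hypothesis Grank_one : exists2 g, G g & rank_one g.

Lemma loxodromic_exists : exists g c tau w xm xp, G g /\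
  loxodromic o g c tau w xm xp.
Proof.
have [g Gg /(rank_one_loxodromic o Xcat0 Xproper)[c [tau [w [xm [xp lox]]]]]] := Grank_one.
by exists g, c, tau, w, xm, xp.
Qed.

(** The orbit of [xi] comes close to [xp], and through [g^-1] to [xm], while translates of these two
    come close to [eta]; continuity of [h] composes the two approximations. *)
Lemma limit_minimal xi eta r e : boundary o xi -> L eta -> 0 < r -> 0 < e ->
  exists2 h, G h & d (pt (bd_act o h xi) r) (pt eta r) <= e.
Proof.
move=> xb Leta r0 e0.
have [g [c [tau [w [xm [xp [Gg lox]]]]]]] := loxodromic_exists.
have [_ _ _ [xmb _] [xpb _]] := lox.
have e2 : 0 < e / 2 by lra.
suff main z h : boundary o z -> G h ->
    (forall r e, 0 < r -> 0 < e -> exists2 k, G k & d (pt (bd_act o k xi) r) (pt z r) <= e) ->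
    d (pt (bd_act o h z) r) (pt eta r) <= e / 2 ->
    exists2 k, G k & d (pt (bd_act o k xi) r) (pt eta r) <= e.
  have [h Gh [hp|hm]] := limit_near_ends lox Leta r0 e2.
    apply: (main xp h xpb Gh _ hp) => r' e' r'0 e'0.
    exact: (orbit_near_attracting Gg lox xb r'0 e'0).
  apply: (main xm h xmb Gh _ hm) => r' e' r'0 e'0.
  exact: (orbit_near_attracting (subgroupV Gsub Gg) (loxodromicV lox) xb r'0 e'0).
move=> zb Gh hz near.
have [t t0 ht] := bd_act_continuous Xcat0 Xproper h zb r0 e2.
have [k Gk hk] := hz t 1 t0 ltr01.
exists (h * k)%g; first exact: subgroupM.
rewrite bd_actM//; rewrite metric_sym in hk.
have h1 := ht _ (bd_act_bd Xcat0 Xproper k xb) hk; rewrite metric_sym in h1.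
have := metric_triangle (pt (bd_act o h (bd_act o k xi)) r) (pt (bd_act o h z) r) (pt eta r).
by lra.
Qed.

(** If [bd_act o h xp] is [eta] itself, it is replaced by the image under [h] of [g^N z] for a third
    limit point [z]: this comes close to [xp] without reaching it, because [g^N] fixes [xp]. *)
Lemma limit_not_isolated eta r e : L eta -> 0 < r -> 0 < e ->
  exists zeta, [/\ L zeta, zeta <> eta & d (pt zeta r) (pt eta r) <= e].
Proof.
move=> Leta r0 e0; have e2 : 0 < e / 2 by lra.
have [g [c [tau [w [xm [xp [Gg lox]]]]]]] := loxodromic_exists.
have [_ _ _ [xmb _] [xpb _]] := lox.
have Lp := loxodromic_limit Gg lox.
have [h Gh hp] := limit_minimal xpb Leta r0 e2.
have [z [Lz zm zp]] := limit_third xm xp; have zb := lbd Lz.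
have [t t0 ht] := bd_act_continuous Xcat0 Xproper h xpb r0 e2.
have [N /(_ N (leqnn _)) hN] := north_south Xcat0 Xproper lox zb zm t0 ltr01.
set z' := bd_act o (g ^+ N)%g z in hN.
have z'b : boundary o z' by exact: bd_act_bd.
have Lz' : L z' by apply: limit_set_act => //; exact: subgroupX.
have z'p : z' <> xp.
  move=> /(congr1 (bd_act o (g ^+ N)^-1%g)); rewrite bd_actK//.
  by rewrite -{1}(loxodromic_fixedX Xcat0 Xproper lox N) bd_actK.
rewrite metric_sym in hN; have hz' := ht z' z'b hN.
have [hpe|hpe] := pselect (bd_act o h xp = eta); last first.
  by exists (bd_act o h xp); split=> //; [exact: limit_set_act|lra].
exists (bd_act o h z'); split; first exact: limit_set_act.
  rewrite -hpe => /(congr1 (bd_act o h^-1%g)).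
  by rewrite !bd_actK.
by rewrite -hpe metric_sym; lra.
Qed.

Lemma limit_avoid eta a r e : L eta -> 0 < r -> 0 < e ->
  exists zeta, [/\ L zeta, zeta <> a & d (pt zeta r) (pt eta r) <= e].
Proof.
move=> Leta r0 e0; have [->|ne] := pselect (a = eta); first exact: limit_not_isolated.
by exists eta; split=> //; [move/esym|rewrite mdistxx ltW].
Qed.

End LimitSet.

(** * Pairs of fixed points *)

Section Pairs.
Variables (R : realType) (X : metricType R) (o : X).
Local Notation d := (@mdist R X).
Implicit Types (c : R -> X) (x y p q : X) (s t r e K T u w tau C : R) (g h : isom X).
Implicit Types (xi eta zeta xm xp : curve X) (U V : set X).
Hypothesis Xcat0 : cat0 X.
Hypothesis Xproper : proper_space X.

Lemma bd_le_radius xi eta r t : boundary o xi -> boundary o eta -> 0 <= r <= t ->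
  d (pt xi r) (pt eta r) <= d (pt xi t) (pt eta t).
Proof.
move=> xb eb /andP[r0 rt]; have [t0|t0] := ltP 0 t; last first.
  by have -> : r = t by lra.
have rt' : 0 <= r <= t by rewrite r0.
apply: le_trans (bd_cone Xcat0 xb eb rt' t0) _.
by rewrite ler_piMl ?mdist_ge0// ler_pdivrMr// mul1r.
Qed.

Lemma loxodromic_fixedV g c tau w xm xp n : loxodromic o g c tau w xm xp ->
  bd_act o (g ^+ n)%g xm = xm.
Proof.
move=> lox; have [_ _ _ [xmb _] _] := lox.
have h := loxodromic_fixedX Xcat0 Xproper (loxodromicV lox) n.
by rewrite -{1}h expVgn bd_actVK.
Qed.

Lemma loxodromic_ge g c tau w xm xp B : loxodromic o g c tau w xm xp ->
  exists n : nat, forall m, (n <= m)%N -> B <= tau * m%:R.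
Proof.
move=> [[_ tau0 _] _ _ _ _]; exists (Num.truncn (B / tau)).+1 => m nm.
rewrite mulrC -ler_pdivrMr//; apply/ltW/(lt_le_trans (truncnS_gt _)).
by rewrite ler_nat.
Qed.

(** The points [g^(n+1) o] lie in [V] and converge to [xp], which locates a pole of an isometry
    known only through its ping-pong sets. *)
Lemma ping_pong_end g U V K c tau w xm xp xi r C : ping_pong g U V o K ->
  loxodromic o g c tau w xm xp -> 0 < r ->
  (forall x, V x -> near_ray o xi r C x) -> d (pt xp r) (pt xi r) <= 1 + C.
Proof.
move=> pp lox r0 hV; have [tr _ _ _ _] := lox.
have [_ _ [nU _] _ _] := pp.
have [T hT] := proj_near_ray Xcat0 Xproper lox r0 ltr01.
have [n /(_ n.+1 (leqnSn _)) hn] := loxodromic_ge (T - proj c o) lox.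
apply: (@near_ray2 _ _ o xp xi r 1 C ((g ^+ n.+1)%g o)).
  by apply: hT; rewrite (proj_translateX Xcat0 _ _ tr); lra.
by apply: hV; exact: ping_pong_iter pp nU.
Qed.

Section TwoAxes.
Variables (a b : isom X) (ca cb : R -> X) (ta tb wa wb : R).
Variables (am ap bm bp : curve X).
Hypothesis loxa : loxodromic o a ca ta wa am ap.
Hypothesis loxb : loxodromic o b cb tb wb bm bp.

(* The complement of a half-space at the attracting point of a is pushed by
   a^-n close to the repelling point of a, hence away from that of b, and then
   by b^m into a half-space at the attracting point of b. *)
Lemma two_axes_ping_pong r : ap <> bp -> am <> bm -> 0 < r ->
  exists m n U V K, [/\ ping_pong (b ^+ m * (a ^+ n)^-1)%g U V o K,
    forall x, U x -> near_ray o ap r 1 x & forall x, V x -> near_ray o bp r 1 x].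
Proof.
move=> nep nem r0.
have [tra _ _ _ _] := loxa; have [cla _ _] := tra.
have [trb _ _ _ _] := loxb; have [clb _ _] := trb.
have [T1 hT1] := half_spaces_disjoint Xcat0 Xproper loxa loxb nep.
have [T2 hT2] := half_spaces_disjoint Xcat0 Xproper (loxodromicV loxa) (loxodromicV loxb) nem.
have [T3 [K hT3]] := half_spaces_visible Xcat0 Xproper loxa loxb nep.
have [T4 hT4] := half_space_far o 0 cla.
have [T5 hT5] := half_space_far o (Num.max 0 (2 * K)) clb.
have [T6 hT6] := proj_near_ray Xcat0 Xproper loxa r0 ltr01.
have [T7 hT7] := proj_near_ray Xcat0 Xproper loxb r0 ltr01.
pose T := Num.max T1 (Num.max T3 (Num.max T4 (Num.max T5 (Num.max T6 T7)))).
have /and5P[t1 t3 t4 t5 /andP[t6 t7]] :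
    [&& T1 <= T, T3 <= T, T4 <= T, T5 <= T & (T6 <= T) && (T7 <= T)].
  by rewrite /T !le_max !lexx !orbT.
have [n /(_ n (leqnn _)) hn] := loxodromic_ge (T + T2) loxa.
have [m /(_ m (leqnn _)) hm] := loxodromic_ge (T + T2) loxb.
have push x : ~ T <= proj ca x -> T <= proj cb ((b ^+ m * (a ^+ n)^-1)%g x).
  move=> /negP; rewrite -ltNge => xT; rewrite isomM (proj_translateX Xcat0 _ _ trb).
  set y := ((a ^+ n)^-1)%g x.
  have yT : T2 <= proj (reversed ca) y.
    have : proj ca x = proj ca y + ta * n%:R.
      by rewrite -(proj_translateX Xcat0 _ _ tra) /y isomVK.
    by rewrite proj_rev//; lra.
  have : proj (reversed cb) y < T2 by rewrite ltNge; apply/negP => /(hT2 _ yT).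
  by rewrite proj_rev//; lra.
have nUo : ~ T <= proj ca o.
  by move=> h; have := hT4 o (le_trans t4 h); rewrite mdistxx ltxx.
exists m, n, [set x | T <= proj ca x], [set x | T <= proj cb x], K; split=> /=.
- split => /=.
  + exact: push.
  + by move=> x h1 h2; apply: (hT1 x (le_trans t1 h1) (le_trans t1 h2)).
  + split=> // h; have := hT5 o (le_trans t5 h).
    by rewrite mdistxx gt_max ltxx.
  + by move=> x y h1 h2; apply: hT3; [exact: le_trans t3 h1|exact: le_trans t3 h2].
  + have := hT5 _ (le_trans t5 (push o nUo)).
    by rewrite gt_max => /andP[].
- by move=> x h; apply: hT6; exact: le_trans t6 h.
- by move=> x h; apply: hT7; exact: le_trans t7 h.
Qed.

End TwoAxes.

Section Group.
Variable G : set (isom X).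
Local Notation L := (limit_set o G).
Hypothesis Gsub : subgroup G.
Hypothesis Gne : ~ elementary o G.
Hypothesis Grank_one : exists2 g, G g & rank_one g.

Let lbd xi : L xi -> boundary o xi. Proof. by case. Qed.

Lemma loxodromic_near xi r e : L xi -> 0 < r -> 0 < e ->
  exists g c tau w xm xp, [/\ G g, loxodromic o g c tau w xm xp &
    d (pt xp r) (pt xi r) <= e].
Proof.
move=> Lxi r0 e0.
have [g [c [tau [w [xm [xp [Gg lox]]]]]]] := loxodromic_exists o Xcat0 Xproper Grank_one.
have [_ _ _ _ [xpb _]] := lox.
have [h Gh hp] := limit_minimal Xcat0 Xproper Gsub Gne Grank_one xpb Lxi r0 e0.
exists (h * g * h^-1)%g, (h \o c), tau, w, (bd_act o h xm), (bd_act o h xp); split=> //.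
  by apply: (subgroupM Gsub); [exact: subgroupM|exact: subgroupV].
exact: (loxodromicJ Xcat0 Xproper).
Qed.

Lemma limit_orbit_avoid (z x1 x2 : curve X) : boundary o z -> boundary o x1 -> boundary o x2 ->
  exists h, [/\ G h, bd_act o h z <> x1 & bd_act o h z <> x2].
Proof.
move=> zb x1b x2b; have [y [Ly y1 y2]] := limit_third Gne x1 x2; have yb := lbd Ly.
have [r1 r10 d1] := bd_neq_sep Xcat0 1 yb x1b y1.
have [r2 r20 d2] := bd_neq_sep Xcat0 1 yb x2b y2.
have r3 : 0 < Num.max r1 r2 by rewrite lt_max r10.
have [h Gh hz] := limit_minimal Xcat0 Xproper Gsub Gne Grank_one zb Ly r3 ltr01.
have hb := bd_act_bd Xcat0 Xproper h zb.
exists h; split=> //.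
  move=> E; have r1m : 0 <= r1 <= Num.max r1 r2 by rewrite (ltW r10) le_max lexx.
  have h1 := bd_le_radius hb yb r1m; rewrite E in h1 hz; rewrite metric_sym in d1.
  by have := lt_le_trans d1 (le_trans h1 hz); rewrite ltxx.
move=> E; have r2m : 0 <= r2 <= Num.max r1 r2 by rewrite (ltW r20) le_max lexx orbT.
have h2 := bd_le_radius hb yb r2m; rewrite E in h2 hz; rewrite metric_sym in d2.
by have := lt_le_trans d2 (le_trans h2 hz); rewrite ltxx.
Qed.

(** Conjugation places the attracting points but gives no control on the repelling ones. If these
    coincide, [b] is replaced by the conjugate of [a] by [u = b^N j]: [j] moves [ap] off [bm], so
    that [b^N] brings it near [bp], and moves [am] off itself, which [b^N], fixing [am = bm], cannot
    undo. *)
Lemma two_loxodromics xi eta r e : L xi -> L eta -> 0 < r -> 0 < e ->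
  exists a b ca cb ta tb wa wb am ap bm bp, [/\
    [/\ G a, G b, loxodromic o a ca ta wa am ap & loxodromic o b cb tb wb bm bp],
    am <> bm, d (pt ap r) (pt xi r) <= e & d (pt bp r) (pt eta r) <= e].
Proof.
move=> Lxi Leta r0 e0; have e2 : 0 < e / 2 by lra.
have [a [ca [ta [wa [am [ap [Ga loxa ha]]]]]]] := loxodromic_near Lxi r0 e0.
have [b [cb [tb [wb [bm [bp [Gb loxb hb]]]]]]] := loxodromic_near Leta r0 e2.
have [ambm|ne] := pselect (am = bm); last first.
  exists a, b, ca, cb, ta, tb, wa, wb, am, ap, bm, bp; split=> //.
  by apply: (le_trans hb); lra.
have [_ _ _ [amb _] [apb _]] := loxa; have [_ _ _ _ [bpb _]] := loxb.
have [i [Gi i1 i2]] := limit_orbit_avoid amb apb amb.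
pose j := (i^-1)%g; have Gj : G j by exact: subgroupV.
have jp : bd_act o j ap <> bm.
  by move=> E; apply: i1; rewrite ambm -E bd_actVK.
have jm : bd_act o j am <> am.
  by move=> E; apply: i2; rewrite -{1}E bd_actVK.
have jpb := bd_act_bd Xcat0 Xproper j apb; have jmb := bd_act_bd Xcat0 Xproper j amb.
have [N /(_ N (leqnn _)) hN] := north_south Xcat0 Xproper loxb jpb jp r0 e2.
pose u := (b ^+ N * j)%g.
have Gu : G u by apply: subgroupM => //; exact: subgroupX.
have lox' := loxodromicJ Xcat0 Xproper u loxa.
exists a, (u * a * u^-1)%g, ca, (u \o ca), ta, ta, wa, wa, am, ap,
  (bd_act o u am), (bd_act o u ap); split=> //.
- split=> //; apply: (subgroupM Gsub); [exact: subgroupM|exact: subgroupV].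
- rewrite bd_actM// => E; apply: jm.
  have := congr1 (bd_act o (b ^+ N)^-1%g) E; rewrite bd_actK// => <-.
  by rewrite ambm -{1}(loxodromic_fixedV N loxb) bd_actK// -ambm.
rewrite bd_actM//; apply: le_trans (metric_triangle _ (pt bp r) _) _.
by lra.
Qed.

Lemma rank_one_pair_near xi eta r e : L xi -> L eta -> xi <> eta -> 0 < r -> 0 < e ->
  exists g c tau w xm xp, [/\ G g, rank_one g, loxodromic o g c tau w xm xp,
    d (pt xm r) (pt xi r) <= e & d (pt xp r) (pt eta r) <= e].
Proof.
move=> Lxi Leta ne r0 e0; have xb := lbd Lxi; have eb := lbd Leta.
have [r1 r10 sep] := bd_neq_sep Xcat0 2 xb eb ne.
(* The error 3 is 1 for the attracting points of [a] and [b] plus [1 + 1] from [ping_pong_end]. *)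
have [r2 [r20 rr2 hr2]] := bd_coarse o Xcat0 r0 e0 (ler0n R 3).
pose t := Num.max r1 r2.
have t0 : 0 < t by rewrite lt_max r10.
have r1t : 0 <= r1 <= t by rewrite (ltW r10) le_max lexx.
have r2t : 0 <= r2 <= t by rewrite (ltW r20) le_max lexx orbT.
have [a [b [ca [cb [ta [tb [wa [wb [am [ap [bm [bp [[Ga Gb loxa loxb] nem ha hb]]]]]]]]]]]]] :=
  two_loxodromics Lxi Leta t0 ltr01.
have [_ _ _ _ [apb _]] := loxa; have [_ _ _ _ [bpb _]] := loxb.
have nep : ap <> bp.
  move=> E; have := bd_le_radius xb eb r1t.
  have := metric_triangle (pt xi t) (pt ap t) (pt eta t).
  by rewrite (metric_sym (pt xi t) (pt ap t)); rewrite -E in hb; lra.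
have [m [n [U [V [K [pp hU hV]]]]]] := two_axes_ping_pong loxa loxb nep nem t0.
set g := (_ * _)%g in pp; have ro := ping_pong_rank_one Xcat0 Xproper pp.
have [c [tau [w [xm [xp lox]]]]] := rank_one_loxodromic o Xcat0 Xproper ro.
have hp := ping_pong_end pp lox t0 hV.
have hm := ping_pong_end (ping_pongV pp) (loxodromicV lox) t0 hU.
have [_ _ _ [xmb _] [xpb _]] := lox.
exists g, c, tau, w, xm, xp; split=> //.
- apply: (subgroupM Gsub); first exact: subgroupX.
  by apply: subgroupV => //; exact: subgroupX.
- apply: hr2 => //; apply: (le_trans (bd_le_radius xmb xb r2t)).
  by apply: le_trans (metric_triangle _ (pt ap t) _) _; lra.
- apply: hr2 => //; apply: (le_trans (bd_le_radius xpb eb r2t)).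
  by apply: le_trans (metric_triangle _ (pt bp t) _) _; lra.
Qed.

(** [a] has poles near [x1], [y1] and [b] near [x2], [y2]. The pair is [a^-N bm], close to [am],
    together with [ap]; applying [a^N] and then [b^M] yields [bm] and a point close to [bp]. The
    primed points make each prescribed pair distinct and keep [bm] off [ap]. *)
Lemma limit_transitive (x1 y1 x2 y2 : curve X) r e : L x1 -> L y1 -> L x2 -> L y2 ->
  0 < r -> 0 < e -> exists h (x y : curve X), [/\ [/\ G h, L x & L y],
    d (pt x r) (pt x1 r) <= e /\ d (pt y r) (pt y1 r) <= e,
    d (pt (bd_act o h x) r) (pt x2 r) <= e &
    d (pt (bd_act o h y) r) (pt y2 r) <= e].
Proof.
move=> Lx1 Ly1 Lx2 Ly2 r0 e0; have e2 : 0 < e / 2 by lra.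
have e4 : 0 < e / 4 by lra.
have avoid := @limit_avoid _ _ G o Xcat0 Xproper Gsub Gne Grank_one.
have [y1' [Ly1' ne1 hy1]] := avoid y1 x1 r _ Ly1 r0 e2.
have [a [ca [ta [wa [am [ap [Ga _ loxa ha1 ha2]]]]]]] :=
  rank_one_pair_near Lx1 Ly1' (fun E => ne1 (esym E)) r0 e2.
have [_ _ _ [amb _] [apb _]] := loxa.
have [x2' [Lx2' ne2 hx2]] := avoid x2 ap r _ Lx2 r0 e2.
have x2b := lbd Lx2'.
have [y2' [Ly2' ne3 hy2]] := avoid y2 x2' r _ Ly2 r0 e4.
have [s s0 sep] := bd_neq_sep Xcat0 1 x2b apb ne2.
pose t := Num.max r s; have t0 : 0 < t by rewrite lt_max r0.
have rt : 0 <= r <= t by rewrite (ltW r0) le_max lexx.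
have st : 0 <= s <= t by rewrite (ltW s0) le_max lexx orbT.
pose e' := Num.min 1 (e / 4); have e'0 : 0 < e' by rewrite lt_min ltr01.
have e'1 : e' <= 1 by rewrite ge_min lexx.
have e'4 : e' <= e / 4 by rewrite ge_min lexx orbT.
have [b [cb [tb [wb [bm [bp [Gb _ loxb hb1 hb2]]]]]]] :=
  rank_one_pair_near Lx2' Ly2' (fun E => ne3 (esym E)) t0 e'0.
have [_ _ _ [bmb _] [bpb _]] := loxb.
have nebm : bm <> ap.
  move=> E; have h1 := bd_le_radius x2b apb st.
  by rewrite -E in h1 sep; rewrite metric_sym in hb1; lra.
have y2b := lbd Ly2'.
have hb1' := le_trans (bd_le_radius bmb x2b rt) hb1.
have hb2' := le_trans (bd_le_radius bpb y2b rt) hb2.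
have [N /(_ N (leqnn _)) hN] := north_south Xcat0 Xproper (loxodromicV loxa) bmb nebm r0 e2.
have [M /(_ M (leqnn _)) hM] := north_south Xcat0 Xproper loxb apb (fun E => nebm (esym E)) r0 e2.
have Lbm : L bm.
  exact: (loxodromic_limit Xcat0 Xproper Gsub (subgroupV Gsub Gb) (loxodromicV loxb)).
have Lap := loxodromic_limit Xcat0 Xproper Gsub Ga loxa.
have GaN : G ((a^-1) ^+ N)%g by apply: (subgroupX Gsub); exact: subgroupV.
exists (b ^+ M * a ^+ N)%g, (bd_act o ((a^-1) ^+ N)%g bm), ap; split.
- split=> //; first by apply: (subgroupM Gsub); exact: subgroupX.
  exact: limit_set_act.
- split; first by apply: le_trans (metric_triangle _ (pt am r) _) _; lra.
  by apply: le_trans (metric_triangle _ (pt y1' r) _) _; lra.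
- rewrite bd_actM//; last exact: bd_act_bd.
  rewrite expVgn bd_actVK// (loxodromic_fixedV M loxb).
  by apply: le_trans (metric_triangle _ (pt x2' r) _) _; lra.
rewrite bd_actM// (loxodromic_fixedX Xcat0 Xproper loxa).
apply: le_trans (metric_triangle _ (pt bp r) _) _.
have := metric_triangle (pt bp r) (pt y2' r) (pt y2 r); lra.
Qed.

End Group.

End Pairs.

(** * A dense orbit *)

Section DenseOrbit.
Variables (R : realType) (X : metricType R) (o : X) (G : set (isom X)).
Local Notation d := (@mdist R X).
Local Notation L := (limit_set o G).
Implicit Types (s t e K T u w tau C : R) (g h : isom X).
Implicit Types (xi eta zeta : curve X).
Hypothesis Xcat0 : cat0 X.
Hypothesis Xproper : proper_space X.

Let lbd xi : L xi -> boundary o xi. Proof. by case. Qed.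

(* A sequence chosen greedily to be 1-separated at radius r has to stop. *)
Lemma limit_net xi0 (r : R) : L xi0 -> 0 < r -> exists E : nat -> curve X,
  (forall i, L (E i)) /\ forall xi, L xi -> exists i, d (pt xi r) (pt (E i) r) <= 1.
Proof.
move=> L0 r0.
pose far (l : seq (curve X)) := [set xi | L xi /\
  forall i, (i < size l)%N -> 1 < d (pt xi r) (pt (nth xi0 l i) r)].
pose F := fix F n := if n is n'.+1 then rcons (F n') (xget xi0 (far (F n'))) else [::].
pose E n := xget xi0 (far (F n)).
have sF n : size (F n) = n by elim: n => //= n IH; rewrite size_rcons IH.
have nF i n : (i < n)%N -> nth xi0 (F n) i = E i.
  elim: n => // n IH; rewrite ltnS /= nth_rcons sF leq_eqVlt => /orP[/eqP ->|lt].
    by rewrite ltnn eqxx.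
  by rewrite lt IH.
exists E; split=> [i|xi Lxi]; first by rewrite /E; case: xgetP => [y -> []|].
apply: contrapT => H.
have sep i n : (i < n)%N -> 1 < d (pt (E n) r) (pt (E i) r).
  move=> lt; have : far (F n) (E n).
    rewrite /E; case: xgetP => [y -> //|/(_ xi)[]]; split=> // j; rewrite sF => jn.
    rewrite nF// ltNge; apply/negP => h; apply: H; by exists j.
  by case=> _ /(_ i); rewrite sF nF//; apply.
have LE i : L (E i) by rewrite /E; case: xgetP => [y -> []|].
have cvE : ucvg (fun n => pt (E n) r) (ulim (fun n => pt (E n) r)).
  apply: (@ulimP _ _ Xproper _ o r); apply: filterE => n /=.
  by rewrite (bd_dist0 (lbd (LE n)))// ltW.
have e0 : 0 < 1 / 2 :> R by lra.
have A := cvE _ e0; have [i Ai] := filter_ex A.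
have [n [An /= lt]] := filter_ex (filterI A (omega_ge i.+1)).
have := sep _ _ lt; move: Ai An => /=; set q := ulim _.
have := metric_triangle (pt (E n) r) q (pt (E i) r).
by rewrite (metric_sym q); lra.
Qed.

(** Error 1 at radius [r k.+1] becomes [1 / 2] at radius [r k], as the radii at least double; with
    the allowed step of [1 / 2] the neighbourhoods are nested. *)
Lemma nested_limit (x : nat -> curve X) (r : nat -> R) :
  (forall k, L (x k)) -> (forall k, 0 < r k) -> (forall k, 2 * r k <= r k.+1) ->
  (forall k, d (pt (x k.+1) (r k)) (pt (x k) (r k)) <= 1 / 2) ->
  exists zeta, L zeta /\ forall k, d (pt zeta (r k)) (pt (x k) (r k)) <= 1.
Proof.
move=> Lx r0 rr xx; have xb k := lbd (Lx k).
have nest n k zeta : boundary o zeta ->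
    d (pt zeta (r (k + n)%N)) (pt (x (k + n)%N) (r (k + n)%N)) <= 1 ->
    d (pt zeta (r k)) (pt (x k) (r k)) <= 1.
  move=> zb; elim: n k => [|n IH] k; first by rewrite addn0.
  rewrite addnS -addSn => /IH h; have rk : 0 <= r k <= r k.+1.
    by have := r0 k; have := rr k; lra.
  have := bd_cone Xcat0 zb (xb k.+1) rk (r0 _).
  have : r k / r k.+1 * d (pt zeta (r k.+1)) (pt (x k.+1) (r k.+1)) <= 1 / 2.
    apply: (@le_trans _ _ (r k / r k.+1)).
      by rewrite ler_piMr// divr_ge0 ?ltW.
    by rewrite ler_pdivrMr//; have := rr k; lra.
  have := xx k; have := metric_triangle (pt zeta (r k)) (pt (x k.+1) (r k)) (pt (x k) (r k)).
  by lra.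
pose y t n := pt (x n) t.
have cvy t : 0 <= t -> ucvg (y t) (ulim (y t)).
  move=> t0; apply: (@ulimP _ _ Xproper _ o t); apply: filterE => n /=.
  by rewrite bd_dist0.
pose zeta := curve_of (fun t => ulim (y t)).
have zE t : 0 <= t -> pt zeta t = ulim (y t) by move=> t0; rewrite pt_curve_of.
have zb : boundary o zeta.
  apply/boundaryP; split=> [s t s0 t0|].
    rewrite !zE//; apply: (ucvg_eq (cvy s s0) (cvy t t0)).
    by apply: filterE => n /=; rewrite (bd_ray (xb n)).
  rewrite zE//; apply: (@mdist_positivity R).
  apply: (ucvg_eq (cvy 0 (lexx _)) (ucvg_cst o)).
  by apply: filterE => n /=; rewrite /y (bd0 (xb n)) mdistxx.
have close k : d (pt zeta (r k)) (pt (x k) (r k)) <= 1.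
  rewrite zE; last exact: ltW.
  apply: (ucvg_le (cvy _ (ltW (r0 k))) (ucvg_cst _)) => e e0.
  apply: filterS (omega_ge k) => n /= kn.
  apply: (@le_trans _ _ 1); last by rewrite lerDl ltW.
  by apply: (nest (n - k)%N) => //; rewrite subnKC// mdistxx.
exists zeta; split=> //; apply: (limit_set_closed Xcat0 (C := 1) zb) => // t t0.
have grow k : k.+1%:R * r 0%N <= r k.
  elim: k => [|k IH]; first by rewrite mul1r.
  have := rr k; rewrite -natr1 mulrDl mul1r.
  have : r 0%N <= r k.
    by apply: le_trans IH; rewrite ler_peMl ?ler1n// ltW.
  by lra.
pose k := Num.truncn (t / r 0%N).
have tk : 0 <= t <= r k.
  rewrite (ltW t0) /=; apply: le_trans (grow k).
  by rewrite -ler_pdivrMr//; exact/ltW/truncnS_gt.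
exists (x k) => //; rewrite metric_sym.
exact: le_trans (bd_le_radius Xcat0 zb (xb k) tk) (close k).
Qed.

Hypothesis Gsub : subgroup G.
Hypothesis Gne : ~ elementary o G.
Hypothesis Grank_one : exists2 g, G g & rank_one g.

(** A Baire argument by hand. Step [k] decodes a triple [(m, i, j)] and shrinks both current
    neighbourhoods so that one element of [G] carries them near the net points [i] and [j] at radius
    [m + 1]. Starting centres more than 2 apart keep the two limits distinct. *)
Lemma limit_dense_orbit : exists p1 p2 : curve X, [/\ L p1, L p2, p1 <> p2 &
  forall xi eta (r e : R), L xi -> L eta -> 0 < r -> 0 < e -> exists2 h, G h &
    d (pt (bd_act o h p1) r) (pt xi r) <= e /\
    d (pt (bd_act o h p2) r) (pt eta r) <= e].
Proof.
have [g [c [tau [w [a [b [Gg lox]]]]]]] := loxodromic_exists o Xcat0 Xproper Grank_one.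
have Lb := loxodromic_limit Xcat0 Xproper Gsub Gg lox.
have La := loxodromic_limit Xcat0 Xproper Gsub (subgroupV Gsub Gg) (loxodromicV lox).
have ab := loxodromic_neq lox.
have [r0 r00 sep] := bd_neq_sep Xcat0 2 (lbd La) (lbd Lb) ab.
have [E EP] := choice (fun m : nat => limit_net La (ltr0Sn R m)).
pose mij k : nat * nat * nat := odflt (0, 0, 0)%N (unpickle k).
pose rad k : R := (mij k).1.1.+1%:R.
pose e1 k := E (mij k).1.1 (mij k).1.2; pose e2 k := E (mij k).1.1 (mij k).2.
pose inv (S : curve X * curve X * R) := [/\ L S.1.1, L S.1.2 & 0 < S.2].
pose step k (S S' : curve X * curve X * R) := [/\ inv S', 2 * S.2 <= S'.2,
  d (pt S'.1.1 S.2) (pt S.1.1 S.2) <= 1 / 2 /\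
  d (pt S'.1.2 S.2) (pt S.1.2 S.2) <= 1 / 2 &
  exists2 h, G h & forall zeta, boundary o zeta ->
    (d (pt zeta S'.2) (pt S'.1.1 S'.2) <= 1 ->
      d (pt (bd_act o h zeta) (rad k)) (pt (e1 k) (rad k)) <= 1) /\
    (d (pt zeta S'.2) (pt S'.1.2 S'.2) <= 1 ->
      d (pt (bd_act o h zeta) (rad k)) (pt (e2 k) (rad k)) <= 1)].
have next (kS : nat * (curve X * curve X * R)) : exists S', inv kS.2 -> step kS.1 kS.2 S'.
  case: kS => k S /=; have [[L1 L2 S0]|ninv] := pselect (inv S); last by exists S.
  have k0 : 0 < rad k by rewrite ltr0Sn.
  have half : 0 < 1 / 2 :> R by lra.
  pose t := Num.max S.2 (rad k).
  have t0 : 0 < t by rewrite lt_max S0.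
  have St : 0 <= S.2 <= t by rewrite (ltW S0) le_max lexx.
  have kt : 0 <= rad k <= t by rewrite (ltW k0) le_max lexx orbT.
  have [Le1 Le2] : L (e1 k) /\ L (e2 k) by split; apply: (EP _).1.
  have [h [x [y [[Gh Lx Ly] [x1 y1] x2 y2]]]] :=
    limit_transitive Xcat0 Xproper Gsub Gne Grank_one L1 L2 Le1 Le2 t0 half.
  have xb := lbd Lx; have yb := lbd Ly.
  have hxb := bd_act_bd Xcat0 Xproper h xb; have hyb := bd_act_bd Xcat0 Xproper h yb.
  have [t1 t10 h1] := bd_act_continuous Xcat0 Xproper h xb k0 half.
  have [t2 t20 h2] := bd_act_continuous Xcat0 Xproper h yb k0 half.
  pose r' := Num.max (2 * S.2) (Num.max t1 t2).
  have r'1 : 0 <= t1 <= r' by rewrite (ltW t10) !le_max lexx orbT.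
  have r'2 : 0 <= t2 <= r' by rewrite (ltW t20) !le_max lexx !orbT.
  exists (x, y, r') => _; split=> /=.
  - by split=> //=; rewrite lt_max mulr_gt0.
  - by rewrite le_max lexx.
  - split; first exact: le_trans (bd_le_radius Xcat0 xb (lbd L1) St) x1.
    exact: le_trans (bd_le_radius Xcat0 yb (lbd L2) St) y1.
  exists h => // zeta zb; split=> hz.
    have := h1 _ zb; rewrite metric_sym.
    move=> /(_ (le_trans (bd_le_radius Xcat0 zb xb r'1) hz)).
    have := le_trans (bd_le_radius Xcat0 hxb (lbd Le1) kt) x2.
    have := metric_triangle (pt (bd_act o h zeta) (rad k))
      (pt (bd_act o h x) (rad k)) (pt (e1 k) (rad k)).
    by rewrite (metric_sym (pt (bd_act o h zeta) _) (pt (bd_act o h x) _)); lra.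
  have := h2 _ zb; rewrite metric_sym.
  move=> /(_ (le_trans (bd_le_radius Xcat0 zb yb r'2) hz)).
  have := le_trans (bd_le_radius Xcat0 hyb (lbd Le2) kt) y2.
  have := metric_triangle (pt (bd_act o h zeta) (rad k))
    (pt (bd_act o h y) (rad k)) (pt (e2 k) (rad k)).
  by rewrite (metric_sym (pt (bd_act o h zeta) _) (pt (bd_act o h y) _)); lra.
have [nx nxP] := choice next.
pose S : nat -> curve X * curve X * R :=
  fix S k := if k is k'.+1 then nx (k', S k') else (a, b, r0).
have Sinv k : inv (S k).
  elim: k => [|k IH] //=; by have [] := nxP (k, S k) IH.
have Sstep k : step k (S k) (S k.+1) by exact: (nxP (k, S k) (Sinv k)).
have [|||k|p1 [Lp1 hp1]] := @nested_limit (fun k => (S k).1.1) (fun k => (S k).2).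
- by move=> k; case: (Sinv k).
- by move=> k; case: (Sinv k).
- by move=> k; case: (Sstep k).
- by case: (Sstep k) => _ _ [].
have [|||k|p2 [Lp2 hp2]] := @nested_limit (fun k => (S k).1.2) (fun k => (S k).2).
- by move=> k; case: (Sinv k).
- by move=> k; case: (Sinv k).
- by move=> k; case: (Sstep k).
- by case: (Sstep k) => _ _ [].
exists p1, p2; split=> //.
  move=> E12; have := hp1 0%N; have := hp2 0%N; rewrite -E12 /=.
  have := metric_triangle (pt a r0) (pt p1 r0) (pt b r0).
  by rewrite (metric_sym (pt a r0) (pt p1 r0)); lra.
move=> xi eta r e Lxi Leta rgt0 e0.
(* The error 2 is 1 for the net and 1 for the step that treats the chosen net points. *)
have [t [t0 rt ht]] := bd_coarse o Xcat0 rgt0 e0 (ler0n R 2).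
pose m := Num.truncn t.
have tm : 0 <= t <= m.+1%:R by rewrite ltW//=; exact/ltW/truncnS_gt.
have [i hi] := (EP m).2 xi Lxi; have [j hj] := (EP m).2 eta Leta.
pose k := pickle (m, i, j).
have mijE : mij k = (m, i, j) by rewrite /mij pickleK.
have [_ _ _ [h Gh hh]] := Sstep k.
have hb1 := bd_act_bd Xcat0 Xproper h (lbd Lp1).
have hb2 := bd_act_bd Xcat0 Xproper h (lbd Lp2).
exists h => //; split; apply: ht => //; try exact: lbd.
  have [/(_ (hp1 k.+1)) h1 _] := hh p1 (lbd Lp1).
  rewrite /rad /e1 mijE /= in h1.
  apply: le_trans (bd_le_radius Xcat0 hb1 (lbd Lxi) tm) _.
  apply: le_trans (metric_triangle _ (pt (E m i) m.+1%:R) _) _.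
  by rewrite metric_sym (metric_sym _ (pt xi _)) in h1 *; lra.
have [_ /(_ (hp2 k.+1)) h2] := hh p2 (lbd Lp2).
rewrite /rad /e2 mijE /= in h2.
apply: le_trans (bd_le_radius Xcat0 hb2 (lbd Leta) tm) _.
apply: le_trans (metric_triangle _ (pt (E m j) m.+1%:R) _) _.
by rewrite metric_sym (metric_sym _ (pt eta _)) in h2 *; lra.
Qed.

End DenseOrbit.

(** * Free subgroups *)

Section Words.
Variables (gT : groupType) (a b : gT).
Implicit Types (l m : bool * bool) (w v : seq (bool * bool)).

Definition eval_word w : gT := foldr (fun l g => (letter a b l * g)%g) 1%g w.

Definition inv_letter l : bool * bool := (l.1, ~~ l.2).

Lemma inv_letterK : involutive inv_letter.
Proof. by case=> i e; rewrite /inv_letter /= negbK. Qed.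

Lemma letterV l : letter a b (inv_letter l) = ((letter a b l)^-1)%g.
Proof. by case: l => -[] [] //=; rewrite /letter /= invgK. Qed.

Lemma eval_word_cat w v : eval_word (w ++ v) = (eval_word w * eval_word v)%g.
Proof. by elim: w => [|l w IH] /=; rewrite ?mul1g// IH mulgA. Qed.

Lemma eval_word_rcons w l : eval_word (rcons w l) = (eval_word w * letter a b l)%g.
Proof. by rewrite -cats1 eval_word_cat /= mulg1. Qed.

Lemma eval_wordV w : eval_word (rev (map inv_letter w)) = ((eval_word w)^-1)%g.
Proof.
elim: w => [|l w IH] /=; first by rewrite invg1.
by rewrite rev_cons eval_word_rcons IH letterV invgM.
Qed.

Lemma eval_word_reduced w : exists2 v, reduced_word v & eval_word v = eval_word w.
Proof.
elim: w => [|l w [[|m v] red IH]]; first by exists [::].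
  by exists [:: l] => //=; rewrite -IH.
have [ml|ml] := eqVneq m (inv_letter l).
  exists v; first exact: path_sorted red.
  by rewrite /= -IH /= ml letterV mulgA mulgV mul1g.
by exists [:: l, m & v]; [rewrite /reduced_word /= ml|rewrite /= -IH].
Qed.

Lemma smallest_subgroup_words (h : gT) : smallest (@subgroup gT) [set a; b] h ->
  exists2 w, reduced_word w & h = eval_word w.
Proof.
pose E := [set eval_word w | w in setT].
move=> /(_ E)[|w _ <-].
  split=> /=.
    split; first by apply: mem_set; exists [::].
    move=> u v /set_mem[w1 _ <-] /set_mem[w2 _ <-]; apply: mem_set.
    by exists (w1 ++ rev (map inv_letter w2)) => //; rewrite eval_word_cat eval_wordV.
  by move=> g [->|->]; [exists [:: (true, true)]|exists [:: (false, true)]] => //=;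
    rewrite mulg1.
by have [v red <-] := eval_word_reduced w; exists v.
Qed.

End Words.

Section PingPong.
Variables (R : realType) (X : metricType R) (o : X).
Local Notation d := (@mdist R X).
Implicit Types (c : R -> X) (x y p q : X) (s t e K T u tau C : R) (g h : isom X).
Implicit Types (l m : bool * bool) (w v : seq (bool * bool)).
Hypothesis Xcat0 : cat0 X.
Hypothesis Xproper : proper_space X.

Lemma rank_oneJ h g : rank_one g -> rank_one (h * g * h^-1)%g.
Proof.
have disp tau : min_displacement g tau -> min_displacement (h * g * h^-1)%g tau.
  move=> [[x gx] gt]; split.
    by exists (h x); rewrite !isomM isomK isom_dist.
  move=> y; have := gt ((h^-1)%g y).
  by rewrite -(isom_dist h) isomVK !isomM.
move=> [[tau tau0 /disp md] [c [cl [tau' [tau'0 /disp md' gc]]] nflat]].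
split; first by exists tau.
exists (h \o c); first split.
- by move=> s t; rewrite /= isom_dist cl.
- exists tau'; split=> // t.
  by rewrite !isomM /comp isomK gc.
move=> [F [FF F0]]; apply: nflat; exists (fun p : R * R => (h^-1)%g (F p)).
split=> [p q p0 q0|t]; first by rewrite isom_dist FF.
by rewrite F0 /comp isomK.
Qed.

Section Letters.
Variables (A B : isom X) (S : bool * bool -> set X) (K : R).
Hypothesis push : forall l x, ~ S (inv_letter l) x -> S l (letter A B l x).
Hypothesis disj : forall l m x, l <> m -> S l x -> ~ S m x.
Hypothesis visible : forall l m x y, l <> m -> S l x -> S m y ->
  exists2 p, on_segment x y p & d o p <= K.
Hypothesis far : forall l x, S l x -> Num.max 0 (2 * K) < d o x.

Let far_o l : ~ S l o.
Proof. by move=> /far; rewrite mdistxx gt_max ltxx. Qed.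

Lemma inv_letter_neq l : inv_letter l <> l.
Proof. by case: l => i []. Qed.

Lemma eval_word_push l w x : reduced_word (l :: w) ->
  ~ S (inv_letter (last l w)) x -> S l (eval_word A B (l :: w) x).
Proof.
elim: w l => [|m w IH] l red nx /=; first exact: push.
apply: push => Sm; move: red; rewrite /reduced_word /= => /andP[ml red].
apply: (disj _ Sm (IH m red nx)) => E.
by move/eqP: ml; apply; rewrite -E.
Qed.

(** Cyclic reduction: if the first letter is not the inverse of the last, the word plays ping-pong
    between [S (inv_letter (last l w))] and [S l]; otherwise it is conjugate to a shorter reduced
    word. *)
Lemma eval_word_ping_pong w : reduced_word w -> w != [::] ->
  rank_one (eval_word A B w) /\ eval_word A B w <> 1%g.
Proof.
move=> red w0; split; last first.
  case: w red w0 => // l w red _ E.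
  by have := eval_word_push red (@far_o _); rewrite E isom1 => /far_o.
have [n] := ubnP (size w); elim: n w red w0 => // n IH [//|l w] red _ /= sz.
have [lm|lm] := pselect (inv_letter (last l w) = l); last first.
  apply: (ping_pong_rank_one Xcat0 Xproper (U := S (inv_letter (last l w)))
    (V := S l) (q := o) (K := K)).
  split.
  - by move=> x; exact: eval_word_push.
  - by move=> x; exact: disj.
  - by split; exact: far_o.
  - by move=> x y; exact: visible.
  - have := far (eval_word_push red (@far_o (inv_letter (last l w)))).
    by rewrite gt_max => /andP[].
case/lastP: w red sz lm => [|w m] red sz; first by move/inv_letter_neq.
rewrite last_rcons => lm.
have mE : m = inv_letter l by rewrite -lm inv_letterK.
have -> : (letter A B l * eval_word A B (rcons w m))%g =
    (letter A B l * eval_word A B w * (letter A B l)^-1)%g.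
  by rewrite eval_word_rcons mE letterV mulgA.
apply: rank_oneJ; apply: IH.
- by move: red; rewrite /reduced_word /= rcons_path => /andP[/path_sorted].
- apply/eqP => w0; move: red.
  by rewrite w0 mE /reduced_word /= eqxx.
- by move: sz; rewrite size_rcons ltnS => /ltnW.
Qed.

End Letters.

Variable G : set (isom X).
Hypothesis Gsub : subgroup G.
Hypothesis Gne : ~ elementary o G.
Hypothesis Grank_one : exists2 g, G g & rank_one g.

(** Both poles of [b] are put near one limit point [x] other than [am] and [ap]; perfectness
    supplies the nearby second point that [rank_one_pair_near] requires. The separation 2 allows 1
    for that point and 1 for the pole. *)
Lemma rank_one_independent : exists a b ca cb ta tb wa wb am ap bm bp, [/\
  [/\ G a, G b, loxodromic o a ca ta wa am ap & loxodromic o b cb tb wb bm bp],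
  bm <> am, bm <> ap, bp <> am & bp <> ap].
Proof.
have [a [ca [ta [wa [am [ap [Ga loxa]]]]]]] := loxodromic_exists o Xcat0 Xproper Grank_one.
have [_ _ _ [amb _] [apb _]] := loxa.
have [x [Lx xm xp]] := limit_third Gne am ap; have xb := limit_set_bd Lx.
have [r1 r10 s1] := bd_neq_sep Xcat0 2 xb amb xm.
have [r2 r20 s2] := bd_neq_sep Xcat0 2 xb apb xp.
pose r := Num.max r1 r2; have r0 : 0 < r by rewrite lt_max r10.
have rr1 : 0 <= r1 <= r by rewrite (ltW r10) le_max lexx.
have rr2 : 0 <= r2 <= r by rewrite (ltW r20) le_max lexx orbT.
have [y [Ly yx hy]] := limit_not_isolated Xcat0 Xproper Gsub Gne Grank_one Lx r0 ltr01.
have [b [cb [tb [wb [bm [bp [Gb _ loxb hm hp]]]]]]] :=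
  rank_one_pair_near Xcat0 Xproper Gsub Gne Grank_one Lx Ly (fun E => yx (esym E)) r0 ltr01.
have [_ _ _ [bmb _] [bpb _]] := loxb.
have {}hp : d (pt bp r) (pt x r) <= 2.
  by have := metric_triangle (pt bp r) (pt y r) (pt x r); lra.
have {}hm : d (pt bm r) (pt x r) <= 2 by lra.
have sep z z' s : boundary o z -> boundary o z' -> 0 <= s <= r ->
    2 < d (pt x s) (pt z' s) -> d (pt z r) (pt x r) <= 2 -> z <> z'.
  move=> zb z'b sr s2' hz E; rewrite E in hz.
  have := le_trans (bd_le_radius Xcat0 xb z'b sr) (_ : _ <= 2).
  by rewrite metric_sym hz leNgt s2' => /(_ isT).
exists a, b, ca, cb, ta, tb, wa, wb, am, ap, bm, bp; split=> //.
- exact: sep rr1 s1 hm.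
- exact: sep rr2 s2 hm.
- exact: sep rr1 s1 hp.
- exact: sep rr2 s2 hp.
Qed.

Lemma uniform_over_finite (I : finType) (P : I -> R -> Prop) :
  (forall i T T', T <= T' -> P i T -> P i T') -> (forall i, exists T, P i T) ->
  exists T, forall i, P i T.
Proof.
move=> mono /choice[f fP]; exists (\sum_i `|f i|) => i.
apply: mono (fP i); apply: le_trans (ler_norm _) _.
by rewrite (bigD1 i)//= lerDl sumr_ge0.
Qed.

Lemma free_rank_one_subgroup : exists H : set (isom X),
  [/\ H `<=` G, free_of_rank2 H & forall h, H h -> h <> 1%g -> rank_one h].
Proof.
have [a [b [ca [cb [ta [tb [wa [wb [am [ap [bm [bp [[Ga Gb loxa loxb] n1 n2 n3 n4]]]]]]]]]]]]] :=
  rank_one_independent.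
pose g l : isom X := letter a b l.
pose c l : R -> X :=
  let c := if l.1 then ca else cb in if l.2 then c else reversed c.
pose tau (i : bool) := if i then ta else tb; pose om (i : bool) := if i then wa else wb.
pose pole l : curve X :=
  if l.1 then (if l.2 then ap else am) else (if l.2 then bp else bm).
have lox l : loxodromic o (g l) (c l) (tau l.1) (om l.1) (pole (inv_letter l)) (pole l).
  by case: l => -[] [] //=; apply: loxodromicV.
have na := loxodromic_neq loxa; have nb := loxodromic_neq loxb.
have pole_neq l m : l <> m -> pole l <> pole m.
  by case: l m => -[] [] [[] []] //= _; rewrite /pole /=; try by []; apply/nesym.
have [T1 hT1] : exists T, forall lm : (bool * bool) * (bool * bool), lm.1 <> lm.2 ->
    forall x, T <= proj (c lm.1) x -> T <= proj (c lm.2) x -> False.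
  apply: uniform_over_finite => [lm T T' TT' h ne x h1 h2|[l m] /=].
    by apply: (h ne x); exact: le_trans TT' _.
  have [lm|ne] := pselect (l = m); first by exists 0.
  have [T hT] := half_spaces_disjoint Xcat0 Xproper (lox l) (lox m) (pole_neq _ _ ne).
  by exists T.
have [T2 [K hT2]] : exists T K, forall lm : (bool * bool) * (bool * bool), lm.1 <> lm.2 ->
    forall x y, T <= proj (c lm.1) x -> T <= proj (c lm.2) y ->
    exists2 p, on_segment x y p & d o p <= K.
  (* One number serves as threshold and as distance, the property being monotone in each. *)
  suff [T hT] : exists T, forall lm : (bool * bool) * (bool * bool), lm.1 <> lm.2 ->
      forall x y, T <= proj (c lm.1) x -> T <= proj (c lm.2) y ->
      exists2 p, on_segment x y p & d o p <= T by exists T, T.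
  apply: uniform_over_finite => [lm T T' TT' h ne x y h1 h2|[l m] /=].
    have [p seg pT] := h ne x y (le_trans TT' h1) (le_trans TT' h2).
    by exists p => //; exact: le_trans TT'.
  have [lm|ne] := pselect (l = m); first by exists 0.
  have [T [K hT]] := half_spaces_visible Xcat0 Xproper (lox l) (lox m) (pole_neq _ _ ne).
  exists (Num.max T K) => _ x y; rewrite !ge_max => /andP[h1 _] /andP[h2 _].
  by have [p seg pK] := hT x y h1 h2; exists p => //; rewrite le_max pK orbT.
have cl l : geodesic_line (c l) by case: (lox l) => -[].
have [T3 hT3] : exists T, forall l x, T <= proj (c l) x -> Num.max 0 (2 * K) < d o x.
  apply: uniform_over_finite => [l T T' TT' h x h1|l].
    by apply: h; exact: le_trans TT' h1.
  exact: half_space_far.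
pose T := Num.max T1 (Num.max T2 T3).
have [t1 t2 t3] : [/\ T1 <= T, T2 <= T & T3 <= T].
  by rewrite /T !le_max !lexx !orbT.
(* A shift of projections by [2 * T] takes everything outside the half-space of the inverse letter,
   where projections exceed [- T], into the half-space of the letter. *)
have [Na hNa] := loxodromic_ge (2 * T) loxa; have [Nb hNb] := loxodromic_ge (2 * T) loxb.
pose n := maxn Na Nb.
have tau_n i : 2 * T <= tau i * n%:R.
  by case: i; [apply: hNa; exact: leq_maxl|apply: hNb; exact: leq_maxr].
pose A := (a ^+ n)%g; pose B := (b ^+ n)%g.
have gX l : letter A B l = (g l ^+ n)%g.
  by case: l => -[] []; rewrite /g /letter /= ?expVgn.
have c_inv l : c (inv_letter l) = reversed (c l).
  by case: l => -[] [] //=; rewrite /c /= rev_rev.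
have pp := @eval_word_ping_pong A B (fun l => [set x | T <= proj (c l) x]) K.
have {}pp : forall w, reduced_word w -> w != [::] ->
    rank_one (eval_word A B w) /\ eval_word A B w <> 1%g.
  apply: pp.
  - move=> l x /=; rewrite c_inv proj_rev// => h.
    have [tr _ _ _ _] := lox l.
    rewrite gX (proj_translateX Xcat0 _ _ tr); have := tau_n l.1.
    by move/negP: h; rewrite -ltNge; lra.
  - by move=> l m x ne /= h1 h2; apply: (hT1 (l, m) ne x); apply: le_trans t1 _.
  - by move=> l m x y ne /= h1 h2; apply: (hT2 (l, m) ne x y); apply: le_trans t2 _.
  - by move=> l x /= h; apply: (hT3 l); exact: le_trans t3 h.
exists (smallest (@subgroup _) [set A; B]); split.
- move=> h /(_ G); apply; split=> //.
  by move=> k [->|->]; exact: subgroupX.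
- exists A, B; split=> // w red w0; exact: (pp w red w0).2.
move=> h /smallest_subgroup_words[w red ->] ne.
have [w0|w0] := eqVneq w [::]; first by rewrite w0 in ne.
exact: (pp w red w0).1.
Qed.

End PingPong.

(** * From distances along rays to the topology of curves *)

Section Topology.
Variables (R : realType) (X : metricType R) (o : X).
Local Notation d := (@mdist R X).
Implicit Types (s t r e : R) (xi eta : curve X).
Hypothesis Xcat0 : cat0 X.

Lemma bd_dball_max xi eta r e : boundary o xi -> boundary o eta -> 0 < e ->
  d (pt eta (Num.max r 1)) (pt xi (Num.max r 1)) <= e / 2 -> dball xi r e eta.
Proof.
move=> xb eb e0 h t /andP[t0 tr].
have r0 : 0 < Num.max r 1 by rewrite lt_max ltr01 orbT.
apply: (bd_dball Xcat0 xb eb r0); last by rewrite t0 le_max tr.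
by rewrite metric_sym; lra.
Qed.

(** Closures in the theorem are taken among all curves, so a limit of boundary points must first be
    recognised as a ray from [o]. *)
Lemma bd_closed xi : closure (boundary o) xi -> boundary o xi.
Proof.
move=> /closure_dball cl; apply/boundaryP; split=> [s t s0 t0|].
  apply/eqP; rewrite eq_le; apply/andP; split; apply/ler_addgt0Pr => e e0.
    have e2 : 0 < e / 2 by lra.
    have [eta eb h] := cl (Num.max s t) _ e2.
    have := h s; have := h t; rewrite s0 t0 !le_max !lexx orbT => /(_ isT) ht /(_ isT) hs.
    have := bd_ray eb s0 t0; have := metric_triangle (pt xi s) (pt eta s) (pt xi t).
    have := metric_triangle (pt eta s) (pt eta t) (pt xi t).
    by rewrite (metric_sym (pt eta t) (pt xi t)); lra.
  have e2 : 0 < e / 2 by lra.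
  have [eta eb h] := cl (Num.max s t) _ e2.
  have := h s; have := h t; rewrite s0 t0 !le_max !lexx orbT => /(_ isT) ht /(_ isT) hs.
  have := bd_ray eb s0 t0; have := metric_triangle (pt eta s) (pt xi s) (pt eta t).
  have := metric_triangle (pt xi s) (pt xi t) (pt eta t).
  by rewrite (metric_sym (pt eta s) (pt xi s)); lra.
apply: (@mdist_positivity R); apply/eqP; rewrite eq_le mdist_ge0 andbT.
apply/ler_addgt0Pr => e e0; have [eta eb h] := cl 0 e e0.
have := h 0; rewrite lexx => /(_ isT); rewrite (bd0 eb); lra.
Qed.

End Topology.

Theorem theorem1p1 (R : realType) (X : metricType R) (G : set (isom X)) (o : X)
    (Xproper : proper_space X) (Xcat0 : cat0 X)
    (Gsubgroup : subgroup G) (Gnonelementary : ~ elementary o G)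
    (Grank_one : exists2 g, G g & rank_one g) :
  [/\ perfect_set (limit_set o G) /\
      (forall xi, limit_set o G xi ->
         dense_in (limit_set o G) (bd_orbit o G xi)),
      dense_in (off_diagonal (limit_set o G)) (rank_one_fixed_pairs o G),
      exists2 p, off_diagonal (limit_set o G) p &
        dense_in (off_diagonal (limit_set o G)) (bd_orbit2 o G p) &
      exists H : set (isom X),
        [/\ H `<=` G, free_of_rank2 H &
            forall h, H h -> h <> 1%g -> rank_one h] ].
Proof.
have lbd xi : limit_set o G xi -> boundary o xi by case.
have r1 r : 0 < Num.max r 1 :> R by rewrite lt_max ltr01 orbT.
have act := @limit_set_act _ _ G o Xcat0 Xproper Gsubgroup.
have clos xi : closure (limit_set o G) xi -> limit_set o G xi.
  move=> cl; have xb : boundary o xi.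
    by apply: bd_closed; apply: closureS cl => eta /lbd.
  apply: (limit_set_closed Xcat0 (C := 1) xb) => // t t0.
  have [eta Leta h] := (closure_dball _ _).1 cl t 1 ltr01.
  exists eta => //; rewrite metric_sym; apply/ltW/h.
  by rewrite ltW//=.
split.
- split; first split=> //.
    apply/seteqP; split=> [xi lp|xi Lxi].
      apply/clos/closure_dball => r e e0.
      have [eta [_ Leta h]] := (limit_point_dball _ _).1 lp r e e0.
      by exists eta.
    apply/limit_point_dball => r e e0; have e2 : 0 < e / 2 by lra.
    have [eta [Leta ne h]] :=
      limit_not_isolated Xcat0 Xproper Gsubgroup Gnonelementary Grank_one Lxi (r1 r) e2.
    by exists eta; split=> //; exact: (bd_dball_max Xcat0 (lbd _ Lxi) (lbd _ Leta)).
  move=> xi Lxi; split=> [_ [g Gg <-]|eta Leta]; first exact: act.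
  apply/closure_dball => r e e0; have e2 : 0 < e / 2 by lra.
  have [h Gh hh] := limit_minimal Xcat0 Xproper Gsubgroup Gnonelementary Grank_one
    (lbd _ Lxi) Leta (r1 r) e2.
  exists (bd_act o h xi); first by exists h.
  exact: (bd_dball_max Xcat0 (lbd _ Leta) (lbd _ (act _ _ Gh Lxi))).
- split=> [[p1 p2] [/= ne [g [Gg ro f1 f2]]]|[xi eta] [/= Lxi Leta ne]].
    have [c [tau [w [xm [xp lox]]]]] := rank_one_loxodromic o Xcat0 Xproper ro.
    have Lp := loxodromic_limit Xcat0 Xproper Gsubgroup Gg lox.
    have Lm := loxodromic_limit Xcat0 Xproper Gsubgroup (subgroupV Gsubgroup Gg) (loxodromicV lox).
    (* A rank-one element fixes only the two poles of its axis, so every pair of its fixed points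
       consists of limit points. *)
    have fixL z : bd_fixed o g z -> limit_set o G z.
      by move=> /(loxodromic_fixed_only Xcat0 Xproper lox)[|] ->.
    by split=> //=; exact: fixL.
  apply: closure_dball2 => r e e0; have e2 : 0 < e / 2 by lra.
  have [g [c [tau [w [xm [xp [Gg ro lox hm hp]]]]]]] :=
    rank_one_pair_near Xcat0 Xproper Gsubgroup Gnonelementary Grank_one Lxi Leta ne (r1 r) e2.
  have [_ _ _ [xmb _] [xpb _]] := lox.
  exists (xm, xp); split=> /=.
  + split=> /=; first exact: loxodromic_neq lox.
    exists g; split=> //; split=> //; last exact: loxodromic_fixed lox.
    by have := loxodromic_fixedV Xcat0 Xproper 1 lox; rewrite expg1.
  + exact: (bd_dball_max Xcat0 (lbd _ Lxi)).
  + exact: (bd_dball_max Xcat0 (lbd _ Leta)).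
- have [p1 [p2 [Lp1 Lp2 ne dense]]] :=
    limit_dense_orbit Xcat0 Xproper Gsubgroup Gnonelementary Grank_one.
  exists (p1, p2) => //; split=> [_ [g Gg <-]|[xi eta] [/= Lxi Leta _]].
    split=> /=; [exact: act|exact: act|].
    by move=> /(congr1 (bd_act o g^-1%g)); rewrite !bd_actK//; exact: lbd.
  apply: closure_dball2 => r e e0; have e2 : 0 < e / 2 by lra.
  have [h Gh [h1 h2]] := dense xi eta _ _ Lxi Leta (r1 r) e2.
  exists (bd_act o h p1, bd_act o h p2); split=> /=; first by exists h.
    exact: (bd_dball_max Xcat0 (lbd _ Lxi) (lbd _ (act _ _ Gh Lp1))).
  exact: (bd_dball_max Xcat0 (lbd _ Leta) (lbd _ (act _ _ Gh Lp2))).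
exact: (@free_rank_one_subgroup _ _ o Xcat0 Xproper G Gsubgroup Gnonelementary Grank_one).
Qed.
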